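(* Let $\beta_s=\lambda_s\big/\sqrt{\sum_{\ell=1}^{D}\lambda_\ell^2}$ for $s=1,\dots,D$ (and $\beta_s=0$ for $s>D$), where $\lambda_1\ge\dots\ge\lambda_D$ are the eigenvalues of $T V_N T$. Assume that the null hypothesis $\mathcal H_0(T): T\mu=0_D$ holds and that one of the asymptotic frameworks (F1), (F2), (F3) is in force. Then the following holds for the standardized quadratic form $\widetilde W_N$. (a) Let $(b_s)_{s\in\mathbb N}$ be a decreasing (i.e. non-increasing) sequence in $[0,1]$ with $\sum_s b_s^2\le 1$ and put $r:=\#\{s: b_s\neq 0\}$. Then $\widetilde W_N$ converges in distribution to $$\sum_{s=1}^r b_s\,\frac{C_s-1}{\sqrt 2}+\sqrt{1-\sum_{s=1}^r b_s^2}\cdot Z,$$ where $C_s$ are i.i.d. $\chi_1^2$-distributed and $Z\sim\mathcal N(0,1)$ is independent of $(C_s)_s$, if and only if $\beta_s\to b_s$ as $N\to\infty$ for all $s\in\mathbb N$. (b) Let $(b_s)_{s\in\mathbb N}$ be a decreasing sequence in $(0,1)$ with $\sum_{s=1}^\infty b_s^2=1$. If $\beta_s\to b_s$ as $N\to\infty$ for all $s\in\mathbb N$, then $\widetilde W_N$ converges in distribution to $\sum_{s=1}^\infty b_s (C_s-1)/\sqrt 2$ with $C_s$ i.i.d. $\chi_1^2$-distributed.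
   Context: Model: there are $a$ groups; in group $i\in\{1,\dots,a\}$ one observes independent random vectors $X_{i,j}\sim\mathcal N_{d_i}(\mu_i,\Sigma_i)$, $j=1,\dots,n_i$, with $\mu_i\in\mathbb R^{d_i}$ and $\Sigma_i\in\mathbb R^{d_i\times d_i}$ positive definite; all $X_{i,j}$ are independent. The dimensions $d_i$ may differ between groups. Put $N=\sum_{i=1}^a n_i$, $D=\sum_{i=1}^a d_i$, $\mu=(\mu_1^\top,\dots,\mu_a^\top)^\top\in\mathbb R^D$, $\overline X_i=n_i^{-1}\sum_{j=1}^{n_i}X_{i,j}$, $\overline X=(\overline X_1^\top,\dots,\overline X_a^\top)^\top$, and $V_N=\bigoplus_{i=1}^a \frac{N}{n_i}\Sigma_i$ (block diagonal). The hypothesis matrix $T\in\mathbb R^{D\times D}$ is a nonzero symmetric idempotent matrix. The quantities $a, d_i, n_i,\mu_i,\Sigma_i,T$ may all depend on $N$ (subject to the framework), and limits are along $N\to\infty$. Asymptotic frameworks: (F1) $a$ is fixed and $\min(\max(d_1,\dots,d_a),n_1,\dots,n_a)\to\infty$; (F2) all $d_i$ are fixed and $\min(a,n_1,\dots,n_a)\to\infty$; (F3) $\min(a,\max(d_1,\dots,d_a),n_1,\dots,n_a)\to\infty$. No relation between the growth of dimensions and sample sizes, and no convergence of $n_i/N$, is required. Test statistic: $Q_N=N\,\overline X^\top T\,\overline X$, and $$\widetilde W_N=\frac{Q_N-\operatorname{tr}(TV_N)}{\sqrt{2\operatorname{tr}((TV_N)^2)}},$$ where $\operatorname{tr}(TV_N)$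 and $2\operatorname{tr}((TV_N)^2)$ are the expectation and variance of $Q_N$ under $\mathcal H_0(T)$. *)

(* Defs.v *)
From HB Require Import structures.
From mathcomp Require Import all_boot all_order all_algebra.
From mathcomp Require Import all_classical all_reals all_analysis.

Set Implicit Arguments.
Unset Strict Implicit.
Unset Printing Implicit Defensive.

Import Order.TTheory GRing.Theory Num.Theory.
Import numFieldNormedType.Exports.

Local Open Scope classical_set_scope.
Local Open Scope ring_scope.

Definition has_law {d} {T : measurableType d} {R : realType}
    (P : probability T R) (X : T -> R) (nu : set R -> \bar R) : Prop :=
  forall A : set R, measurable A -> P (X @^-1` A) = nu A.

(* The normal law with mean m and variance v.  The library's normal_prob takes
   the standard deviation, and normal_prob m 0 is the uniform law on [0, 1],
   not the point mass at m. *)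
Definition normal_law {R : realType} (m v : R) : set R -> \bar R :=
  if v == 0 then \d_m else normal_prob m (Num.sqrt v).

Definition chi2_1 {R : realType} : set R -> \bar R :=
  fun A => normal_prob 0 1 ((fun x : R => x ^+ 2) @^-1` A).

Definition posdefmx {R : realType} {n : nat} (A : 'M[R]_n) : Prop :=
  A^T = A /\ forall u : 'cV[R]_n, u != 0 -> 0 < (u^T *m A *m u) 0 0.

Definition rvec {d} {T : measurableType d} {R : realType}
    {P : probability T R} {n : nat} (X : 'I_n -> {RV P >-> R}) (w : T) :
    'cV[R]_n := \col_c X c w.

(* X ~ N_n(mu, Sigma): every linear combination u^T X of the coordinates is
   univariate normal with mean u^T mu and variance u^T Sigma u. *)
Definition multivariate_normal {d} {T : measurableType d} {R : realType}
    (P : probability T R) {n : nat} (X : 'I_n -> {RV P >-> R})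
    (mu : 'cV[R]_n) (Sigma : 'M[R]_n) : Prop :=
  forall u : 'cV[R]_n,
    has_law P (fun w => (u^T *m rvec X w) 0 0)
      (normal_law ((u^T *m mu) 0 0) ((u^T *m Sigma *m u) 0 0)).

Definition sigma_rv {d} {T : measurableType d} {R : realType} {K : Type}
    (Y : K -> T -> R) : set (set T) :=
  <<s \bigcup_k preimage_set_system setT (Y k) measurable >>.

Definition mutually_independent {d} {T : measurableType d} {R : realType}
    (P : probability T R) {I : eqType} (F : I -> set (set T)) : Prop :=
  forall (J : seq I) (E : I -> set T), uniq J ->
    (forall i, i \in J -> F i (E i)) ->
    P (\bigcap_(i in [set` J]) E i) = (\prod_(i <- J) P (E i))%E.

Definition cvg_in_distribution {R : realType} {d : nat -> measure_display}
    {T : forall k, measurableType (d k)} (P : forall k, probability (T k) R)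
    (X : forall k, T k -> R) {d' : measure_display} {T' : measurableType d'}
    (P' : probability T' R) (Y : T' -> R) : Prop :=
  [/\ forall k, measurable_fun setT (X k),
      measurable_fun setT Y &
      forall f : R -> R, continuous f -> (exists B, forall x, `|f x| <= B) ->
        ('E_(P k)[f \o X k])%E @[k --> \oo] --> ('E_P'[f \o Y])%E].

Record model (R : realType) := Model {
  ngroups : nat;
  dim : 'I_ngroups -> nat;
  ssize : 'I_ngroups -> nat;
  mean : forall i, 'cV[R]_(dim i);
  cov : forall i, 'M[R]_(dim i);
  hyp : 'M[R]_(\sum_(i < ngroups) dim i);
  disp : measure_display;
  Omega : measurableType disp;
  prob : probability Omega R;
  obs : forall i, 'I_(ssize i) -> 'I_(dim i) -> {RV prob >-> R};
  dim_gt0 : forall i, (0 < dim i)%N;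
  ssize_gt0 : forall i, (0 < ssize i)%N;
  cov_posdef : forall i, posdefmx (cov i);
  hyp_neq0 : hyp != 0;
  hyp_sym : hyp^T = hyp;
  hyp_idem : hyp *m hyp = hyp;
  obs_normal : forall i (j : 'I_(ssize i)),
    multivariate_normal (obs j) (mean i) (cov i);
  obs_indep : mutually_independent prob
    (fun ij : {i : 'I_ngroups & 'I_(ssize i)} =>
       sigma_rv (fun c w => obs (tagged ij) c w))
}.

Section model_quantities.
Context {R : realType} (m : model R).

Definition total_dim : nat := (\sum_(i < ngroups m) dim i)%N.

Definition total_size : nat := (\sum_(i < ngroups m) ssize i)%N.

Definition max_dim : nat := (\max_(i < ngroups m) dim i)%N.

Definition full_mean : 'cV[R]_total_dim := \mxcol_(i < ngroups m) mean i.

Definition V_mx : 'M[R]_total_dim :=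
  \mxdiag_(i < ngroups m) ((total_size%:R / (ssize i)%:R) *: cov i).

Definition group_mean (i : 'I_(ngroups m)) (w : Omega m) : 'cV[R]_(dim i) :=
  (ssize i)%:R^-1 *: \sum_(j < ssize i) rvec (obs j) w.

Definition full_group_mean (w : Omega m) : 'cV[R]_total_dim :=
  \mxcol_(i < ngroups m) group_mean i w.

Definition Q_stat (w : Omega m) : R :=
  total_size%:R * ((full_group_mean w)^T *m hyp m *m full_group_mean w) 0 0.

Definition W_stat (w : Omega m) : R :=
  (Q_stat w - \tr (hyp m *m V_mx)) /
  Num.sqrt (2 * \tr ((hyp m *m V_mx) *m (hyp m *m V_mx))).

Definition H0 : Prop := hyp m *m full_mean = 0.

End model_quantities.

(* \big[minn/x]_i n_i is min(x, n_1, ..., n_a). *)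
Definition F1 {R : realType} (M : nat -> model R) : Prop :=
  (exists a : nat, forall k, ngroups (M k) = a) /\
  (\big[minn/max_dim (M k)]_(i < ngroups (M k)) ssize i)%N @[k --> \oo] --> \oo.

Definition F2 {R : realType} (M : nat -> model R) : Prop :=
  (exists d : nat -> nat, forall k (i : 'I_(ngroups (M k))), dim i = d i) /\
  (\big[minn/ngroups (M k)]_(i < ngroups (M k)) ssize i)%N @[k --> \oo] --> \oo.

Definition F3 {R : realType} (M : nat -> model R) : Prop :=
  (\big[minn/minn (ngroups (M k)) (max_dim (M k))]_(i < ngroups (M k))
     ssize i)%N @[k --> \oo] --> \oo.

(* s lists the eigenvalues of A with algebraic multiplicity, in non-increasing
   order; in particular size s = n. *)
Definition ordered_eigenvalues {R : realType} {n : nat} (A : 'M[R]_n)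
    (s : seq R) : Prop :=
  char_poly A = \prod_(x <- s) ('X - x%:P) /\ sorted >=%R s.

(* Sequences indexed by s = 1, 2, ... in the text are indexed from 0 here; the
   default value 0 of lam`_s gives beta lam s = 0 beyond the dimension. *)
Definition beta {R : realType} (lam : seq R) (s : nat) : R :=
  lam`_s / Num.sqrt (\sum_(x <- lam) x ^+ 2).

(* The number of nonzero terms of b, in {0, 1, ...} U {+oo}. *)
Definition num_nonzero {R : realType} (b : nat -> R) : \bar R :=
  counting [set s | b s != 0].

(* Sum of the first r terms of u, with r in {0, 1, ...} U {+oo}; for r = +oo,
   the limit of the partial sums. *)
Definition sum_upto {R : realType} (r : \bar R) (u : nat -> R) : R :=
  limn (fun m => \sum_(0 <= s < m | ((s.+1)%:R%:E <= r)%E) u s).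

Definition chi2_part {R : realType} {T : Type} (r : \bar R) (b : nat -> R)
    (C : nat -> T -> R) (w : T) : R :=
  sum_upto r (fun s => b s * ((C s w - 1) / Num.sqrt 2)).

Definition limit_variable {R : realType} {T : Type} (b : nat -> R)
    (C : nat -> T -> R) (Z : T -> R) (w : T) : R :=
  let r := num_nonzero b in
  chi2_part r b C w +
  Num.sqrt (1 - sum_upto r (fun s => b s ^+ 2)) * Z w.

(* Main.v *)
Require Import Defs.
From mathcomp Require Import all_boot all_order all_algebra.
From mathcomp Require Import all_classical all_reals all_analysis.
From mathcomp Require Import measurable_realfun ring lra.
Import Order.TTheory GRing.Theory Num.Theory.
Import numFieldNormedType.Exports.
Local Open Scope classical_set_scope.
Local Open Scope ring_scope.

Set Implicit Arguments.
Unset Strict Implicit.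
Unset Printing Implicit Defensive.

(** Under the null hypothesis the statistic is a normalized sum of independent
    centred chi-square variables whose weights are the [beta (lam k) s], so that
    the theorem is one about weighted sums [\sum_s be k s * xi s] with
    [xi s = (C s - 1) / sqrt 2], nonincreasing weights and
    [\sum_s be k s ^+ 2 = 1].

    This reduction uses Laplace transforms.  Linear forms of the group means are
    normal, and a Gaussian factor [expR (- th * y ^+ 2 / 2)] is itself the
    characteristic function of a normal variable; by Fubini's theorem the
    Laplace transform of the quadratic form thus only involves characteristic
    functions of linear forms.  In an eigenbasis of [T V T], which exists by the
    spectral theorem ([symmetric_spectral]), it is a product
    ([Rintegral_gauss_quadratic], [Q_laplace]), the same as for a chi-square
    sum.  A Laplace transform determines the law of a nonnegative variable
    ([laplace_inversion], by Bernstein polynomials in [expR (- x)]), so that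
    all statistics can be realized on the probability space of the limit
    ([W_law], [W_cvg_in_distributionE]).

    If the weights converge to [b], fix [m] and replace the terms from [m] on by
    a normal variable of the same variance.  As a standardized chi-square and a
    standard normal variable have the same first two moments, Lindeberg's
    replacement method bounds the change of the characteristic function by a
    multiple of [\sum_(s >= m) be k s ^+ 3 <= be k m <= (m + 1) ^ (- 1 / 2)],
    uniformly in [k] ([lindeberg], [normal_tail_error]).  What is left depends
    continuously on finitely many weights ([normal_tail_continuous]).  The same
    estimate holds for the limit, whose series converges almost surely by
    Kolmogorov's maximal inequality ([block_cvg]), and convergence of
    characteristic functions, together with the bound on the second moments,
    gives convergence in distribution ([cosine_cvg_distribution]).

    Conversely, let the weighted sums converge in distribution to the limit
    variable with weights [b].  The exponential moments of order [2 * th] are at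
    most [expR (2 * th ^+ 2)], so that by uniform integrability those of order
    [th] converge.  Their logarithms are [th ^+ 2 / 2 - rsum 3 / 2], where [rsum 3]
    is the sum of the third order Taylor remainders of [ln] at the scaled
    weights ([std_chi2_laplace], [series_laplace]): a possible normal part only
    contributes to the quadratic term.  Letting the scale tend to zero, the
    power sums [\sum_s be k s ^+ m] converge for all [m >= 3], one after the other
    ([psums_cvg_rsum]), and the power sums determine the largest weight, then
    the second largest, and so on ([weights_cvg_psum]). *)

(** * Bernstein polynomials and uniform approximation *)

Section bernstein.
Context {R : realType}.
Implicit Types (f : R -> R) (g h : nat -> R) (x y a b c d e M : R).

(** The value at [x] is the expectation of [g] at the number of successes in
    [n] trials of success probability [x]; the recursion conditions on the
    first trial. *)
Fixpoint bern (n : nat) (g : nat -> R) : {poly R} :=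
  if n is n'.+1 then 'X * bern n' (g \o S) + (1 - 'X) * bern n' g
  else (g 0%N)%:P.

Lemma bernS n g x :
  (bern n.+1 g).[x] = x * (bern n (g \o S)).[x] + (1 - x) * (bern n g).[x].
Proof. by rewrite /= !hornerE. Qed.

Lemma bernZD n a g h x :
  (bern n (fun k => a * g k + h k)).[x] = a * (bern n g).[x] + (bern n h).[x].
Proof.
elim: n g h => [|n IH] g h; first by rewrite /= !hornerE.
rewrite !bernS (IH (g \o S) (h \o S)) IH; ring.
Qed.

Lemma bern_le n g h x : 0 <= x <= 1 ->
  (forall k, (k <= n)%N -> g k <= h k) -> (bern n g).[x] <= (bern n h).[x].
Proof.
move=> /andP[x0 x1]; elim: n g h => [|n IH] g h gh.
  by rewrite /= !hornerE gh.
rewrite !bernS lerD// ler_wpM2l ?subr_ge0// IH// => k kn; apply: gh => //.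
exact: leq_trans kn _.
Qed.

Lemma bern_cst n c x : (bern n (fun=> c)).[x] = c.
Proof.
elim: n => [|n IH]; first by rewrite /= !hornerE.
rewrite bernS (_ : _ \o S = fun=> c)// IH; ring.
Qed.

(** The second moment about [c] of the binomial law, read off the recursion. *)
Lemma bern_sq n (c : R) x :
  (bern n (fun k => (k%:R - c) ^+ 2)).[x]
  = (n%:R * x - c) ^+ 2 + n%:R * (x * (1 - x)).
Proof.
elim: n c => [|n IH] c; first by rewrite /= !hornerE; ring.
rewrite bernS; set u := (fun k => _) \o S.
have -> : u = (fun k => (k%:R - (c - 1)) ^+ 2).
  by apply/funext => k; rewrite /u /= -natr1; congr (_ ^+ 2); ring.
rewrite !IH -natr1; ring.
Qed.

Definition bernstein n f := bern n (fun k => f (k%:R / n%:R)).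

Lemma bernstein_bound n f M x : 0 <= x <= 1 ->
  (forall y : R, 0 <= y <= 1 -> `|f y| <= M) -> `|(bernstein n f).[x]| <= M.
Proof.
move=> x01 fM.
have fM' k : (k <= n)%N -> - M <= f (k%:R / n%:R) <= M.
  move=> kn; rewrite -ler_norml; apply: fM.
  have [->|n0] := eqVneq n 0%N; first by rewrite invr0 mulr0 lexx ler01.
  by rewrite divr_ge0//= ler_pdivrMr ?ltr0n ?lt0n// mul1r ler_nat.
rewrite ler_norml -{1}(bern_cst n (- M) x) -{2}(bern_cst n M x).
by rewrite !bern_le// => k /fM'/andP[].
Qed.

(** Chebyshev's inequality for the binomial law controls the points far from
    [x]. *)
Lemma bernstein_error n f M e d x : (0 < n)%N -> 0 <= x <= 1 -> 0 < d ->
  0 <= e -> (forall y : R, 0 <= y <= 1 -> `|f y| <= M) ->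
  (forall y : R, 0 <= y <= 1 -> `|y - x| < d -> `|f y - f x| <= e) ->
  `|(bernstein n f).[x] - f x| <= e + 2 * M / d ^+ 2 / n%:R.
Proof.
move=> n0 x01 d0 e0 fM fe; have nR : 0 < n%:R :> R by rewrite ltr0n.
have M0 : 0 <= M by apply: le_trans (normr_ge0 _) (fM _ x01).
pose K := 2 * M / d ^+ 2 / n%:R ^+ 2.
have K0 : 0 <= K by rewrite /K divr_ge0 ?sqr_ge0// divr_ge0 ?sqr_ge0// mulr_ge0.
have hk k : (k <= n)%N ->
    `|f (k%:R / n%:R) - f x| <= K * (k%:R - n%:R * x) ^+ 2 + e.
  move=> kn.
  have k01 : 0 <= (k%:R / n%:R : R) <= 1.
    by rewrite divr_ge0//= ler_pdivrMr// mul1r ler_nat.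
  have [lt|ge] := ltP `|k%:R / n%:R - x| d.
    by rewrite (le_trans (fe _ k01 lt))// lerDr mulr_ge0// sqr_ge0.
  rewrite (le_trans (ler_normB _ _))//.
  apply: (@le_trans _ _ (2 * M)); first by rewrite (_ : 2 * M = M + M) ?lerD ?fM//; ring.
  rewrite -[leLHS]addr0 lerD//.
  have -> : K * (k%:R - n%:R * x) ^+ 2 = 2 * M * ((k%:R / n%:R - x) ^+ 2 / d ^+ 2).
    by rewrite /K; field; rewrite gt_eqF//= gt_eqF.
  rewrite ler_peMr ?mulr_ge0// ler_pdivlMr ?exprn_gt0// mul1r.
  by rewrite -[leRHS]real_normK ?num_real// lerXn2r ?nnegrE// ltW.
have e1 : (bern n (fun k => K * (k%:R - n%:R * x) ^+ 2 + e)).[x]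
      <= e + 2 * M / d ^+ 2 / n%:R.
  rewrite bernZD bern_sq bern_cst addrC lerD2l subrr expr0n/= add0r.
  have -> : K * (n%:R * (x * (1 - x))) = 2 * M / d ^+ 2 / n%:R * (x * (1 - x)).
    by rewrite /K; field; rewrite gt_eqF//= gt_eqF.
  case/andP: x01 => x0 x1.
  apply: ler_piMr; first by rewrite divr_ge0// divr_ge0 ?sqr_ge0// mulr_ge0.
  by apply: mulr_ile1; rewrite ?subr_ge0// lerBlDr lerDl.
have dif : (bernstein n f).[x] - f x =
    (bern n (fun k => f (k%:R / n%:R) - f x)).[x].
  have := bernZD n 1 (fun k => f (k%:R / n%:R)) (fun=> - f x) x.
  rewrite bern_cst mul1r => <-; congr (bern n _).[x].
  by apply/funext => k; rewrite mul1r.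
rewrite dif ler_norml; apply/andP; split; last first.
  apply: le_trans e1; apply: bern_le => // k kn.
  exact: le_trans (ler_norm _) (hk _ kn).
rewrite lerNl; apply: le_trans e1.
have -> : - (bern n (fun k => f (k%:R / n%:R) - f x)).[x] =
    (bern n (fun k => -1 * (f (k%:R / n%:R) - f x) + 0)).[x].
  by rewrite bernZD bern_cst; ring.
apply: bern_le => // k kn; rewrite addr0 mulN1r.
by apply: le_trans (hk _ kn); rewrite -normrN ler_norm.
Qed.

(** Pointwise convergence needs continuity at the point only; this is what lets
    the Laplace transform be inverted without any behaviour at infinity. *)
Lemma bernstein_cvg f M x : 0 <= x <= 1 -> {for x, continuous f} ->
  (forall y : R, 0 <= y <= 1 -> `|f y| <= M) ->
  (bernstein n f).[x] @[n --> \oo] --> f x.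
Proof.
move=> x01 fx fM; have M0 : 0 <= M by apply: le_trans (normr_ge0 _) (fM _ x01).
apply/cvgrPdist_le => e e0.
have e20 : 0 < e / 2 by rewrite divr_gt0.
move/cvgrPdist_le : fx => /(_ _ e20)/nbhs_ballP[d /= d0 dP].
near=> n; rewrite distrC.
apply: le_trans (@bernstein_error n f M (e / 2) d x _ x01 d0 (ltW e20) fM _) _.
- by near: n; exact: nbhs_infty_gt.
- by move=> y _ yx; rewrite distrC; apply: dP; rewrite /ball/= distrC.
- rewrite {2}(splitr e) lerD2l ler_pdivrMr; last first.
    by rewrite ltr0n; near: n; exact: nbhs_infty_gt.
  by rewrite [leRHS]mulrC -ler_pdivrMr//; near: n; exact: nbhs_infty_ger.
Unshelve. all: by end_near. Qed.

Lemma uniformly_continuous_itv f a b e : continuous f -> 0 < e ->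
  exists2 d, 0 < d & forall x y, a <= x <= b -> `|y - x| < d ->
    `|f y - f x| <= e.
Proof.
move=> fc e0.
have /compact_near_coveringP cov := @segment_compact R a b.
pose P (d x : R) := forall y, `|y - x| < d -> `|f y - f x| <= e.
have := cov R 0^'+ P _.
have H : forall x : R, `[a, b]%classic x ->
    \forall x' \near x & i \near 0^'+, P i x'.
  move=> x _; have e20 : 0 < e / 2 by rewrite divr_gt0.
  have /cvgrPdist_le/(_ _ e20) := fc x; move=> /nbhs_ballP[d /= d0 dP].
  exists (ball x (d / 2), [set i | i <= d / 2]).
    split => /=; first by apply: nbhsx_ballx; rewrite divr_gt0.
    by apply: nbhs_right_le; rewrite divr_gt0.
  move=> [x' i]/= [xx' id] y yx'.
  have h1 : `|f x - f x'| <= e / 2.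
    by apply: dP; move: xx'; rewrite /ball/= => /lt_trans; apply; lra.
  have h2 : `|f x - f y| <= e / 2.
    apply: dP; move: xx'; rewrite /ball/= => xx'.
    rewrite (splitr d) (le_lt_trans (ler_distD x' _ _))// ltrD//.
    by rewrite distrC (lt_le_trans yx').
  by rewrite (le_trans (ler_distD (f x) _ _))// (splitr e) lerD// distrC.
move=> /(_ _ H) nr.
have [d [d0 dP]] : exists d : R, 0 < d /\ (forall x, `[a, b]%classic x -> P d x).
  have : \forall d \near (0 : R)^'+, 0 < d /\ (`[a, b]%classic `<=` P d).
    near=> d; split; first by near: d; exact: nbhs_right_gt.
    by near: d; exact: nr.
  by move=> /filter_ex[d [d0 dP]]; exists d.
exists d => // x y xab; apply: dP; by rewrite /= in_itv.
Unshelve. all: by end_near. Qed.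

Theorem weierstrass f e : continuous f -> 0 < e ->
  exists p : {poly R}, forall x, 0 <= x <= 1 -> `|p.[x] - f x| <= e.
Proof.
move=> fc e0; have e20 : 0 < e / 2 by rewrite divr_gt0.
have [d d0 dP] := uniformly_continuous_itv 0 1 fc e20.
have [M fM] : exists M, forall y, 0 <= y <= 1 -> `|f y| <= M.
  have cont : {within `[0 : R, 1], continuous (fun x => `|f x|)}.
    apply: continuous_subspaceT => x.
    by apply: continuous_comp; [exact: fc|exact: norm_continuous].
  have [c _ cP] := EVT_max ler01 cont.
  by exists `|f c| => y y01; apply: cP; rewrite in_itv.
pose n := (Num.truncn (2 * M / d ^+ 2 / (e / 2))).+1.
exists (bernstein n f) => x x01.
apply: le_trans (@bernstein_error n f M (e / 2) d x _ x01 d0 (ltW e20) fM _) _ => //.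
  by move=> y y01 yx; apply: dP.
rewrite {2}(splitr e) lerD2l ler_pdivrMr ?ltr0n// [leRHS]mulrC -ler_pdivrMr//.
by rewrite ltW// truncnS_gt.
Qed.

End bernstein.

(** * Integrals on a probability space *)

Section expectation.
Context d {T : measurableType d} {R : realType} (P : probability T R).
Implicit Types (f g : T -> R).

Lemma bounded_integrable f (B : R) : measurable_fun setT f ->
  (forall w, `|f w| <= B) -> P.-integrable setT (EFin \o f).
Proof.
move=> mf fB; apply: measurable_bounded_integrable => //.
  by rewrite (le_lt_trans (probability_le1 P _))// ltry.
exists B; split; first exact: num_real.
by move=> M /ltW BM w _; apply: le_trans (fB w) BM.
Qed.

Lemma prob_integrable_cst (c : R) : P.-integrable setT (EFin \o (fun=> c)).
Proof. exact: (@bounded_integrable _ `|c|). Qed.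

Lemma measurable_cos : measurable_fun setT (@cos R).
Proof. exact: continuous_measurable_fun (@continuous_cos R). Qed.

Lemma measurable_sin : measurable_fun setT (@sin R).
Proof. exact: continuous_measurable_fun (@continuous_sin R). Qed.

Lemma cos_affine_measurable (a t : R) f : measurable_fun setT f ->
  measurable_fun setT (fun w => cos (a + t * f w)).
Proof.
move=> mf; apply: (measurableT_comp measurable_cos).
by apply: measurable_funD => //; exact: measurable_funM.
Qed.

Lemma cos_affine_integrable (a t : R) f : measurable_fun setT f ->
  P.-integrable setT (EFin \o (fun w => cos (a + t * f w))).
Proof.
move=> mf; apply: (@bounded_integrable _ 1); first exact: cos_affine_measurable.
by move=> w; exact: cos_max.
Qed.

Lemma integrable_scale (c : R) f : P.-integrable setT (EFin \o f) ->
  P.-integrable setT (EFin \o (fun w => c * f w)).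
Proof.
move=> fi; have -> : EFin \o (fun w => c * f w) = (fun w => c%:E * (EFin \o f) w)%E.
  by apply/funext => w /=; rewrite EFinM.
exact: integrableZl.
Qed.

Lemma integrable_add f g : P.-integrable setT (EFin \o f) ->
  P.-integrable setT (EFin \o g) ->
  P.-integrable setT (EFin \o (fun w => f w + g w)).
Proof.
move=> fi gi; have -> : EFin \o (fun w => f w + g w) = ((EFin \o f) \+ (EFin \o g))%E.
  by apply/funext => w /=; rewrite EFinD.
exact: integrableD.
Qed.

Lemma integrable_sub f g : P.-integrable setT (EFin \o f) ->
  P.-integrable setT (EFin \o g) ->
  P.-integrable setT (EFin \o (fun w => f w - g w)).
Proof.
move=> fi gi; have -> : EFin \o (fun w => f w - g w) = ((EFin \o f) \- (EFin \o g))%E.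
  by apply/funext => w /=; rewrite EFinB.
exact: integrableB.
Qed.

Lemma Rintegral_prob_cst (c : R) : \int[P]_w c = c.
Proof. rewrite Rintegral_cst// -[RHS]mulr1; congr (_ * _).
by transitivity (fine (1 : \bar R)%E) => //; congr fine; exact: probability_setT. Qed.

Lemma expectationE f : P.-integrable setT (EFin \o f) ->
  ('E_P[f])%E = (\int[P]_w f w)%:E.
Proof.
by move=> fi; rewrite unlock /Rintegral fineK// integrable_fin_num.
Qed.

Lemma RintegralDprob f g : P.-integrable setT (EFin \o f) ->
  P.-integrable setT (EFin \o g) ->
  \int[P]_w (f w + g w) = \int[P]_w f w + \int[P]_w g w.
Proof. exact: RintegralD. Qed.

Lemma Rintegral_bounded_cvg (f_ : nat -> T -> R) f (B : R) :
  (forall n, measurable_fun setT (f_ n)) -> measurable_fun setT f ->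
  (forall n w, `|f_ n w| <= B) ->
  {ae P, forall w, f_ n w @[n --> \oo] --> f w} ->
  \int[P]_w f_ n w @[n --> \oo] --> \int[P]_w f w.
Proof.
move=> mf_ mf fB ff.
have [] := @dominated_convergence _ _ _ P setT measurableT
  (fun n => EFin \o f_ n) (EFin \o f) (EFin \o cst B).
- by move=> n; exact/measurable_EFinP.
- exact/measurable_EFinP.
- apply: filterS ff => w fw _; apply: cvg_EFin; [exact: filterE|exact: fw].
- apply: (@bounded_integrable _ `|B|) => //.
- by apply: filterE => w n _; rewrite /= lee_fin.
- move=> fi _ h; apply: (@fine_cvg _ _ _ _ (fun n => \int[P]_w (f_ n w)%:E)%E).
  by rewrite /Rintegral fineK// integrable_fin_num.
Qed.

Lemma Rintegral_dist f g (h : T -> R) : P.-integrable setT (EFin \o f) ->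
  P.-integrable setT (EFin \o g) -> P.-integrable setT (EFin \o h) ->
  (forall w, `|f w - g w| <= h w) ->
  `|\int[P]_w f w - \int[P]_w g w| <= \int[P]_w h w.
Proof.
move=> fi gi hi fgh; rewrite -RintegralB//.
have fgi := integrable_sub fi gi.
apply: le_trans (le_normr_Rintegral measurableT fgi) _.
apply: le_Rintegral => // .
exact: integrable_norm.
Qed.

End expectation.

(** * Uniqueness of the Laplace transform *)

Section laplace_inversion.
Context {R : realType} d (T : measurableType d) (P : probability T R)
  d' (T' : measurableType d') (P' : probability T' R).

Lemma horner_bounded01 (p : {poly R}) :
  exists B : R, forall x, 0 <= x <= 1 -> `|p.[x]| <= B.
Proof.
elim/poly_ind: p => [|p c [B pB]]; first by exists 0 => x _; rewrite hornerE normr0.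
exists (B + `|c|) => x x01; rewrite !hornerE (le_trans (ler_normD _ _))// lerD2r.
apply: le_trans (pB _ x01); rewrite normrM ler_piMr//.
by case/andP: x01 => x0 x1; rewrite ger0_norm.
Qed.

Lemma moments_polynomials (U : T -> R) (U' : T' -> R) :
  measurable_fun setT U -> measurable_fun setT U' ->
  (forall w, 0 <= U w <= 1) -> (forall w, 0 <= U' w <= 1) ->
  (forall n, \int[P]_w (U w ^+ n) = \int[P']_w (U' w ^+ n)) ->
  forall p : {poly R}, \int[P]_w p.[U w] = \int[P']_w p.[U' w].
Proof.
move=> mU mU' U01 U'01 UU' p.
(* The factor [U w ^+ m] makes the induction on the polynomial go through. *)
suff H m : \int[P]_w (p.[U w] * U w ^+ m) = \int[P']_w (p.[U' w] * U' w ^+ m).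
  have := H 0%N; congr (_ = _);
    by apply: eq_Rintegral => w _; rewrite expr0 mulr1.
have int e (S : measurableType e) (Q : probability S R) (V : S -> R) (q : {poly R}) n :
    measurable_fun setT V -> (forall w, 0 <= V w <= 1) ->
    Q.-integrable setT (EFin \o (fun w => q.[V w] * V w ^+ n)).
  move=> mV V01; have [B qB] := horner_bounded01 (q * 'X^n).
  apply: (@bounded_integrable _ _ _ _ _ B).
    apply: measurable_funM; last exact: measurable_funX.
    apply: measurableT_comp => //; apply: continuous_measurable_fun.
    exact: continuous_horner.
  by move=> w; have := qB _ (V01 w); rewrite hornerM hornerXn.
elim/poly_ind: p m => [|p c IH] m.
  under eq_Rintegral do rewrite hornerE mul0r.
  under [RHS]eq_Rintegral do rewrite hornerE mul0r.
  by rewrite !Rintegral_prob_cst.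
have E (x : R) : (p * 'X + c%:P).[x] * x ^+ m
    = p.[x] * x ^+ m.+1 + c * ((1 : {poly R}).[x] * x ^+ m).
  by rewrite hornerMXaddC hornerC exprS mul1r mulrDl mulrA.
under eq_Rintegral do rewrite E.
under [RHS]eq_Rintegral do rewrite E.
rewrite !RintegralDprob ?RintegralZl//; try exact: int;
  try by apply: integrable_scale; exact: int.
rewrite IH; congr (_ + _ * _).
under eq_Rintegral do rewrite hornerE mul1r.
by under [RHS]eq_Rintegral do rewrite hornerE mul1r.
Qed.

(** With [U = expR (- X)], the hypothesis says that [U] and [U'] have the same
    moments, hence the same integrals of Bernstein polynomials. *)
Lemma laplace_inversion (X : T -> R) (X' : T' -> R) :
  measurable_fun setT X -> measurable_fun setT X' ->
  (forall w, 0 <= X w) -> (forall w, 0 <= X' w) ->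
  (forall n : nat, \int[P]_w expR (- (n%:R * X w))
                 = \int[P']_w expR (- (n%:R * X' w))) ->
  forall (f : R -> R) (B : R), continuous f -> (forall x, `|f x| <= B) ->
  \int[P]_w f (X w) = \int[P']_w f (X' w).
Proof.
move=> mX mX' X0 X'0 XX' f B fc fB.
pose g (u : R) := f (- ln u).
have gB y : 0 <= y <= 1 -> `|g y| <= B by move=> _; exact: fB.
have U01 e (S : measurableType e) (V : S -> R) : (forall w, 0 <= V w) ->
    forall w, 0 <= expR (- V w) <= 1.
  by move=> V0 w; rewrite expR_ge0 -expR0 ler_expR oppr_le0 V0.
have cvg e (S : measurableType e) (Q : probability S R) (V : S -> R) :
    measurable_fun setT V -> (forall w, 0 <= V w) ->
    \int[Q]_w (bernstein n g).[expR (- V w)] @[n --> \oo] --> \int[Q]_w f (V w).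
  move=> mV V0; apply: (@Rintegral_bounded_cvg _ _ _ _ _ _ B).
  - move=> n; apply: measurableT_comp; last first.
      by apply: measurableT_comp => //; exact: measurable_funN.
    by apply: continuous_measurable_fun; exact: continuous_horner.
  - by apply: measurableT_comp => //; exact: continuous_measurable_fun.
  - by move=> n w; apply: bernstein_bound => //; exact: U01.
  - apply: filterE => w.
    have -> : f (V w) = g (expR (- V w)) by rewrite /g expRK opprK.
    apply: (@bernstein_cvg _ g B) => //; first exact: U01.
    apply: (continuous_comp _ (fc _)).
    apply: (@continuous_comp _ _ _ (@ln R)); last exact: opp_continuous.
    by apply: continuous_ln; rewrite expR_gt0.
have := cvg _ _ P X mX X0.
have -> : (fun n => \int[P]_w (bernstein n g).[expR (- X w)]) =
          (fun n => \int[P']_w (bernstein n g).[expR (- X' w)]).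
  apply/funext => n; apply: (@moments_polynomials
    (fun w => expR (- X w)) (fun w => expR (- X' w))).
  - by apply: measurableT_comp => //; apply: measurableT_comp.
  - by apply: measurableT_comp => //; apply: measurableT_comp.
  - exact: U01.
  - exact: U01.
  - move=> k; under eq_Rintegral do rewrite -expRM_natl mulrN.
    by rewrite XX'; apply: eq_Rintegral => w _; rewrite -expRM_natl mulrN.
by move=> /cvg_lim <- //; rewrite (cvg_lim _ (cvg _ _ P' X' mX' X'0)).
Qed.

End laplace_inversion.

(** * Convergence in distribution from characteristic functions *)

Section trigonometric_approximation.
Context {R : realType}.
Implicit Types (f : R -> R) (x y a t A B e r : R).

(** Keeps the argument of [asin] inside the open interval where it is
    continuous. *)
Let clamp r x : R := Num.max (- r) (Num.min r x).

Let clamp_id r x : - r <= x <= r -> clamp r x = x.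
Proof.
by move=> /andP[rx xr]; rewrite /clamp (min_idPr xr) (max_idPr rx).
Qed.

Let clamp_itv r x : 0 <= r -> - r <= clamp r x <= r.
Proof.
move=> r0; rewrite /clamp le_max lexx/= ge_max ge_min lexx/=.
by rewrite andbT (le_trans _ r0)// oppr_le0.
Qed.

Let clamp_continuous r : continuous (clamp r).
Proof.
move=> x; apply: (@continuous_max R R (fun=> - r) (fun y => Num.min r y) x).
  exact: cst_continuous.
apply: (@continuous_min R R (fun=> r) (fun y => y) x) => //.
exact: cst_continuous.
Qed.

(** On [[-A, A]] the map [x |-> sin (x / A)] is invertible, so that [f] is
    there a continuous function of [sin (x / A)], which is close to a
    polynomial in it; off this interval only the boundedness of the polynomial
    on [[-1, 1]] matters. *)
Lemma sine_polynomial_approx f A B e : continuous f -> (forall x, `|f x| <= B) ->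
  0 < A -> 0 < e <= 1 ->
  exists q : {poly R}, forall x,
    `|q.[sin (A^-1 * x)] - f x| <= e + (2 * B + 1) * (A^-1 * x) ^+ 2.
Proof.
move=> fc fB A0 /andP[e0 e1].
have B0 : 0 <= B by apply: le_trans (normr_ge0 _) (fB 0).
have B1 : 0 <= 2 * B + 1 by rewrite addr_ge0// mulr_ge0.
have pi2 : 1 <= pi / 2 :> R by rewrite ler_pdivlMr// mul1r pi_ge2.
have pi2' : 1 < pi :> R by have := pi_ge2 R; lra.
have in01 y : - 1 <= y <= 1 -> y \in `[- (pi / 2), pi / 2].
  by move=> /andP[y1 y2]; rewrite in_itv/= (le_trans y2)// andbT (le_trans _ y1)// lerN2.
have le_sin x y : - 1 <= x -> x <= y -> y <= 1 -> sin x <= sin y.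
  move=> x1 xy y1; move: (xy); rewrite le_eqVlt => /predU1P[->//|xy'].
  rewrite ltW// ltr_sin//; apply: in01; first by rewrite x1 (le_trans xy).
  by rewrite (le_trans x1).
pose r := sin 1 : R.
have r0 : 0 <= r by rewrite /r sin_ge0_pi// ler01 ltW.
have r1 : r < 1.
  rewrite lt_neqAle sin_le1 andbT; apply/eqP => r1.
  by have := cos1_gt0 R; rewrite (@sin1cos0 _ 1) ?ltxx// -/r r1 normr1.
pose g (u : R) := f (A * asin (clamp r (2 * u - 1))).
have gc : continuous g.
  move=> u.
  have c1 : {for u, continuous (fun u : R => clamp r (2 * u - 1))}.
    apply: (@continuous_comp _ _ _ (fun u : R => 2 * u - 1) (clamp r)).
      by apply: cvgB; [apply: cvgMl_tmp; exact: cvg_id|exact: cvg_cst].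
    exact: clamp_continuous.
  have c2 : {for u, continuous (fun u : R => asin (clamp r (2 * u - 1)))}.
    apply: (@continuous_comp _ _ _ (fun u : R => clamp r (2 * u - 1)) asin) => //.
    apply: continuous_asin; have := clamp_itv (2 * u - 1) r0; lra.
  apply: (@continuous_comp _ _ _ (fun u : R => A * asin (clamp r (2 * u - 1))) f).
    by apply: cvgMl_tmp; exact: c2.
  exact: fc.
have [p pP] := weierstrass gc e0.
exists (p \Po (2^-1 *: (1 + 'X))) => x.
set s := sin (A^-1 * x).
have s1 : -1 <= s <= 1 by rewrite sin_geN1 sin_le1.
rewrite horner_comp hornerZ hornerD hornerC hornerX; set u := 2^-1 * (1 + s).
have u01 : 0 <= u <= 1 by rewrite /u; lra.
have us : 2 * u - 1 = s by rewrite /u mulrA divff// mul1r addrAC subrr add0r.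
have [xA|xA] := leP `|A^-1 * x| 1.
  have gx : g u = f x.
    move: xA; rewrite ler_norml => xA.
    rewrite /g us clamp_id; last first.
      by case/andP: xA => x1 x2; rewrite /s /r -sinN !le_sin.
    by rewrite /s sinK ?in01// mulrA divff ?mul1r// gt_eqF.
  rewrite -gx (le_trans (pP _ u01))// lerDl; apply: mulr_ge0 => //; exact: sqr_ge0.
have x2 : 1 <= (A^-1 * x) ^+ 2.
  rewrite -[leRHS]real_normK ?num_real//.
  by rewrite exprn_ege1// ltW.
apply: (@le_trans _ _ (2 * B + 1)); last first.
  rewrite -[leLHS]add0r lerD ?(ltW e0)// ler_peMr//.
have pu : `|p.[u]| <= B + 1.
  rewrite -[p.[u]](subrK (g u)) (le_trans (ler_normD _ _))// addrC lerD ?fB//.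
  exact: le_trans (pP _ u01) e1.
rewrite (le_trans (ler_normB _ _))// (_ : 2 * B + 1 = (B + 1) + B) ?lerD//.
ring.
Qed.

Context (d : nat -> measure_display) (T : forall k, measurableType (d k))
  (P : forall k, probability (T k) R) (X : forall k, T k -> R)
  d' (T' : measurableType d') (P' : probability T' R) (Y : T' -> R).
Arguments X : clear implicits.
Hypothesis mX : forall k, measurable_fun setT (X k).
Hypothesis mY : measurable_fun setT Y.
Hypothesis cosXY : forall a t,
  \int[P k]_w cos (a + t * X k w) @[k --> \oo] --> \int[P']_w cos (a + t * Y w).

Let measurable_sine (e : measure_display) (S : measurableType e) (V : S -> R) (q : {poly R}) c :
  measurable_fun setT V -> measurable_fun setT (fun w => q.[sin (c * V w)]).
Proof.
move=> mV; apply: measurableT_comp; first by apply: continuous_measurable_fun; exact: continuous_horner.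
apply: measurableT_comp; first exact: measurable_sin.
exact: measurable_funM.
Qed.

Lemma horner_sine_bounded (q : {poly R}) : exists B : R, forall y, `|q.[sin y]| <= B.
Proof.
elim/poly_ind: q => [|p c [B pB]]; first by exists 0 => x; rewrite hornerE normr0.
exists (B + `|c|) => x; rewrite hornerMXaddC (le_trans (ler_normD _ _))// lerD2r.
by apply: le_trans (pB x); rewrite normrM ler_piMr// sin_max.
Qed.

Let int (e : measure_display) (S : measurableType e) (Q : probability S R) (V : S -> R) (q : {poly R}) c a t :
  measurable_fun setT V ->
  Q.-integrable setT (EFin \o (fun w => q.[sin (c * V w)] * cos (a + t * V w))).
Proof.
move=> mV; have [B qB] := horner_sine_bounded q.
apply: (@bounded_integrable _ _ _ _ _ B).
  by apply: measurable_funM; [exact: measurable_sine|exact: cos_affine_measurable].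
by move=> w; apply: le_trans (qB (c * V w)); rewrite normrM ler_piMr// cos_max.
Qed.

(** The products of powers of sines with cosines linearize to cosines. *)
Lemma sine_polynomial_cvg (q : {poly R}) c a t :
  \int[P k]_w (q.[sin (c * X k w)] * cos (a + t * X k w)) @[k --> \oo]
  --> \int[P']_w (q.[sin (c * Y w)] * cos (a + t * Y w)).
Proof.
elim/poly_ind: q a t => [|p b IH] a t.
  have E (e : measure_display) (S : measurableType e) (Q : probability S R) (V : S -> R) :
      \int[Q]_w ((0 : {poly R}).[sin (c * V w)] * cos (a + t * V w)) = 0.
    by under eq_Rintegral do rewrite hornerE mul0r; exact: Rintegral_prob_cst.
  by rewrite E; under eq_fun do rewrite E; exact: cvg_cst.
have E (e : measure_display) (S : measurableType e) (Q : probability S R) (V : S -> R) :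
    measurable_fun setT V ->
    \int[Q]_w ((p * 'X + b%:P).[sin (c * V w)] * cos (a + t * V w)) =
    2^-1 * \int[Q]_w (p.[sin (c * V w)] * cos ((a - pi / 2) + (t + c) * V w))
  - 2^-1 * \int[Q]_w (p.[sin (c * V w)] * cos ((a - pi / 2) + (t - c) * V w))
  + b * \int[Q]_w cos (a + t * V w).
  move=> mV; rewrite -!RintegralZl//; try exact: int; last exact: cos_affine_integrable.
  rewrite -RintegralB//; try by apply: integrable_scale; exact: int.
  rewrite -RintegralDprob//; last 2 first.
  - by apply: integrable_sub; apply: integrable_scale; exact: int.
  - by apply: integrable_scale; exact: cos_affine_integrable.
  apply: eq_Rintegral => w _; rewrite hornerMXaddC.
  have -> : a - pi / 2 + (t + c) * V w = (a + t * V w) + c * V w - pi / 2 by ring.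
  have -> : a - pi / 2 + (t - c) * V w = (a + t * V w) - c * V w - pi / 2 by ring.
  by rewrite !cosBpihalf sinB sinD; field.
rewrite E//; under eq_fun do rewrite E//.
by apply: cvgD; [apply: cvgB|]; apply: cvgMl_tmp => //; exact: IH.
Qed.

Hypothesis X2 : forall k, (P k).-integrable setT (EFin \o (fun w => X k w ^+ 2)).
Hypothesis Y2 : P'.-integrable setT (EFin \o (fun w => Y w ^+ 2)).
Hypothesis X2_le1 : forall k, \int[P k]_w (X k w ^+ 2) <= 1.
Hypothesis Y2_le1 : \int[P']_w (Y w ^+ 2) <= 1.

(** The second moments bound the mass that the periodic approximation of a test
    function misses. *)
Lemma cosine_cvg_distribution f B : continuous f -> (forall x, `|f x| <= B) ->
  \int[P k]_w f (X k w) @[k --> \oo] --> \int[P']_w f (Y w).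
Proof.
move=> fc fB; have B0 : 0 <= B by apply: le_trans (normr_ge0 _) (fB 0).
apply/cvgrPdist_le => e e0.
pose e' := Num.min 1 (e / 6).
have e'0 : 0 < e' by rewrite lt_min ltr01 divr_gt0.
have e'1 : 0 < e' <= 1 by rewrite e'0 ge_min lexx.
(* At this scale the quadratic error term of the approximation has mean at most
   [e'] for every variable of second moment at most one. *)
pose A := (2 * B + 1) / e' + 1.
have B1 : 0 < 2 * B + 1 by rewrite ltr_wpDl// mulr_ge0.
have A1 : 1 <= A by rewrite /A lerDr divr_ge0// ltW.
have A0 : 0 < A by exact: lt_le_trans A1.
have AB : (2 * B + 1) * A^-1 ^+ 2 <= e'.
  rewrite exprVn ler_pdivrMr ?exprn_gt0// [leRHS]mulrC -ler_pdivrMr//.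
  apply: (@le_trans _ _ A); first by rewrite /A lerDl.
  by rewrite expr2 ler_peMr// ltW.
have [q qP] := sine_polynomial_approx fc fB A0 e'1.
have approx (e1 : measure_display) (S : measurableType e1) (Q : probability S R) (V : S -> R) :
    measurable_fun setT V -> Q.-integrable setT (EFin \o (fun w => V w ^+ 2)) ->
    \int[Q]_w (V w ^+ 2) <= 1 ->
    `|\int[Q]_w q.[sin (A^-1 * V w)] - \int[Q]_w f (V w)| <= 2 * e'.
  move=> mV V2 V21.
  have ic c := prob_integrable_cst Q c.
  apply: (@le_trans _ _ (\int[Q]_w (e' + (2 * B + 1) * A^-1 ^+ 2 * V w ^+ 2))).
    apply: Rintegral_dist.
    - have [B' qB] := horner_sine_bounded q.
      by apply: (@bounded_integrable _ _ _ _ _ B') => //; exact: measurable_sine.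
    - apply: (@bounded_integrable _ _ _ _ _ B) => //.
      by apply: measurableT_comp => //; exact: continuous_measurable_fun.
    - by apply: integrable_add => //; exact: integrable_scale.
    - by move=> w; apply: le_trans (qP (V w)) _; rewrite exprMn mulrA.
  rewrite RintegralDprob//; last exact: integrable_scale.
  rewrite Rintegral_prob_cst RintegralZl// (_ : 2 * e' = e' + e'); last by ring.
  rewrite lerD2l (le_trans _ AB)// ler_piMr// mulr_ge0 ?sqr_ge0//.
  exact: ltW.
have := @sine_polynomial_cvg q A^-1 0 0.
have E (e1 : measure_display) (S : measurableType e1) (Q : probability S R) (V : S -> R) :
    \int[Q]_w (q.[sin (A^-1 * V w)] * cos (0 + 0 * V w)) = \int[Q]_w q.[sin (A^-1 * V w)].
  by apply: eq_Rintegral => w _; rewrite mul0r addr0 cos0 mulr1.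
rewrite E; under eq_fun do rewrite E.
move=> /cvgrPdist_le/(_ _ e'0) near_q; near=> k.
have hk : `|\int[P']_w q.[sin (A^-1 * Y w)] - \int[P k]_w q.[sin (A^-1 * X k w)]| <= e'.
  by near: k.
have h1 := approx _ _ (P k) (X k) (@mX k) (@X2 k) (@X2_le1 k).
have h2 := approx _ _ _ _ mY Y2 Y2_le1.
have e6 : e' <= e / 6 by rewrite ge_min lexx orbT.
move: hk h1 h2; rewrite !ler_distl; lra.
Unshelve. all: by end_near. Qed.

End trigonometric_approximation.

(** * Independence *)

Section independence.
Context d {T : measurableType d} {R : realType} (P : probability T R).
Implicit Types (F G : set (set T)) (A B : set T) (X Y : T -> R).

Definition indep_systems F G :=
  forall A B, F A -> G B -> P (A `&` B) = (P A * P B)%E.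

Lemma indep_systemsC F G : indep_systems F G -> indep_systems G F.
Proof. by move=> FG A B GA FB; rewrite setIC FG// muleC. Qed.

Lemma dynkin_indep B : measurable B ->
  dynkin [set A | measurable A /\ P (A `&` B) = (P A * P B)%E].
Proof.
move=> mB.
have PB : P B = (fine (P B))%:E by rewrite fineK// fin_num_measure.
split=> /=.
- by split => //; rewrite setTI; have := probability_setT P => ->; rewrite mul1e.
- move=> A [mA AB]; split; first exact: measurableC.
  have -> : ~` A `&` B = B `\` A by rewrite setDE setIC.
  have -> : P (B `\` A) = (P B - P (A `&` B))%E.
    by rewrite setIC; apply: measureD => //; rewrite -ge0_fin_numE// fin_num_measure.
  rewrite AB; have -> : P (~` A) = (1 - P A)%E by exact: probability_setC.
  by rewrite [RHS]muleC muleBr ?mule1 1?muleC // ?fin_num_adde_defr ?fin_num_measure.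
- move=> F tF mFB; split; first by apply: bigcup_measurable => k _; case: (mFB k).
  have -> : P (\bigcup_k F k `&` B) = (\sum_(k <oo) P (F k `&` B))%E.
    have mFI k : measurable (F k `&` B).
      by case: (mFB k) => mFk _; exact: measurableI.
    rewrite setI_bigcupl; apply: measure_semi_bigcup => //.
      exact: trivIset_setIr.
    exact: bigcup_measurable.
  have -> : P (\bigcup_k F k) = (\sum_(k <oo) P (F k))%E.
    apply: measure_semi_bigcup => //; first by move=> k; case: (mFB k).
    by apply: bigcup_measurable => k _; case: (mFB k).
  rewrite muleC PB -nneseriesZl//; apply: eq_eseriesr => k _.
  by case: (mFB k) => _ ->; rewrite muleC -PB.
Qed.

(** The events independent of a given one form a Dynkin system, so that
    Dynkin's pi-lambda theorem applies. *)
Lemma indep_sigma_algebra F G : setI_closed F -> F `<=` measurable ->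
  G `<=` measurable -> indep_systems F G -> indep_systems <<s F >> G.
Proof.
move=> FI mF mG FG A B FA GB.
move: FA; rewrite -(setI_closed_g_dynkin_g_sigma_algebra FI) => FA.
have [] // := smallest_sub (dynkin_indep (mG _ GB)) _ FA.
by move=> C FC; split; [exact: mF|exact: FG].
Qed.

Section grouping.
Context (I : eqType) (F : I -> set (set T)).
Hypothesis FT : forall i, F i setT.
Hypothesis FI : forall i, setI_closed (F i).
Hypothesis mF : forall i, F i `<=` measurable.
Hypothesis indF : mutually_independent P F.

(** Unlike the union of the [F i] over [J], this system is closed under intersection,
    while it generates the same sigma-algebra. *)
Definition cylinders (J : seq I) : set (set T) :=
  [set A | exists2 E : I -> set T, (forall i, i \in J -> F i (E i)) &
           A = \bigcap_(i in [set` J]) E i].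

Lemma cylinders_setI_closed J : setI_closed (cylinders J).
Proof.
move=> A B [E EF ->] [E' E'F ->]; exists (fun i => E i `&` E' i).
  by move=> i iJ; apply: FI; [exact: EF|exact: E'F].
by rewrite bigcapI.
Qed.

Lemma cylinders_measurable J : cylinders J `<=` measurable.
Proof.
move=> A [E EF ->]; elim: J EF => [|j J IH] EF.
  by rewrite (_ : [set` [::]] = set0) ?bigcap_set0//; apply/seteqP; split.
have -> : \bigcap_(i in [set` j :: J]) E i = E j `&` \bigcap_(i in [set` J]) E i.
  apply/seteqP; split => [w Ew|w [Ej Ew] i /=].
    split; first by apply: Ew; rewrite /= mem_head.
    by move=> i iJ; apply: Ew; rewrite /= in_cons iJ orbT.
  by rewrite in_cons => /predU1P[->//|iJ]; exact: Ew.
apply: measurableI; first by apply: (@mF j); apply: EF; rewrite mem_head.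
by apply: IH => i iJ; apply: EF; rewrite in_cons iJ orbT.
Qed.

Lemma sub_cylinders J i : i \in J -> F i `<=` cylinders J.
Proof.
move=> iJ A FA; exists (fun j => if j == i then A else setT).
  by move=> j jJ; case: eqP => [->|_] //; exact: FT.
apply/seteqP; split => [w Aw j _ /=|w /= /(_ i iJ)]; last by rewrite eqxx.
by case: eqP.
Qed.

Lemma indep_cylinders J1 J2 : uniq (J1 ++ J2) ->
  indep_systems (cylinders J1) (cylinders J2).
Proof.
move=> uJ A B [E EF ->] [E' E'F ->].
move: (uJ); rewrite cat_uniq => /and3P[u1 /hasPn d12 u2].
pose E12 i := if i \in J1 then E i else E' i.
have E2 i : i \in J2 -> E12 i = E' i.
  by move=> iJ; rewrite /E12 (negbTE (d12 _ iJ)).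
have -> : \bigcap_(i in [set` J1]) E i `&` \bigcap_(i in [set` J2]) E' i =
          \bigcap_(i in [set` J1 ++ J2]) E12 i.
  apply/seteqP; split => w /=.
    move=> [w1 w2] i /=; rewrite mem_cat => /orP[iJ|iJ].
      by rewrite /E12 iJ; exact: w1.
    by rewrite E2//; exact: w2.
  move=> w12; split => i /= iJ; have := w12 i; rewrite /= mem_cat iJ ?orbT => /(_ isT).
    by rewrite /E12 iJ.
  by rewrite E2.
rewrite indF//; last first.
  move=> i; rewrite mem_cat => /orP[iJ|iJ]; first by rewrite /E12 iJ; exact: EF.
  by rewrite E2//; exact: E'F.
rewrite big_cat/= !indF//; congr (_ * _)%E; apply: eq_big_seq => i iJ.
  by rewrite /E12 iJ.
by rewrite E2.
Qed.

Lemma indep_cylinder_sigma_algebras J1 J2 : uniq (J1 ++ J2) ->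
  indep_systems <<s cylinders J1 >> <<s cylinders J2 >>.
Proof.
move=> uJ; have sm J : <<s cylinders J >> `<=` measurable.
  apply: smallest_sub; first exact: sigma_algebra_measurable.
  exact: cylinders_measurable.
apply: indep_sigma_algebra; [exact: cylinders_setI_closed|
  exact: cylinders_measurable|exact: sm|].
apply/indep_systemsC/indep_sigma_algebra;
  [exact: cylinders_setI_closed|exact: cylinders_measurable|
   exact: cylinders_measurable|].
exact/indep_systemsC/indep_cylinders.
Qed.

(** Expressing that [X] is a function of the variables indexed by [J] as
    measurability makes it stable under all measurable operations. *)
Definition depends_on (J : seq I) X :=
  measurable_fun (setT : set (g_sigma_algebraType (cylinders J))) X.

Lemma depends_on_measurable J X : depends_on J X -> measurable_fun setT X.
Proof.
move=> JX _ A mA; have := JX measurableT A mA; apply: smallest_sub.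
  exact: sigma_algebra_measurable.
exact: cylinders_measurable.
Qed.

Lemma depends_on_mem J i X : i \in J ->
  preimage_set_system setT X measurable `<=` F i -> depends_on J X.
Proof.
move=> iJ XF _ A mA; apply: sub_sigma_algebra; apply: (sub_cylinders iJ).
by apply: XF; exists A.
Qed.

End grouping.

Definition indep_fun X Y := forall A B : set R, measurable A -> measurable B ->
  P (X @^-1` A `&` Y @^-1` B) = (P (X @^-1` A) * P (Y @^-1` B))%E.

Lemma indep_fun_comp X Y (f g : R -> R) : measurable_fun setT f ->
  measurable_fun setT g -> indep_fun X Y -> indep_fun (f \o X) (g \o Y).
Proof.
move=> mf mg XY A B mA mB; apply: (XY (f @^-1` A) (g @^-1` B)).
  by rewrite -[X in measurable X]setTI; exact: mf.
by rewrite -[X in measurable X]setTI; exact: mg.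
Qed.

Lemma indep_fun_cst X (c : R) : indep_fun X (fun=> c).
Proof.
move=> A B mA mB; rewrite -[fun=> c]/(cst c) preimage_cst; case: ifPn => _.
  by rewrite setIT (_ : P setT = 1%E) ?mule1//; exact: probability_setT.
by rewrite setI0 measure0 mule0.
Qed.

Lemma depends_on_indep (I : eqType) (F : I -> set (set T)) (J1 J2 : seq I) X Y :
  (forall i, F i setT) -> (forall i, setI_closed (F i)) ->
  (forall i, F i `<=` measurable) -> mutually_independent P F ->
  uniq (J1 ++ J2) -> depends_on F J1 X -> depends_on F J2 Y -> indep_fun X Y.
Proof.
move=> FT FI mF indF uJ JX JY A B mA mB.
apply: (indep_cylinder_sigma_algebras FI mF indF uJ).
  by have := JX measurableT A mA; rewrite setTI.
by have := JY measurableT B mB; rewrite setTI.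
Qed.

(** The joint law of independent variables is the product of their laws, so
    that Fubini's theorem applies. *)
Lemma indep_Rintegral_mul X Y : measurable_fun setT X -> measurable_fun setT Y ->
  indep_fun X Y ->
  P.-integrable setT (EFin \o X) -> P.-integrable setT (EFin \o Y) ->
  P.-integrable setT (EFin \o (fun w => X w * Y w)) /\
  \int[P]_w (X w * Y w) = \int[P]_w X w * \int[P]_w Y w.
Proof.
move=> mX mY XY iX iY.
pose X' : {RV P >-> R} := MeasurableFun.Pack (MeasurableFun.Class (isMeasurableFun.Build _ _ _ _ _ mX)).
pose Y' : {RV P >-> R} := MeasurableFun.Pack (MeasurableFun.Class (isMeasurableFun.Build _ _ _ _ _ mY)).
pose Z w := (X w, Y w).
have mZ : measurable_fun setT Z by exact: measurable_fun_pair.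
pose Z' : {RV P >-> (R * R)%type} := MeasurableFun.Pack (MeasurableFun.Class (isMeasurableFun.Build _ _ _ _ _ mZ)).
pose m1 := distribution P X'. pose m2 := distribution P Y'.
have mE (A : set (R * R)) : measurable A -> (m1 \x m2)%E A = distribution P Z' A.
  by apply: product_measure_unique => // B C mB mC; exact: XY.
have eqI (g : R * R -> \bar R) :
    (\int[m1 \x m2]_z g z = \int[distribution P Z']_z g z)%E.
  by apply: eq_measure_integral => A mA _; exact: mE.
pose f (z : R * R) := (z.1 * z.2)%:E.
have mf : measurable_fun setT f.
  by apply/measurable_EFinP; apply: measurable_funM; [exact: measurable_fst|exact: measurable_snd].
have fX1 : measurable_fun setT (fun x : R => `|x%:E|%E).
  by apply: measurableT_comp => //; exact: measurableT_comp.
have aX : (\int[m1]_x `|x%:E| < +oo)%E.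
  rewrite ge0_integral_distribution//.
  by case/integrableP : iX.
have aY : (\int[m2]_x `|x%:E| < +oo)%E.
  rewrite ge0_integral_distribution//.
  by case/integrableP : iY.
have finX : (\int[m1]_x `|x%:E|)%E \is a fin_num.
  by rewrite ge0_fin_numE// integral_ge0.
have finY : (\int[m2]_x `|x%:E|)%E \is a fin_num.
  by rewrite ge0_fin_numE// integral_ge0.
have inf : (m1 \x m2)%E.-integrable setT f.
  apply/integrable12ltyP => //.
  have -> : (\int[m1]_x \int[m2]_y `|f (x, y)| =
             \int[m1]_x (`|x%:E| * \int[m2]_y `|y%:E|))%E.
    apply: eq_integral => x _; rewrite -ge0_integralZl//.
    by apply: eq_integral => y _; rewrite /f -abseM.
  rewrite ge0_integralZr//; last exact: integral_ge0.
  by rewrite -(fineK finX) -(fineK finY) -EFinM ltry.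
have iZ : P.-integrable setT (EFin \o (fun w => X w * Y w)).
  have : (distribution P Z').-integrable setT f.
    case/integrableP : inf => _ ltf; apply/integrableP; split => //.
    by rewrite -eqI.
  case/integrableP => _; rewrite ge0_integral_distribution//; last first.
    exact: measurableT_comp.
  move=> ltf; apply/integrableP; split => //.
  by apply/measurable_EFinP; exact: measurable_funM.
split => //.
rewrite /Rintegral -fineM ?integrable_fin_num//; congr fine.
transitivity (\int[distribution P Z']_z f z)%E.
  by rewrite integral_distribution.
rewrite -eqI.
rewrite -integral12_prod_meas1//.
have EX : (\int[m1]_x x%:E = \int[P]_w (X w)%:E)%E by rewrite integral_distribution.
have EY : (\int[m2]_x x%:E = \int[P]_w (Y w)%:E)%E by rewrite integral_distribution.
have i1 : m1.-integrable setT (@EFin R) by apply: integrable_pushforward.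
have i2 : m2.-integrable setT (@EFin R) by apply: integrable_pushforward.
rewrite -EX -EY.
transitivity (\int[m1]_x (x%:E * \int[m2]_y y%:E))%E.
  apply: eq_integral => x _; rewrite /fubini_F -integralZl//.
rewrite -[X in (\int[m1]_x (_ * X))%E]fineK ?integrable_fin_num//.
by rewrite integralZr// fineK ?integrable_fin_num.
Qed.

End independence.

(** * Densities and changes of variables *)

Section density.
Context d {T : measurableType d} {R : realType}.
Variables (mu nu : {measure set T -> \bar R}) (g : T -> R).
Hypotheses (mg : measurable_fun setT g) (g0 : forall x, 0 <= g x).
Hypothesis nuE : forall A, measurable A -> nu A = (\int[mu]_(x in A) (g x)%:E)%E.

Import HBNNSimple.

Let integral_density_nnsfun (h : {nnsfun T >-> R}) :
  (\int[nu]_x (h x)%:E = \int[mu]_x ((h x)%:E * (g x)%:E))%E.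
Proof.
under [LHS]eq_integral do rewrite fimfunE -fsumEFin//.
rewrite [LHS]ge0_integral_fsum//; last 2 first.
  - by move=> r; exact/measurable_EFinP/measurableT_comp.
  - by move=> n x _; rewrite EFinM nnfun_muleindic_ge0.
under [RHS]eq_integral.
  move=> x xD; rewrite fimfunE -fsumEFin// muleC ge0_mule_fsumr; last first.
    by move=> r; rewrite EFinM nnfun_muleindic_ge0.
  over.
rewrite [RHS]ge0_integral_fsum//; last 2 first.
  - move=> r; apply/measurable_EFinP; apply: measurable_funM => //.
    by apply: measurable_funM => //; exact: measurable_indic.
  - move=> n x _; apply: mule_ge0; first by rewrite lee_fin.
    by rewrite EFinM nnfun_muleindic_ge0.
apply: eq_fsbigr => r _; set A := h @^-1` [set r].
have mA : measurable A by exact: measurable_sfunP.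
have [r0|r0] := leP 0 r; last first.
  have A0 : A = set0.
    apply/seteqP; split => // x /= hx; have : 0 <= h x by exact: fun_ge0.
    by rewrite hx leNgt r0.
  rewrite A0; under eq_integral do rewrite indic0 mulr0.
  rewrite integral0; under eq_integral do rewrite indic0 mulr0 mule0.
  by rewrite integral0.
have mI : measurable_fun setT (\1_A : T -> R) by exact: measurable_indic.
rewrite (_ : (\int[nu]_x (r * \1_A x)%:E = r%:E * nu A)%E); last first.
  under eq_integral do rewrite EFinM.
  rewrite ge0_integralZl//.
  - by rewrite integral_indic// setIT.
  - exact/measurable_EFinP.
rewrite nuE// -ge0_integralZl//; last 2 first.
  - by apply/measurable_EFinP; exact: measurable_funTS.
  - by move=> x _; rewrite lee_fin.
rewrite integral_mkcond; apply: eq_integral => x _.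
rewrite patchE indicE; case: ifPn => xA; first by rewrite /= mulr1 muleC.
by rewrite /= mulr0 mule0.
Qed.

Lemma ge0_integral_density (f : T -> \bar R) : measurable_fun setT f ->
  (forall x, 0 <= f x)%E -> (\int[nu]_x f x = \int[mu]_x (f x * (g x)%:E))%E.
Proof.
move=> mf f0; pose f_ := nnsfun_approx measurableT mf.
have mgE : measurable_fun setT (fun x => (g x)%:E) by exact/measurable_EFinP.
transitivity (limn (fun n => \int[nu]_x (f_ n x)%:E)%E).
  rewrite -monotone_convergence//=.
  - apply: eq_integral => x _; apply/esym/cvg_lim => //=.
    exact: cvg_nnsfun_approx.
  - by move=> n; exact/measurable_EFinP.
  - by move=> n x _; rewrite lee_fin.
  - by move=> x _ a b ab; rewrite lee_fin//; exact/lefP/nd_nnsfun_approx.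
rewrite (_ : \int[mu]_x _ =
    limn (fun n => \int[mu]_x ((f_ n x)%:E * (g x)%:E)))%E; last first.
  rewrite -monotone_convergence//=.
  - apply: eq_integral => x _; apply/esym/cvg_lim => //.
    by apply: cvgeZr => //; exact: cvg_nnsfun_approx.
  - move=> n; apply: emeasurable_funM => //; exact/measurable_EFinP.
  - by move=> n x _; rewrite mule_ge0// lee_fin.
  - move=> x _ a b ab; rewrite lee_wpmul2r ?lee_fin//.
    exact/lefP/nd_nnsfun_approx.
by congr (limn _); apply/funext => n; exact: integral_density_nnsfun.
Qed.

End density.

Section transfer_of_laws.
Context {R : realType}.

(** Splitting into positive and negative parts makes the change of variables
    unconditional. *)
Lemma integral_posneg_ext d d' (T : measurableType d) (T' : measurableType d')
    (mu : {measure set T -> \bar R}) (nu : {measure set T' -> \bar R})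
    (f : T -> R) (f' : T' -> R) :
  (\int[mu]_x (Num.max (f x) 0)%:E = \int[nu]_y (Num.max (f' y) 0)%:E)%E ->
  (\int[mu]_x (Num.max (- f x) 0)%:E = \int[nu]_y (Num.max (- f' y) 0)%:E)%E ->
  (\int[mu]_x (f x)%:E = \int[nu]_y (f' y)%:E)%E.
Proof.
move=> h1 h2; rewrite integralE [RHS]integralE.
congr (_ - _)%E.
  by under eq_integral do rewrite funeposE -EFin_max;
     under [RHS]eq_integral do rewrite funeposE -EFin_max.
by under eq_integral do rewrite funenegE -EFinN -EFin_max;
   under [RHS]eq_integral do rewrite funenegE -EFinN -EFin_max.
Qed.

Lemma integral_same_law d d' (T : measurableType d) (T' : measurableType d')
    (P : probability T R) (Q : probability T' R) (X : T -> R) (Y : T' -> R) :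
  measurable_fun setT X -> measurable_fun setT Y ->
  (forall A, measurable A -> P (X @^-1` A) = Q (Y @^-1` A)) ->
  forall f : R -> R, measurable_fun setT f ->
  (\int[P]_w (f (X w))%:E = \int[Q]_w (f (Y w))%:E)%E.
Proof.
move=> mX mY XY.
pose X' : {RV P >-> R} := MeasurableFun.Pack
  (MeasurableFun.Class (isMeasurableFun.Build _ _ _ _ _ mX)).
pose Y' : {RV Q >-> R} := MeasurableFun.Pack
  (MeasurableFun.Class (isMeasurableFun.Build _ _ _ _ _ mY)).
have ge0 (f : R -> R) : measurable_fun setT f -> (forall x, 0 <= f x) ->
    (\int[P]_w (f (X w))%:E = \int[Q]_w (f (Y w))%:E)%E.
  move=> mf f0; have mfE : measurable_fun setT (EFin \o f) by exact/measurable_EFinP.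
  have f0E y : (0 <= (EFin \o f) y)%E by rewrite lee_fin.
  rewrite -(ge0_integral_distribution X' mfE f0E).
  rewrite -(ge0_integral_distribution Y' mfE f0E).
  by apply: eq_measure_integral => A mA _; exact: XY.
move=> f mf; apply: integral_posneg_ext.
  apply: (ge0 (fun x => Num.max (f x) 0)); last by move=> x; rewrite le_max lexx orbT.
  exact: measurable_maxr.
apply: (ge0 (fun x => Num.max (- f x) 0)); last by move=> x; rewrite le_max lexx orbT.
by apply: measurable_maxr => //; exact: measurable_funN.
Qed.

Lemma integrable_same_law d d' (T : measurableType d) (T' : measurableType d')
    (P : probability T R) (Q : probability T' R) (X : T -> R) (Y : T' -> R) :
  measurable_fun setT X -> measurable_fun setT Y ->
  (forall A, measurable A -> P (X @^-1` A) = Q (Y @^-1` A)) ->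
  forall f : R -> R, measurable_fun setT f ->
  Q.-integrable setT (EFin \o (fun w => f (Y w))) ->
  P.-integrable setT (EFin \o (fun w => f (X w))).
Proof.
move=> mX mY XY f mf /integrableP[_ fY]; apply/integrableP; split.
  by apply/measurable_EFinP; exact: measurableT_comp.
apply: le_lt_trans fY; rewrite le_eqVlt; apply/orP; left; apply/eqP.
apply: (integral_same_law mX mY XY (f := fun x => `|f x|)).
exact: measurableT_comp.
Qed.

End transfer_of_laws.

(** * Gaussian integrals *)

Section gaussian.
Context {R : realType}.
Implicit Types (f : R -> R) (m s h t a x v th : R).

Definition std_normal : probability (measurableTypeR R) R := normal_prob 0 1.

Local Notation gamma := std_normal.
Local Notation mu := (@lebesgue_measure R).

Lemma ge0_integral_normal m s f : measurable_fun setT f -> (forall x, 0 <= f x) ->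
  (\int[normal_prob m s]_x (f x)%:E = \int[mu]_x (f x * normal_pdf m s x)%:E)%E.
Proof.
move=> mf f0.
rewrite (@ge0_integral_density _ _ _ mu (normal_prob m s) (normal_pdf m s)).
- by apply: eq_integral => x _; rewrite EFinM.
- exact: measurable_normal_pdf.
- exact: normal_pdf_ge0.
- by [].
- exact/measurable_EFinP.
- by move=> x; rewrite lee_fin.
Qed.

Lemma ge0_integral_normal_shift m s f : continuous f -> (forall x, 0 <= f x) ->
  0 < s ->
  (\int[normal_prob m s]_x (f x)%:E = \int[gamma]_x (f (m + s * x))%:E)%E.
Proof.
move=> cf f0 s0; have s1 : s != 0 by rewrite gt_eqF.
have cF : continuous (fun x => f (m + s * x)).
  move=> x; apply: (@continuous_comp _ _ _ (fun x : R => m + s * x) f).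
    by apply: cvgD; [exact: cvg_cst|apply: cvgMl_tmp; exact: cvg_id].
  exact: cf.
rewrite (ge0_integral_normal m s (continuous_measurable_fun cf) f0).
rewrite (ge0_integral_normal 0 1 (continuous_measurable_fun cF)
  (fun x => f0 (m + s * x))).
pose F x := m + s * x.
have dF x : is_derive x 1 F s.
  by rewrite /F; apply: is_derive_eq; rewrite /GRing.scale/=; ring.
have F' : F^`()%classic = cst s.
  by apply/funext => x; rewrite derive1E; have [_ ->] := dF x.
rewrite (@increasing_ge0_integration_by_substitutionT _ F).
- apply: eq_integral => x _; congr EFin; rewrite F' !fctE /F -mulrA; congr (_ * _).
  rewrite !normal_pdfE ?oner_eq0// /normal_peak /normal_fun.
  rewrite expr1n mul1r subr0.
  have -> : - (m + s * x - m) ^+ 2 / (s ^+ 2 *+ 2) = - x ^+ 2 / (1 *+ 2).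
    rewrite !mulr2n; field.
    by rewrite -mulr2n mulrn_eq0 expf_neq0.
  rewrite mulrC mulrA; congr (_ * _).
  rewrite -mulrnAr sqrtrM ?sqr_ge0// sqrtr_sqr gtr0_norm// invfM mulrA divff// mul1r.
  by [].
- by move=> x y xy; rewrite /F ltrD2l ltr_pM2l.
- by rewrite F' => ?; exact: cvg_cst.
- by rewrite F'; exact: is_cvg_cst.
- by rewrite F'; exact: is_cvg_cst.
- by move=> x; have [] := dF x.
- rewrite /F; under eq_fun do rewrite addrC mulrC.
  apply/cvgrNyPle => B; near=> x.
  rewrite -lerBrDr -ler_pdivlMr//; near: x; exact: nbhs_ninfty_le.
- rewrite /F; under eq_fun do rewrite addrC mulrC.
  apply/cvgryPge => B; near=> x.
  rewrite -lerBlDr -ler_pdivrMr//; near: x; exact: nbhs_pinfty_ge.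
- move=> x; apply: cvgM; first exact: cf.
  exact: continuous_normal_pdf.
- by move=> x; rewrite mulr_ge0// normal_pdf_ge0.
Unshelve. all: by end_near. Qed.

Lemma max0_continuous f : continuous f -> continuous (fun x => Num.max (f x) 0).
Proof.
move=> cf x; apply: (@continuous_max R R f (fun=> 0) x); first exact: cf.
exact: cst_continuous.
Qed.

Lemma continuous_opp_fun f : continuous f -> continuous (fun x => - f x).
Proof. by move=> cf x; apply: cvgN; exact: cf. Qed.

Lemma max0_ge0 f x : 0 <= Num.max (f x) 0.
Proof. by rewrite le_max lexx orbT. Qed.

Lemma integral_normal_shift m s f : continuous f -> 0 < s ->
  (\int[normal_prob m s]_x (f x)%:E = \int[gamma]_x (f (m + s * x))%:E)%E.
Proof.
move=> cf s0; apply: integral_posneg_ext.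
  apply: (@ge0_integral_normal_shift m s (fun x => Num.max (f x) 0)) => //.
    exact: max0_continuous.
  exact: max0_ge0.
apply: (@ge0_integral_normal_shift m s (fun x => Num.max (- f x) 0)) => //.
  exact/max0_continuous/continuous_opp_fun.
exact: (max0_ge0 (fun x => - f x)).
Qed.

(** Cameron-Martin: a shift multiplies the density of the standard normal law
    by an exponential. *)
Lemma cameron_martin h f : continuous f ->
  (\int[gamma]_x (f (x + h))%:E = \int[gamma]_x (f x * expR (h * x - h ^+ 2 / 2))%:E)%E.
Proof.
move=> cf.
have ge0 (g : R -> R) : continuous g -> (forall x, 0 <= g x) ->
    (\int[gamma]_x (g (x + h))%:E =
     \int[gamma]_x (g x * expR (h * x - h ^+ 2 / 2))%:E)%E.
  move=> cg g0.
  have -> : (\int[gamma]_x (g (x + h))%:E = \int[gamma]_x (g (h + 1 * x))%:E)%E.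
    by apply: eq_integral => x _; rewrite mul1r addrC.
  rewrite -(ge0_integral_normal_shift h cg g0 ltr01).
  rewrite (ge0_integral_normal h 1 (continuous_measurable_fun cg) g0).
  rewrite (@ge0_integral_normal 0 1 (fun x => g x * expR (h * x - h ^+ 2 / 2))).
  - apply: eq_integral => x _; congr EFin.
    rewrite !normal_pdfE ?oner_eq0// /normal_fun -!mulrA; congr (_ * _).
    rewrite mulrCA; congr (_ * _); rewrite -expRD; congr expR.
    by rewrite !expr1n !mulr2n; field.
  - apply: measurable_funM; first exact: continuous_measurable_fun.
    by apply: measurableT_comp => //; apply: measurable_funB.
  - by move=> x; rewrite mulr_ge0// expR_ge0.
apply: integral_posneg_ext.
  rewrite (ge0 (fun x => Num.max (f x) 0)).
  - apply: eq_integral => x _; congr EFin.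
    by rewrite maxr_pMl ?mul0r ?expR_ge0.
  - exact: max0_continuous.
  - exact: max0_ge0.
rewrite (ge0 (fun x => Num.max (- f x) 0)).
- apply: eq_integral => x _; congr EFin.
  by rewrite maxr_pMl ?mul0r ?mulNr ?expR_ge0.
- exact/max0_continuous/continuous_opp_fun.
- exact: (max0_ge0 (fun x => - f x)).
Qed.

Lemma integral_normal_expR h : (\int[gamma]_x (expR (h * x))%:E = (expR (h ^+ 2 / 2))%:E)%E.
Proof.
have := @cameron_martin h (fun=> 1) (@cst_continuous _ _ _).
rewrite integral_cst//= mul1e.
have -> : gamma setT = 1%E by exact: probability_setT.
move=> /(congr1 (fun z => (expR (h ^+ 2 / 2))%:E * z)%E); rewrite mule1 => ->.
have mE : measurable_fun setT (fun x : R => (1 * expR (h * x - h ^+ 2 / 2))%:E).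
  apply/measurable_EFinP; apply: measurable_funM => //.
  apply: measurableT_comp => //; exact: measurable_funB.
have E0 (x : R) : [set: R] x -> (0 <= (1 * expR (h * x - h ^+ 2 / 2))%:E)%E.
  by move=> _; rewrite lee_fin mul1r expR_ge0.
have K0 : (0 <= (expR (h ^+ 2 / 2))%:E :> \bar R)%E by rewrite lee_fin expR_ge0.
rewrite -(ge0_integralZl gamma measurableT mE E0 K0).
apply: eq_integral => x _; rewrite -EFinM; congr EFin.
by rewrite mul1r -expRD; congr expR; ring.
Qed.

Lemma integrable_expR h : gamma.-integrable setT (EFin \o (fun x => expR (h * x))).
Proof.
apply/integrableP; split.
  apply/measurable_EFinP; apply: measurableT_comp => //; exact: measurable_funM.
under eq_integral do rewrite /= ger0_norm ?expR_ge0//.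
by rewrite integral_normal_expR ltry.
Qed.

Lemma Rintegral_normal_expR h : \int[gamma]_x expR (h * x) = expR (h ^+ 2 / 2).
Proof. by rewrite /Rintegral integral_normal_expR. Qed.

Lemma integrable_expR_norm f (K : R) h : measurable_fun setT f -> 0 <= h ->
  (forall x, `|f x| <= K * expR (h * `|x|)) ->
  gamma.-integrable setT (EFin \o f).
Proof.
move=> mf h0 fK.
have K0 : 0 <= K.
  by have := le_trans (normr_ge0 _) (fK 0); rewrite pmulr_lge0 ?expR_gt0.
have := integrable_scale K (integrable_add (integrable_expR h) (integrable_expR (- h))).
apply: le_integrable => //; first exact/measurable_EFinP.
move=> x _; rewrite /= lee_fin; apply: le_trans (fK x) (le_trans _ (ler_norm _)).
rewrite ler_wpM2l//; have [x0|x0] := leP 0 x.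
  by rewrite ger0_norm// lerDl expR_ge0.
by rewrite ltr0_norm// mulNr -mulrN lerDr expR_ge0.
Qed.

Lemma pow_le_expR n : exists2 K : R, 0 <= K & forall x, `|x| ^+ n <= K * expR `|x|.
Proof.
have [->|n0] := eqVneq n 0%N.
  exists 1 => // x; rewrite mul1r expr0.
  by apply: le_trans (expR_ge1Dx _); rewrite lerDl.
have nR : 0 < n%:R :> R by rewrite ltr0n lt0n.
exists (n%:R ^+ n); first exact: exprn_ge0.
move=> x; have h : `|x| <= n%:R * expR (`|x| / n%:R).
  rewrite mulrC -ler_pdivrMr//; apply: le_trans (expR_ge1Dx _).
  by rewrite lerDr.
rewrite (_ : expR `|x| = expR (`|x| / n%:R) ^+ n).
  by rewrite -exprMn lerXn2r ?nnegrE// mulr_ge0// expR_ge0.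
by rewrite -expRM_natl mulrC divfK// gt_eqF.
Qed.

Lemma integrable_normal_pow n : gamma.-integrable setT (EFin \o (fun x => x ^+ n)).
Proof.
have [K K0 hK] := pow_le_expR n.
apply: (@integrable_expR_norm _ K 1) => //.
by move=> x; rewrite normrX mul1r.
Qed.

(** Stein's identity: differentiate the Cameron-Martin formula at [h = 0]. *)
Lemma stein_identity f f' (K : R) : (forall x, is_derive x 1 f (f' x)) ->
  measurable_fun setT f' ->
  (forall x, `|f x| <= K * expR `|x|) -> (forall x, `|f' x| <= K * expR `|x|) ->
  \int[gamma]_x f' x = \int[gamma]_x (x * f x).
Proof.
move=> df mf' fK f'K.
have K0 : 0 <= K.
  by have := le_trans (normr_ge0 _) (fK 0); rewrite pmulr_lge0 ?expR_gt0.
have cf : continuous f.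
  move=> x; apply/differentiable_continuous/derivable1_diffP.
  by have [] := df x.
have mf : measurable_fun setT f by exact: continuous_measurable_fun.
have abs1 h : `]-1, 1[%classic h -> `|h| <= 1.
  by rewrite /= in_itv/= ler_norml => /andP[/ltW -> /ltW ->].
have I0 : `]-1, 1[%classic (0 : R) by rewrite /= in_itv/= ltrN10 ltr01.
have bnd x h : `|h| <= 1 -> expR `|x + h| <= expR 1 * expR (1 * `|x|).
  move=> h1; rewrite -expRD ler_expR mul1r addrC (le_trans (ler_normD _ _))//.
  by rewrite lerD2r.
pose A h x := f (x + h).
pose B h x := f x * expR (h * x - h ^+ 2 / 2).
have dA h x : is_derive h 1 (A ^~ x) (f' (x + h)).
  have h1 : is_derive h 1 (fun h => x + h) 1.
    by apply: is_derive_eq; ring.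
  have h2 := @is_derive1_comp _ f (fun h : R => x + h) h _ _ (df (x + h)) h1.
  by rewrite mulr1 in h2.
have dB h x : is_derive h 1 (B ^~ x) (f x * ((x - h) * expR (h * x - h ^+ 2 / 2))).
  have h1 : is_derive h 1 (fun h => h * x - h ^+ 2 / 2) (x - h).
    by apply: is_derive_eq; rewrite /GRing.scale/=; field.
  have h2 := @is_derive1_comp _ expR (fun h : R => h * x - h ^+ 2 / 2) h _ _ (is_derive_expR _) h1.
  rewrite /B; apply: is_derive_eq; rewrite /GRing.scale/=; ring.
have iA h : `]-1, 1[%classic h -> gamma.-integrable setT (EFin \o A h).
  move=> /abs1 h1; apply: (@integrable_expR_norm _ (K * expR 1) 1) => //.
    by apply: measurableT_comp => //; exact: measurable_funD.
  move=> x; rewrite (le_trans (fK _))// -mulrA ler_wpM2l//; exact: bnd.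
have bB h x : `|h| <= 1 -> `|expR (h * x - h ^+ 2 / 2)| <= expR `|x|.
  move=> h1; rewrite ger0_norm ?expR_ge0// ler_expR lerBlDr.
  rewrite (le_trans (ler_norm _))// normrM (@le_trans _ _ (`|x|))//.
    by rewrite ler_piMl.
  by rewrite lerDl divr_ge0// sqr_ge0.
have iB h : `]-1, 1[%classic h -> gamma.-integrable setT (EFin \o B h).
  move=> /abs1 h1; apply: (@integrable_expR_norm _ K 2) => //.
    apply: measurable_funM => //; apply: measurableT_comp => //.
    exact: measurable_funB.
  move=> x; rewrite /B normrM (_ : 2 * `|x| = `|x| + `|x|); last by ring.
  by rewrite [expR (`|x| + _)]expRD mulrA ler_pM// bB.
have EAB : (fun h => \int[gamma]_x A h x) = (fun h => \int[gamma]_x B h x).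
  by apply/funext => h; rewrite /Rintegral; congr fine; exact: cameron_martin.
have d1A h x : (partial1of2 A) h x = f' (x + h).
  by rewrite partial1of2E; have [_ ->] := dA h x.
have d1B h x : (partial1of2 B) h x = f x * ((x - h) * expR (h * x - h ^+ 2 / 2)).
  by rewrite partial1of2E; have [_ ->] := dB h x.
pose GA x := K * (expR 1 * expR (1 * `|x|)).
pose GB x := K * expR (3 * `|x|).
have mabs c : measurable_fun setT (fun x : R => expR (c * `|x|)).
  by apply: measurableT_comp => //; apply: measurable_funM => //; exact: measurableT_comp.
have iGA : gamma.-integrable setT (EFin \o GA).
  apply: (@integrable_expR_norm _ (K * expR 1) 1) => //.
    by apply: measurable_funM => //; exact: measurable_funM.
  by move=> x; rewrite /GA ger0_norm ?mulrA// !mulr_ge0// expR_ge0.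
have iGB : gamma.-integrable setT (EFin \o GB).
  apply: (@integrable_expR_norm _ K 3) => //; first exact: measurable_funM.
  by move=> x; rewrite /GB ger0_norm// mulr_ge0// expR_ge0.
have DA := @differentiation_under_integral R _ _ gamma A setT measurableT 0 (-1) 1
  I0 iA (fun h x _ _ => @ex_derive _ _ _ _ _ _ _ (dA h x)) GA _ iGA _.
have DB := @differentiation_under_integral R _ _ gamma B setT measurableT 0 (-1) 1
  I0 iB (fun h x _ _ => @ex_derive _ _ _ _ _ _ _ (dB h x)) GB _ iGB _.
have {}DA : (fun h => \int[gamma]_x A h x)^`()%classic 0 = \int[gamma]_x f' x.
  rewrite DA.
  - by apply: eq_Rintegral => x _; rewrite d1A addr0.
  - by move=> x; rewrite /GA !mulr_ge0// expR_ge0.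
  - move=> h x /abs1 h1 _; rewrite d1A (le_trans (f'K _))// /GA ler_wpM2l//.
    exact: bnd.
have {}DB : (fun h => \int[gamma]_x B h x)^`()%classic 0 = \int[gamma]_x (x * f x).
  rewrite DB.
  - apply: eq_Rintegral => x _; rewrite d1B subr0 mul0r expr0n/= mul0r subr0.
    by rewrite expR0 mulr1 mulrC.
  - by move=> x; rewrite /GB !mulr_ge0// expR_ge0.
  - move=> h x /abs1 h1 _; rewrite d1B normrM /GB.
    rewrite (_ : 3 * `|x| = `|x| + (`|x| + `|x|)); last by ring.
    rewrite [expR (`|x| + _)]expRD mulrA ler_pM// normrM [expR (`|x| + _)]expRD.
    rewrite ler_pM ?bB//.
    rewrite (le_trans (ler_normB _ _))// (le_trans _ (expR_ge1Dx _))//.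
    by rewrite addrC lerD2r.
by rewrite -DA EAB DB.
Qed.

Lemma Rintegral_normal_id : \int[gamma]_x x = 0.
Proof.
transitivity (\int[gamma]_x (x * 1)).
  by apply: eq_Rintegral => x _; rewrite mulr1.
rewrite -(@stein_identity (fun=> 1) (fun=> 0) 1) ?Rintegral_prob_cst//.
- by move=> x; rewrite normr1 mul1r -[leLHS]expR0 ler_expR.
- by move=> x; rewrite normr0 mul1r expR_ge0.
Qed.

Lemma Rintegral_normal_powSS n :
  \int[gamma]_x (x ^+ n.+2) = n.+1%:R * \int[gamma]_x (x ^+ n).
Proof.
have [K K0 hK] := pow_le_expR n.+1; have [K' K'0 hK'] := pow_le_expR n.
rewrite -RintegralZl//; last exact: integrable_normal_pow.
have df x : is_derive x 1 (fun x => x ^+ n.+1) (n.+1%:R * x ^+ n).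
  by have := @is_deriveX R R id n.+1 x 1 1 _; rewrite fctE /GRing.scale/= mulr1; apply.
rewrite (@stein_identity _ _ (K + n.+1%:R * K') df).
- by apply: eq_Rintegral => x _; rewrite -exprS.
- by apply: measurable_funM => //; exact: measurable_funX.
- move=> x; rewrite normrX (le_trans (hK x))// ler_wpM2r ?expR_ge0// lerDl.
  exact: mulr_ge0.
- move=> x; rewrite normrM normrX ger0_norm// mulrDl -[leLHS]add0r lerD//.
    by rewrite mulr_ge0// expR_ge0.
  by rewrite -mulrA ler_wpM2l.
Qed.

Lemma Rintegral_normal_sqr : \int[gamma]_x (x ^+ 2) = 1.
Proof.
rewrite Rintegral_normal_powSS mul1r; under eq_Rintegral do rewrite expr0.
exact: Rintegral_prob_cst.
Qed.

Lemma Rintegral_normal_pow4 : \int[gamma]_x (x ^+ 4) = 3.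
Proof. by rewrite Rintegral_normal_powSS Rintegral_normal_sqr mulr1. Qed.

(** By Stein's identity, the integral as a function of [t] solves
    [u' = - t u]. *)
Lemma Rintegral_normal_cos a t :
  \int[gamma]_x cos (a + t * x) = expR (- t ^+ 2 / 2) * cos a.
Proof.
have msin s : measurable_fun setT (fun x : R => sin (a + s * x)).
  apply: (measurableT_comp measurable_sin).
  by apply: measurable_funD => //; exact: measurable_funM.
pose u s := \int[gamma]_x cos (a + s * x).
have icos s : gamma.-integrable setT (EFin \o (fun x => cos (a + s * x))).
  exact: cos_affine_integrable.
have dcos s x : is_derive s 1 (fun s => cos (a + s * x)) (- (x * sin (a + s * x))).
  have h1 : is_derive s 1 (fun s => a + s * x) x.
    by apply: is_derive_eq; rewrite /GRing.scale/=; ring.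
  have h2 := @is_derive1_comp _ cos (fun s => a + s * x) s _ _ (is_derive_cos _) h1.
  by apply: is_derive_eq; rewrite mulNr mulrC.
have iabs : gamma.-integrable setT (EFin \o (fun x : R => `|x|)).
  apply: (@integrable_expR_norm _ 1 1) => // x.
  by rewrite normr_id !mul1r (le_trans _ (expR_ge1Dx _))// lerDr.
have stein s : \int[gamma]_x (x * sin (a + s * x)) = s * u s.
  rewrite /u -RintegralZl//.
  have df x : is_derive x 1 (fun x => sin (a + s * x)) (s * cos (a + s * x)).
    have h1 : is_derive x 1 (fun x => a + s * x) s.
      by apply: is_derive_eq; rewrite /GRing.scale/=; ring.
    have h2 := @is_derive1_comp _ sin (fun x => a + s * x) x _ _ (is_derive_sin _) h1.
    by apply: is_derive_eq; rewrite mulrC.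
  rewrite -(@stein_identity _ _ (1 + `|s|) df) //.
  - by apply: measurable_funM => //; exact: cos_affine_measurable.
  - move=> x; rewrite (le_trans (sin_max _))// -[leLHS]mulr1 ler_pM ?lerDl//.
    by rewrite -[leLHS]expR0 ler_expR.
  - move=> x; rewrite normrM ler_pM// ?lerDr// (le_trans (cos_max _))//.
    by rewrite -[leLHS]expR0 ler_expR.
have du s : is_derive s 1 u (- (s * u s)).
  have Is : `]s - 1, s + 1[%classic s by rewrite /= in_itv/= ltrBlDr ltrDl ltr01.
  have iI h : `]s - 1, s + 1[%classic h ->
      gamma.-integrable setT (EFin \o (fun x => cos (a + h * x))) by move=> _.
  have dI h x (_ : `]s - 1, s + 1[%classic h) (_ : [set: R] x) :=
    @ex_derive _ _ _ _ _ _ _ (dcos h x).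
  have d1 h x : (partial1of2 (fun s x => cos (a + s * x))) h x = - (x * sin (a + h * x)).
    by rewrite partial1of2E; have [_ ->] := dcos h x.
  have bI h x : `]s - 1, s + 1[%classic h -> [set: R] x ->
      `|(partial1of2 (fun s x => cos (a + s * x))) h x| <= `|x|.
    by move=> _ _; rewrite d1 normrN normrM ler_piMr// sin_max.
  have D1 := @derivable_under_integral R _ _ gamma (fun s x => cos (a + s * x))
    setT measurableT s _ _ Is iI dI _ (fun x : R => normr_ge0 x) iabs bI.
  have D2 := @differentiation_under_integral R _ _ gamma (fun s x => cos (a + s * x))
    setT measurableT s _ _ Is iI dI _ (fun x : R => normr_ge0 x) iabs bI.
  apply: DeriveDef => //; rewrite -derive1E [LHS]D2.
  rewrite -stein; under eq_Rintegral do rewrite d1 -mulN1r.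
  rewrite RintegralZl ?mulN1r//.
  apply: (le_integrable _ _ _ iabs) => //.
    by apply/measurable_EFinP; apply: measurable_funM => //; exact: msin.
  by move=> x _; rewrite /= lee_fin normr_id normrM ler_piMr// sin_max.
pose v s := u s * expR (s ^+ 2 / 2).
have dv s : is_derive s 1 v 0.
  have h1 : is_derive s 1 (fun s => s ^+ 2 / 2) s.
    by apply: is_derive_eq; rewrite /GRing.scale/=; field.
  have h2 := @is_derive1_comp _ expR (fun s => s ^+ 2 / 2) s _ _ (is_derive_expR _) h1.
  by rewrite /v; apply: is_derive_eq; rewrite /GRing.scale/=; ring.
have : v t = v 0 by exact: is_derive_0_is_cst.
rewrite /v expr0n/= mul0r expR0 mulr1 {2}/u.
under [X in _ = X -> _]eq_Rintegral do rewrite mul0r addr0.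
rewrite Rintegral_prob_cst => <-; rewrite mulrC -mulrA -expRD.
by rewrite (_ : t ^+ 2 / 2 + - t ^+ 2 / 2 = 0) ?expR0 ?mulr1//; ring.
Qed.

(** Up to a factor, the integrand times the normal density is the density of
    the normal law of variance [(1 + th)^-1]. *)
Lemma Rintegral_normal_gauss th : 0 <= th ->
  \int[gamma]_x expR (- (th * x ^+ 2) / 2) = (Num.sqrt (1 + th))^-1.
Proof.
move=> th0; have th1 : 0 < 1 + th by rewrite ltr_pwDl.
have sth : 0 < Num.sqrt (1 + th) by rewrite sqrtr_gt0.
have mf : measurable_fun setT (fun x : R => expR (- (th * x ^+ 2) / 2)).
  apply: measurableT_comp => //; apply: measurable_funM => //.
  by apply: measurable_funN; apply: measurable_funM => //; exact: measurable_funX.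
pose s := (Num.sqrt (1 + th))^-1.
have s0 : 0 < s by rewrite invr_gt0.
rewrite /Rintegral ge0_integral_normal//.
have -> : (\int[mu]_x (expR (- (th * x ^+ 2) / 2) * normal_pdf 0 1 x)%:E =
    \int[mu]_x (s%:E * (normal_pdf 0 s x)%:E))%E.
  apply: eq_integral => x _; rewrite -EFinM; congr EFin.
  rewrite !normal_pdfE ?oner_eq0 ?gt_eqF// /normal_peak /normal_fun.
  rewrite expr1n mul1r !subr0 [LHS]mulrCA [RHS]mulrA; congr (_ * _).
    rewrite -mulrnAr sqrtrM ?sqr_ge0// sqrtr_sqr gtr0_norm// invfM mulrA divff ?mul1r//.
    by rewrite gt_eqF.
  rewrite -expRD; congr expR; rewrite /s exprVn sqr_sqrtr ?ltW// !mulr2n.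
  by field; rewrite gt_eqF.
rewrite ge0_integralZl//.
- by rewrite integral_normal_pdf mule1.
- by apply/measurable_EFinP; exact: measurable_normal_pdf.
- by move=> x _; rewrite lee_fin normal_pdf_ge0.
- by rewrite lee_fin ltW.
Qed.

End gaussian.

(** * Normal and chi-square laws *)

Section laws.
Context d {T : measurableType d} {R : realType} (P : probability T R).
Implicit Types (X Y : T -> R) (a m v t : R).

Lemma Rintegral_normal_law_cos X m v a : measurable_fun setT X ->
  has_law P X (normal_law m v) -> 0 <= v ->
  \int[P]_w cos (a + X w) = expR (- v / 2) * cos (a + m).
Proof.
move=> mX lX v0.
have mcos : measurable_fun setT (fun x : R => cos (a + x)).
  by apply: (measurableT_comp measurable_cos); exact: measurable_funD.
have [v00|vN0] := eqVneq v 0.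
  move: lX; rewrite /normal_law v00 eqxx => lX.
  rewrite /Rintegral (integral_same_law mX (Q := @std_normal R) (Y := fun=> m) _ _ mcos).
  - rewrite -[fine _]/(\int[std_normal]_y cos (a + m)) Rintegral_prob_cst.
    by rewrite oppr0 mul0r expR0 mul1r.
  - exact: measurable_cst.
  - move=> A mA; rewrite lX// diracE preimage_cst.
    case: ifPn => _; first by apply/esym; exact: probability_setT.
    by rewrite measure0.
have v1 : 0 < v by rewrite lt_neqAle eq_sym vN0.
have s0 : 0 < Num.sqrt v by rewrite sqrtr_gt0.
move: lX; rewrite /normal_law (negbTE vN0) => lX.
rewrite /Rintegral.
rewrite (integral_same_law mX (Q := normal_prob m (Num.sqrt v)) (Y := id) _ _ mcos) //.
rewrite integral_normal_shift//; last first.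
  move=> x; apply: continuous_comp; last exact: continuous_cos.
  by apply: cvgD; [exact: cvg_cst|exact: cvg_id].
rewrite -[fine _]/(\int[std_normal]_x cos (a + (m + Num.sqrt v * x))).
under eq_Rintegral do rewrite addrA.
by rewrite Rintegral_normal_cos sqr_sqrtr.
Qed.

Lemma integral_std_normal_law X (f : R -> R) : measurable_fun setT X ->
  has_law P X (normal_prob 0 1) -> measurable_fun setT f ->
  (\int[P]_w (f (X w))%:E = \int[std_normal]_x (f x)%:E)%E.
Proof.
move=> mX lX mf.
by apply: (integral_same_law mX (Q := @std_normal R) (Y := fun x : measurableTypeR R => (x : R))).
Qed.

Lemma integrable_std_normal_law X (f : R -> R) : measurable_fun setT X ->
  has_law P X (normal_prob 0 1) -> measurable_fun setT f ->
  std_normal.-integrable setT (EFin \o f) ->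
  P.-integrable setT (EFin \o (fun w => f (X w))).
Proof.
move=> mX lX mf.
by apply: (integrable_same_law mX (Q := @std_normal R) (Y := fun x : measurableTypeR R => (x : R))).
Qed.

Lemma integral_chi2_law X (f : R -> R) : measurable_fun setT X ->
  has_law P X chi2_1 -> measurable_fun setT f ->
  (\int[P]_w (f (X w))%:E = \int[std_normal]_x (f (x ^+ 2))%:E)%E.
Proof.
move=> mX lX mf.
by apply: (integral_same_law mX (Q := @std_normal R) (Y := fun x : measurableTypeR R => (x : R) ^+ 2)).
Qed.

Lemma integrable_chi2_law X (f : R -> R) : measurable_fun setT X ->
  has_law P X chi2_1 -> measurable_fun setT f ->
  std_normal.-integrable setT (EFin \o (fun x => f (x ^+ 2))) ->
  P.-integrable setT (EFin \o (fun w => f (X w))).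
Proof.
move=> mX lX mf.
by apply: (integrable_same_law mX (Q := @std_normal R) (Y := fun x : measurableTypeR R => (x : R) ^+ 2)).
Qed.

Lemma chi2_law_ge0 X : measurable_fun setT X -> has_law P X chi2_1 ->
  {ae P, forall w, 0 <= X w}.
Proof.
move=> mX lX; exists (X @^-1` `]-oo, 0[%classic); split.
- by rewrite -[X in measurable X]setTI; exact: mX.
- rewrite lX// /chi2_1 (_ : _ @^-1` _ = set0) ?measure0//.
  apply/seteqP; split => // x /=; rewrite in_itv/= ltNge.
  by rewrite sqr_ge0.
- by move=> w /= /negP; rewrite -ltNge in_itv.
Qed.

End laws.

(** * Taylor bounds *)

Section taylor.
Context {R : realType}.
Implicit Types (f g : R -> R) (x y u : R).

(** By the mean value theorem [g - f] and [g + f] are nonnegative. *)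
Lemma derive_dominated f f' g g' : f 0 = 0 -> g 0 = 0 ->
  (forall x, 0 <= x -> is_derive x 1 f (f' x)) ->
  (forall x, 0 <= x -> is_derive x 1 g (g' x)) ->
  (forall x, 0 <= x -> `|f' x| <= g' x) -> forall x, 0 <= x -> `|f x| <= g x.
Proof.
move=> f0 g0 df dg fg x; rewrite le_eqVlt => /predU1P[<-|x0].
  by rewrite f0 g0 normr0.
have H (s : R) : s = 1 \/ s = -1 -> 0 <= g x - s * f x.
  move=> hs; pose h y := g y - s * f y.
  have dh y : 0 <= y -> is_derive y 1 h (g' y - s * f' y).
    move=> y0; have := df y y0; have := dg y y0 => dgy dfy.
    by rewrite /h; apply: is_derive_eq; rewrite /GRing.scale/=; ring.
  have dh' (y : R) : y \in `]0, x[ -> is_derive y 1 h (g' y - s * f' y).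
    by rewrite in_itv/= => /andP[/ltW y0 _]; exact: dh.
  have [|c c01 hc] := @MVT R h (fun y => g' y - s * f' y) 0 x x0 dh'; last first.
    have -> : g x - s * f x = h x - h 0 by rewrite /h f0 g0 mulr0 !subr0.
    rewrite hc.
    rewrite subr0; apply: mulr_ge0; last exact: ltW.
    have c0 : 0 <= c by rewrite (itvP c01).
    rewrite subr_ge0; apply: le_trans (fg c c0); case: hs => ->.
      by rewrite mul1r ler_norm.
    by rewrite mulN1r -normrN ler_norm.
  apply: derivable_within_continuous => y; rewrite in_itv/= => /andP[y0 _].
  by have [] := dh y y0.
rewrite ler_norml; have h1 := H 1 (or_introl erefl); have h2 := H (-1) (or_intror erefl).
by apply/andP; split; lra.
Qed.

(** This bound and the next three arise from one another by integration. *)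
Lemma sin_bound x : 0 <= x -> `|sin x| <= x.
Proof.
apply: (@derive_dominated sin cos id (fun=> 1)) => //; first exact: sin0.
by move=> y _; exact: cos_max.
Qed.

Lemma cos_bound2 x : 0 <= x -> `|1 - cos x| <= x ^+ 2 / 2.
Proof.
apply: (@derive_dominated (fun x => 1 - cos x) sin (fun x => x ^+ 2 / 2) id).
- by rewrite cos0 subrr.
- by rewrite expr0n/= mul0r.
- by move=> y _; apply: is_derive_eq; rewrite /GRing.scale/=; ring.
- by move=> y _; apply: is_derive_eq; rewrite /GRing.scale/=; field.
- exact: sin_bound.
Qed.

Lemma sin_bound3 x : 0 <= x -> `|x - sin x| <= x ^+ 3 / 6.
Proof.
apply: (@derive_dominated (fun x => x - sin x) (fun x => 1 - cos x)
  (fun x => x ^+ 3 / 6) (fun x => x ^+ 2 / 2)).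
- by rewrite sin0 subrr.
- by rewrite expr0n/= mul0r.
- by move=> y _; apply: is_derive_eq; rewrite /GRing.scale/=; field.
- exact: cos_bound2.
Qed.

Lemma cos_bound4 x : 0 <= x -> `|cos x - 1 + x ^+ 2 / 2| <= x ^+ 4 / 24.
Proof.
apply: (@derive_dominated (fun x => cos x - 1 + x ^+ 2 / 2) (fun x => x - sin x)
  (fun x => x ^+ 4 / 24) (fun x => x ^+ 3 / 6)).
- by rewrite cos0 subrr add0r expr0n/= mul0r.
- by rewrite expr0n/= mul0r.
- by move=> y _; apply: is_derive_eq; rewrite /GRing.scale/=; field.
- by move=> y _; apply: is_derive_eq; rewrite /GRing.scale/=; field.
- exact: sin_bound3.
Qed.

Lemma expRN_bound2 x : 0 <= x -> `|expR (- x) - 1 + x| <= x ^+ 2 / 2.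
Proof.
apply: (@derive_dominated (fun x => expR (- x) - 1 + x) (fun x => 1 - expR (- x))
  (fun x => x ^+ 2 / 2) id).
- by rewrite oppr0 expR0 subrr addr0.
- by rewrite expr0n/= mul0r.
- move=> y _; have h1 : is_derive y 1 (fun y : R => - y) (-1) by apply: is_derive_eq.
  have h2 := @is_derive1_comp _ expR (fun y : R => - y) y _ _ (is_derive_expR _) h1.
  by apply: is_derive_eq; rewrite mulrN1; ring.
- by move=> y _; apply: is_derive_eq; rewrite /GRing.scale/=; field.
- move=> y y0; rewrite ger0_norm; last by rewrite subr_ge0 -expR0 ler_expR oppr_le0.
  by rewrite lerBlDr -lerBlDl; exact: expR_ge1Dx.
Qed.

Lemma sin_taylor3 x : `|sin x - x| <= `|x| ^+ 3 / 6.
Proof.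
have [x0|x0] := leP 0 x; first by rewrite distrC (ger0_norm x0); exact: sin_bound3.
have nx : 0 <= - x by rewrite oppr_ge0 ltW.
by have := sin_bound3 nx; rewrite sinN (ltr0_norm x0) opprK addrC.
Qed.

Lemma cos_taylor4 x : `|cos x - 1 + x ^+ 2 / 2| <= x ^+ 4 / 24.
Proof.
have [x0|x0] := leP 0 x; first exact: cos_bound4.
have nx : 0 <= - x by rewrite oppr_ge0 ltW.
have := cos_bound4 nx; rewrite cosN (_ : (- x) ^+ 2 = x ^+ 2); last by ring.
by rewrite (_ : (- x) ^+ 4 = x ^+ 4); last by ring.
Qed.

End taylor.

(** * Sums of independent variables *)

Section more_independence.
Context d {T : measurableType d} {R : realType} (P : probability T R).
Implicit Types (X Y : T -> R) (a m v e c : R).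

Section depends_on.
Context (I : eqType) (F : I -> set (set T)).
Hypothesis FT : forall i, F i setT.

Lemma depends_on_sub (J J' : seq I) X : {subset J <= J'} ->
  depends_on F J X -> depends_on F J' X.
Proof.
move=> JJ' JX _ A mA; have := JX measurableT A mA.
apply: sub_smallest2r => // B [E EF ->].
exists (fun i => if i \in J then E i else setT).
  by move=> i iJ'; case: ifPn => [/EF//|_]; exact: FT.
apply/seteqP; split => [w Ew i /=|w /= Ew i /= iJ].
  by case: ifPn => // iJ _; exact: Ew.
by have := Ew i (JJ' _ iJ); rewrite iJ.
Qed.

Lemma depends_on_cst J c : depends_on F J (fun=> c).
Proof. exact: measurable_cst. Qed.

Lemma depends_onD J X Y : depends_on F J X -> depends_on F J Y ->
  depends_on F J (fun w => X w + Y w).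
Proof. by move=> ? ?; exact: measurable_funD. Qed.

Lemma depends_onM J X Y : depends_on F J X -> depends_on F J Y ->
  depends_on F J (fun w => X w * Y w).
Proof. by move=> ? ?; exact: measurable_funM. Qed.

Lemma depends_on_comp J X (g : R -> R) : measurable_fun setT g ->
  depends_on F J X -> depends_on F J (fun w => g (X w)).
Proof. by move=> mg ?; exact: measurableT_comp. Qed.

Lemma depends_on_sum (K : eqType) J (s : seq K) (X : K -> T -> R) :
  (forall k, k \in s -> depends_on F J (X k)) ->
  depends_on F J (fun w => \sum_(k <- s) X k w).
Proof.
elim: s => [|k s IH] sX.
  by under eq_fun do rewrite big_nil; exact: depends_on_cst.
under eq_fun do rewrite big_cons; apply: depends_onD.
  by apply: sX; rewrite mem_head.
by apply: IH => l ls; apply: sX; rewrite in_cons ls orbT.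
Qed.

End depends_on.

Lemma Rintegral_cos_indep X Y a : measurable_fun setT X -> measurable_fun setT Y ->
  indep_fun P X Y ->
  \int[P]_w cos (a + (X w + Y w)) = (\int[P]_w cos (a + X w)) * (\int[P]_w cos (Y w))
    - (\int[P]_w sin (a + X w)) * (\int[P]_w sin (Y w)).
Proof.
move=> mX mY XY.
have mc := @measurable_cos R; have ms := @measurable_sin R.
have mca : measurable_fun setT (fun x : R => cos (a + x)).
  by apply: measurableT_comp => //; exact: measurable_funD.
have msa : measurable_fun setT (fun x : R => sin (a + x)).
  by apply: measurableT_comp => //; exact: measurable_funD.
have bi (f : R -> R) (Z : T -> R) : measurable_fun setT f -> measurable_fun setT Z ->
    (forall x, `|f x| <= 1) -> P.-integrable setT (EFin \o (f \o Z)).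
  move=> mf mZ f1; apply: (@bounded_integrable _ _ _ _ _ 1) => [|w]; last exact: f1.
  exact: measurableT_comp.
have c1 := bi _ _ mca mX (fun x => cos_max (a + x)).
have s1 := bi _ _ msa mX (fun x => sin_max (a + x)).
have c2 := bi _ _ mc mY (@cos_max R).
have s2 := bi _ _ ms mY (@sin_max R).
have [i1 E1] := indep_Rintegral_mul (measurableT_comp mca mX) (measurableT_comp mc mY)
  (indep_fun_comp mca mc XY) c1 c2.
have [i2 E2] := indep_Rintegral_mul (measurableT_comp msa mX) (measurableT_comp ms mY)
  (indep_fun_comp msa ms XY) s1 s2.
rewrite -[X in X - _]E1 -[X in _ - X]E2 -RintegralB//.
by apply: eq_Rintegral => w _; rewrite addrA (cosD (a + X w)).
Qed.

(** The hypothesis gives the integrals of both [cos (Y w)] and [sin (Y w)],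
    the latter by a phase shift; the addition formulas do the rest. *)
Lemma Rintegral_cos_normal X Y a m v : measurable_fun setT X ->
  measurable_fun setT Y -> indep_fun P X Y ->
  (forall a, \int[P]_w cos (a + Y w) = expR (- v / 2) * cos (a + m)) ->
  \int[P]_w cos (a + (X w + Y w)) = expR (- v / 2) * \int[P]_w cos (a + m + X w).
Proof.
move=> mX mY XY hY; rewrite Rintegral_cos_indep//.
have -> : \int[P]_w cos (Y w) = expR (- v / 2) * cos m.
  rewrite -[cos m](congr1 cos (add0r m)) -hY.
  by apply: eq_Rintegral => w _; rewrite add0r.
have -> : \int[P]_w sin (Y w) = expR (- v / 2) * sin m.
  rewrite -cosBpihalf addrC -hY; apply: eq_Rintegral => w _.
  by rewrite -cosBpihalf addrC.
have mS : measurable_fun setT (fun w => a + X w) by exact: measurable_funD.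
have int (f : R -> R) : measurable_fun setT f -> (forall x, `|f x| <= 1) ->
    P.-integrable setT (EFin \o (fun w => f (a + X w))).
  move=> mf f1; apply: (@bounded_integrable _ _ _ _ _ 1) => [|w]; last exact: f1.
  exact: (measurableT_comp mf mS).
have ic := int cos (@measurable_cos R) (@cos_max R).
have isn := int sin (@measurable_sin R) (@sin_max R).
have -> : \int[P]_w cos (a + m + X w) =
    cos m * (\int[P]_w cos (a + X w)) - sin m * (\int[P]_w sin (a + X w)).
  rewrite -!RintegralZl// -RintegralB//; try exact: integrable_scale.
  apply: eq_Rintegral => w _; rewrite (_ : a + m + X w = (a + X w) + m); last by ring.
  by rewrite cosD; ring.
by ring.
Qed.

Lemma integrable_sqr_id X : measurable_fun setT X ->
  P.-integrable setT (EFin \o (fun w => X w ^+ 2)) -> P.-integrable setT (EFin \o X).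
Proof.
move=> mX X2.
have := integrable_add (prob_integrable_cst P 1) X2; apply: le_integrable => //; first exact/measurable_EFinP.
move=> w _; rewrite /= lee_fin [leRHS]ger0_norm ?addr_ge0 ?sqr_ge0//.
rewrite -[X w ^+ 2]real_normK ?num_real//.
have := sqr_ge0 (`|X w| - 2^-1); nra.
Qed.

Lemma indep_Rintegral_sqr X Y : measurable_fun setT X -> measurable_fun setT Y ->
  indep_fun P X Y -> P.-integrable setT (EFin \o (fun w => X w ^+ 2)) ->
  P.-integrable setT (EFin \o (fun w => Y w ^+ 2)) -> \int[P]_w Y w = 0 ->
  P.-integrable setT (EFin \o (fun w => (X w + Y w) ^+ 2)) /\
  \int[P]_w ((X w + Y w) ^+ 2) = \int[P]_w (X w ^+ 2) + \int[P]_w (Y w ^+ 2).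
Proof.
move=> mX mY XY X2 Y2 Y0.
have [iXY EXY] := indep_Rintegral_mul mX mY XY (integrable_sqr_id mX X2) (integrable_sqr_id mY Y2).
have E w : (X w + Y w) ^+ 2 = X w ^+ 2 + Y w ^+ 2 + 2 * (X w * Y w) by ring.
have i1 := integrable_add X2 Y2.
have i2 := integrable_scale 2 iXY.
split; first by under eq_fun do rewrite E; exact: integrable_add.
under eq_Rintegral do rewrite E.
rewrite RintegralDprob// RintegralDprob// RintegralZl//.
by rewrite [X in 2 * X]EXY Y0 mulr0 mulr0 addr0.
Qed.

End more_independence.

(** * Almost sure convergence of series of independent variables *)

Section orthonormal_sequence.
Context d {T : measurableType d} {R : realType} (P : probability T R).
Context (F : nat -> set (set T)) (xi : nat -> T -> R).
Hypothesis FT : forall i, F i setT.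
Hypothesis FI : forall i, setI_closed (F i).
Hypothesis mF : forall i, F i `<=` measurable.
Hypothesis indF : mutually_independent P F.
Hypothesis xiF : forall s, preimage_set_system setT (xi s) measurable `<=` F s.
Hypothesis xi2 : forall s, P.-integrable setT (EFin \o (fun w => xi s w ^+ 2)).
Hypothesis xi_mean : forall s, \int[P]_w xi s w = 0.
Hypothesis xi_var : forall s, \int[P]_w (xi s w ^+ 2) = 1.
Implicit Types (c : nat -> R) (m n s : nat).

Lemma xi_depends s J : s \in J -> depends_on F J (xi s).
Proof. by move=> sJ; apply: (depends_on_mem FT sJ); exact: xiF. Qed.

Lemma xi_measurable s : measurable_fun setT (xi s).
Proof. exact: (depends_on_measurable mF (xi_depends (mem_head s [::]))). Qed.

Definition block c m n (w : T) : R := \sum_(m <= s < n) c s * xi s w.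

Lemma block_depends c m n : depends_on F (index_iota m n) (block c m n).
Proof.
apply: depends_on_sum => s sJ; apply: depends_onM; first exact: depends_on_cst.
exact: xi_depends.
Qed.

Lemma block_measurable c m n : measurable_fun setT (block c m n).
Proof. exact: (depends_on_measurable mF (@block_depends c m n)). Qed.

Lemma indep_next m n X : depends_on F (index_iota m n) X -> indep_fun P X (xi n).
Proof.
move=> JX; apply: (depends_on_indep FT FI mF indF _ JX
  (xi_depends (mem_head n [::]))).
rewrite cats1 rcons_uniq iota_uniq andbT mem_index_iota ltnn andbF.
by [].
Qed.

Lemma xi_integrable s : P.-integrable setT (EFin \o xi s).
Proof. by apply: integrable_sqr_id => //; exact: xi_measurable. Qed.

Lemma block_var c m n : (m <= n)%N ->
  P.-integrable setT (EFin \o (fun w => block c m n w ^+ 2)) /\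
  \int[P]_w (block c m n w ^+ 2) = \sum_(m <= s < n) c s ^+ 2.
Proof.
move=> /subnKC <-; elim: (n - m)%N => [|k [IH1 IH2]].
  rewrite addn0 big_geq//; have E w : block c m m w ^+ 2 = 0.
    by rewrite /block big_geq// expr0n.
  rewrite (funext E).
  split; last exact: Rintegral_prob_cst.
  exact: prob_integrable_cst.
have E w : block c m (m + k.+1) w = block c m (m + k) w + c (m + k)%N * xi (m + k) w.
  by rewrite /block addnS big_nat_recr ?leq_addr.
rewrite (funext E).
have i2 : P.-integrable setT (EFin \o (fun w => (c (m + k)%N * xi (m + k) w) ^+ 2)).
  by under eq_fun do rewrite exprMn; exact: integrable_scale.
have [|||//|//||h1 h2] := @indep_Rintegral_sqr _ _ _ P (block c m (m + k))
    (fun w => c (m + k)%N * xi (m + k) w).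
- exact: block_measurable.
- by apply: measurable_funM => //; exact: xi_measurable.
- apply: (@indep_fun_comp _ _ _ P _ _ id (fun x => c (m + k)%N * x)) => //.
  + exact: measurable_funM.
  + by apply: indep_next; exact: block_depends.
- by rewrite RintegralZl//; [rewrite xi_mean mulr0|exact: xi_integrable].
split => //; rewrite h2 IH2 addnS big_nat_recr ?leq_addr//=; congr (_ + _).
by under eq_Rintegral do rewrite exprMn; rewrite RintegralZl// xi_var mulr1.
Qed.

(** The partial sums from [m] on, frozen once they leave [[-e, e]]. *)
Fixpoint stopped_block c m (e : R) k (w : T) : R :=
  if k is k'.+1 then
    stopped_block c m e k' w + \1_(`[- e, e]%classic : set R) (stopped_block c m e k' w)
      * (c (m + k')%N * xi (m + k') w)
  else 0.

Lemma stopped_block_inside c m e k w : `|stopped_block c m e k w| <= e ->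
  stopped_block c m e k w = block c m (m + k) w /\
  forall j, (j <= k)%N -> `|block c m (m + j) w| <= e.
Proof.
elim: k => [|k IH] /=.
  rewrite normr0 => e0; rewrite addn0 /block big_geq//; split => // j.
  by rewrite leqn0 => /eqP ->; rewrite addn0 big_geq// normr0.
rewrite indicE; have [|out] := boolP (_ \in _); last first.
  rewrite mul0r addr0 => /IH[E1 E2].
  have : stopped_block c m e k w \in `[- e, e]%classic.
    by rewrite inE/= in_itv/= -ler_norml E1 (E2 k (leqnn k)).
  by rewrite (negbTE out).
rewrite inE/= in_itv/= -ler_norml => /IH[-> E2].
rewrite mul1r; have -> : block c m (m + k) w + c (m + k)%N * xi (m + k) w =
    block c m (m + k.+1) w by rewrite /block addnS big_nat_recr ?leq_addr.
move=> le_e; split => // j; rewrite leq_eqVlt => /predU1P[->//|]; exact: E2.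
Qed.

Lemma stopped_block_depends c m e k :
  depends_on F (index_iota m (m + k)) (stopped_block c m e k).
Proof.
elim: k => [|k IH]; first exact: depends_on_cst.
have sub : {subset index_iota m (m + k) <= index_iota m (m + k.+1)}.
  move=> j; rewrite !mem_index_iota => /andP[-> /leq_trans]; apply.
  by rewrite leq_add2l.
have IH' := depends_on_sub FT sub IH.
apply: depends_onD => //; apply: depends_onM.
  by apply: (depends_on_comp _ IH'); exact: measurable_indic.
apply: depends_onM; first exact: depends_on_cst.
by apply: xi_depends; rewrite mem_index_iota leq_addr/= addnS.
Qed.

Lemma stopped_block_var c m e k :
  P.-integrable setT (EFin \o (fun w => stopped_block c m e k w ^+ 2)) /\
  \int[P]_w (stopped_block c m e k w ^+ 2) <= \sum_(m <= s < m + k) c s ^+ 2.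
Proof.
elim: k => [|k [IH1 IH2]].
  have E (w : T) : stopped_block c m e 0 w ^+ 2 = 0 by rewrite /= expr0n.
  rewrite (funext E) addn0 big_geq// Rintegral_prob_cst; split => //.
  exact: prob_integrable_cst.
set S := stopped_block c m e k in IH1 IH2 *.
pose U w : R := \1_(`[- e, e]%classic : set R) (S w).
have dS : depends_on F (index_iota m (m + k)) S by exact: stopped_block_depends.
have dU : depends_on F (index_iota m (m + k)) U.
  by apply: (depends_on_comp _ dS); exact: measurable_indic.
have mS := depends_on_measurable mF dS; have mU := depends_on_measurable mF dU.
have dSU : depends_on F (index_iota m (m + k)) (fun w => S w * U w).
  exact: depends_onM.
have U01 w : 0 <= U w <= 1 by rewrite /U indicE; case: (_ \in _); rewrite ?lexx ?ler01.
have UU w : U w ^+ 2 = U w.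
  by rewrite /U indicE; case: (_ \in _); rewrite ?expr0n ?expr1n.
have iU : P.-integrable setT (EFin \o U).
  apply: (@bounded_integrable _ _ _ _ _ 1) => // w.
  by rewrite ger0_norm; case/andP: (U01 w).
have iS : P.-integrable setT (EFin \o S) by exact: integrable_sqr_id.
have iSU : P.-integrable setT (EFin \o (fun w => S w * U w)).
  apply: (le_integrable _ _ _ iS) => //.
    by apply/measurable_EFinP; exact: measurable_funM.
  move=> w _; rewrite /= lee_fin normrM ler_piMr//.
  by rewrite ger0_norm; case/andP: (U01 w).
have mxi := xi_measurable (m + k).
have [i1 E1] := indep_Rintegral_mul (depends_on_measurable mF dSU) mxi
  (indep_next dSU) iSU (xi_integrable (m + k)).
have mx2 : measurable_fun setT (fun x : R => x ^+ 2) by exact: measurable_funX.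
have [i2 E2] := indep_Rintegral_mul (depends_on_measurable mF dU)
  (measurableT_comp mx2 mxi)
  (indep_fun_comp (@measurable_id _ _ _) mx2 (indep_next dU)) iU (xi2 (m + k)).
set cc := c (m + k)%N.
have E w : stopped_block c m e k.+1 w ^+ 2 =
    S w ^+ 2 + ((2 * cc) * (S w * U w * xi (m + k) w) + cc ^+ 2 * (U w * xi (m + k) w ^+ 2)).
  by rewrite /= -/S -/cc -/(U w) -{3}(UU w); ring.
have j1 := integrable_scale (2 * cc) i1.
have j2 := integrable_scale (cc ^+ 2) i2.
have j3 := integrable_add j1 j2.
rewrite (funext E).
split; first exact: integrable_add.
rewrite RintegralDprob// RintegralDprob// RintegralZl// RintegralZl//.
rewrite addnS big_nat_recr ?leq_addr//= lerD//.
rewrite [X in 2 * cc * X]E1 [X in cc ^+ 2 * X]E2 xi_mean mulr0 mulr0 add0r.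
rewrite [X in _ * (_ * X)]xi_var mulr1 ler_piMr ?sqr_ge0//.
rewrite -[leRHS](Rintegral_prob_cst P); apply: le_Rintegral => //.
  exact: prob_integrable_cst.
by move=> w _; case/andP: (U01 w).
Qed.

(** Kolmogorov's maximal inequality: the frozen partial sums leave [[-e, e]]
    exactly when some partial sum does, and their second moment is at most that
    of the full sum. *)
Lemma kolmogorov_maximal c m k (e : R) : 0 < e ->
  (P (\bigcup_(j in `I_k.+1) [set w | (e < `|block c m (m + j)%N w|)%R])
   <= (e ^- 2 * \sum_(m <= s < m + k) c s ^+ 2)%R%:E)%E.
Proof.
move=> e0; set A := \bigcup_(j in _) _.
have mS := depends_on_measurable mF (@stopped_block_depends c m e k).
have mA : measurable A.
  apply: bigcup_measurable => j _.
  rewrite (_ : [set w | _] = (fun w => `|block c m (m + j) w|) @^-1` `]e, +oo[%classic).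
    rewrite -[X in measurable X]setTI.
    have : measurable_fun setT (fun w => `|block c m (m + j) w|).
      by apply: measurableT_comp => //; exact: block_measurable.
    by apply.
  by apply/seteqP; split => w /=; rewrite in_itv/= andbT.
have [iS2 S2] := stopped_block_var c m e k.
have AS w : A w -> e < `|stopped_block c m e k w|.
  move=> [j /= jk ej]; rewrite ltNge; apply/negP => /stopped_block_inside[_ /(_ j)].
  by rewrite leNgt ej => /(_ jk).
have -> : P A = (\int[P]_w (\1_A w))%:E.
  by rewrite /Rintegral integral_indic// setIT fineK// fin_num_measure.
rewrite lee_fin; apply: (@le_trans _ _ (e ^- 2 * \int[P]_w (stopped_block c m e k w ^+ 2))).
  rewrite -RintegralZl//; apply: le_Rintegral => //.
  - apply: (@bounded_integrable _ _ _ _ _ 1); first exact: measurable_indic.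
    by move=> w; rewrite indicE; case: (_ \in _); rewrite ?normr1// normr0.
  - exact: integrable_scale.
  - move=> w _; rewrite indicE; case: (boolP (w \in A)) => [|_]; last first.
      by rewrite mulr_ge0 ?sqr_ge0// invr_ge0 sqr_ge0.
    rewrite inE => /AS ltS; rewrite mulrC ler_pdivlMr ?exprn_gt0// mul1r.
    rewrite -(@real_normK _ (stopped_block c m e k w)) ?num_real//.
    by rewrite lerXn2r ?nnegrE// ltW.
by rewrite ler_wpM2l// invr_ge0 sqr_ge0.
Qed.

Lemma block_dist c N n w : (N <= n)%N -> block c 0 n w - block c 0 N w = block c N n w.
Proof.
by move=> Nn; rewrite /block (big_cat_nat (leq0n N) Nn)/= addrAC subrr add0r.
Qed.

(** By the maximal inequality the oscillation of the partial sums beyond [N]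
    is small in probability for large [N], so that almost surely they form a
    Cauchy sequence. *)
Lemma block_cvg c (L : R) : (forall n, \sum_(0 <= s < n) c s ^+ 2 <= L) ->
  {ae P, forall w, cvgn (fun n => block c 0 n w)}.
Proof.
move=> cL.
have cvgc : cvgn (fun n => \sum_(0 <= s < n) c s ^+ 2).
  apply: nondecreasing_is_cvgn.
    apply/nondecreasing_seqP => n; rewrite big_nat_recr//= lerDl; exact: sqr_ge0.
  by exists L => _ [n _ <-].
set l := limn _ in cvgc.
have tail N n : (N <= n)%N -> \sum_(N <= s < n) c s ^+ 2 <= l - \sum_(0 <= s < N) c s ^+ 2.
  move=> Nn; rewrite lerBrDl -(big_cat_nat (leq0n N) Nn)/=.
  apply: (@nondecreasing_cvgn_le _ (fun n => \sum_(0 <= s < n) c s ^+ 2)) => //.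
  apply/nondecreasing_seqP => i; rewrite big_nat_recr//= lerDl; exact: sqr_ge0.
pose bad (e : R) (N : nat) := \bigcup_j [set w | e < `|block c N (N + j) w|].
have mbad1 (e : R) N j : measurable [set w | e < `|block c N (N + j) w|].
  rewrite (_ : [set w | _] = (fun w => `|block c N (N + j) w|) @^-1` `]e, +oo[%classic).
    rewrite -[X in measurable X]setTI.
    have : measurable_fun setT (fun w => `|block c N (N + j) w|).
      by apply: measurableT_comp => //; exact: block_measurable.
    by apply.
  by apply/seteqP; split => w /=; rewrite in_itv/= andbT.
have mbad (e : R) (N : nat) : measurable (bad e N) by apply: bigcup_measurable => j _; exact: mbad1.
have bad_le (e : R) (N : nat) : 0 < e ->
    (P (bad e N) <= (e ^- 2 * (l - \sum_(0 <= s < N) c s ^+ 2))%R%:E)%E.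
  move=> e0; pose A k := \bigcup_(j in `I_k.+1) [set w | e < `|block c N (N + j) w|].
  have -> : bad e N = \bigcup_k A k.
    apply/seteqP; split => [w [j _ jw]|w [k _ [j _ jw]]]; last by exists j.
    by exists j => //; exists j => /=.
  have mA k : measurable (A k) by apply: bigcup_measurable => j _; exact: mbad1.
  have ndA : nondecreasing_seq A.
    apply/nondecreasing_seqP => k; apply/subsetPset => w [j /= jk jw].
    by exists j => //=; exact: ltnW.
  have cvgA := @nondecreasing_cvg_mu _ _ _ P A mA (bigcupT_measurable _ mA) ndA.
  have PA : (limn (P \o A) = P (\bigcup_k A k))%E by exact: cvg_lim cvgA.
  rewrite -PA; apply: lime_le; first by apply/cvg_ex; eexists; exact: cvgA.
  apply: nearW => k /=; apply: le_trans (kolmogorov_maximal c N k e0) _.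
  by rewrite lee_fin ler_wpM2l ?invr_ge0 ?sqr_ge0// tail// leq_addr.
pose Bad j := \bigcap_N bad (j.+1%:R^-1) N.
have mBad j : measurable (Bad j) by exact: bigcapT_measurable.
have Bad0 j : P (Bad j) = 0.
  have e0 : 0 < j.+1%:R^-1 :> R by rewrite invr_gt0.
  apply/eqP; rewrite eq_le measure_ge0 andbT; apply/lee_addgt0Pr => h h0.
  rewrite add0e.
  have h1 : 0 < h * j.+1%:R^-1 ^+ 2 by rewrite mulr_gt0// exprn_gt0.
  have [N _ /(_ N (leqnn N)) hN] : \forall N \near \oo, `|l - \sum_(0 <= s < N) c s ^+ 2| <= h * j.+1%:R^-1 ^+ 2.
    by move/cvgrPdist_le : cvgc => /(_ _ h1).
  apply: (@le_trans _ _ (P (bad (j.+1%:R^-1) N))).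
    by apply: le_measure; rewrite ?inE//; apply: bigcap_inf.
  apply: le_trans (bad_le _ N e0) _; rewrite lee_fin mulrC ler_pdivrMr ?exprn_gt0//.
  exact: le_trans (ler_norm _) hN.
apply: (@negligibleS _ _ _ P (\bigcup_j Bad j)); last first.
  apply: negligible_bigcup => j; apply/negligibleP => //; exact: Bad0.
move=> w /= nc; apply: contrapT => nB; apply: nc.
apply/cauchy_cvgP/cauchy_exP => e e0.
have [j je] : exists j, j.+1%:R^-1 < e / 2.
  pose j := Num.truncn (e / 2)^-1; exists j.
  rewrite invf_plt ?posrE ?divr_gt0//; exact: truncnS_gt.
have [N hN] : exists N, ~ bad (j.+1%:R^-1) N w.
  apply/not_existsP => allN; apply: nB; exists j => // N _.
  by apply: contrapT => nb; exact: (allN N nb).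
have close n : (N <= n)%N -> `|block c 0 n w - block c 0 N w| <= j.+1%:R^-1.
  move=> Nn; rewrite block_dist// leNgt; apply/negP => lt; apply: hN.
  by exists (n - N)%N => //=; rewrite subnKC.
exists (block c 0 N w); exists N => // n /= Nn.
rewrite /ball/= distrC (le_lt_trans (close n Nn))// (lt_trans je)//.
by rewrite ltr_pdivrMr// ltr_pMr// ltr1n.
Qed.

End orthonormal_sequence.

(** * Diagonalization of real symmetric matrices *)

Section spectral_theorem.
Context {R : rcfType}.
Implicit Types (n : nat) (a x : R).

Lemma row_sqr_ge0 n (u : 'rV[R]_n) : 0 <= (u *m u^T) 0 0.
Proof. by rewrite mxE sumr_ge0// => i _; rewrite !mxE -expr2 sqr_ge0. Qed.

Lemma row_sqr_gt0 n (u : 'rV[R]_n) : u != 0 -> 0 < (u *m u^T) 0 0.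
Proof.
move=> u0; rewrite lt_neqAle row_sqr_ge0 andbT eq_sym; apply: contra_neq u0 => u0.
apply/rowP => i; rewrite mxE; move: u0; rewrite mxE => /eqP.
rewrite psumr_eq0 => [/allP/(_ i)|j _]; last by rewrite !mxE -expr2 sqr_ge0.
by rewrite mem_index_enum !mxE -expr2 sqrf_eq0 => /(_ isT)/eqP.
Qed.

(** Householder's reflection in the hyperplane orthogonal to [u - v]. *)
Lemma householder n (u v : 'rV[R]_n) : (u *m u^T) 0 0 = 1 -> (v *m v^T) 0 0 = 1 ->
  exists H : 'M[R]_n, [/\ H^T = H, H *m H = 1%:M & v *m H = u].
Proof.
move=> u1 v1; have [->|uv] := eqVneq u v.
  by exists 1%:M; rewrite trmx1 !mulmx1.
pose w := u - v; have w0 : w != 0 by rewrite subr_eq0.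
pose q := (w *m w^T) 0 0; have q0 : 0 < q by exact: row_sqr_gt0.
have qE : w *m w^T = q%:M by rewrite [LHS]mx11_scalar.
exists (1%:M - (2 / q) *: (w^T *m w)); split.
- by rewrite linearB/= trmx1 linearZ/= trmx_mul trmxK.
- set W := _ *: _; have WW : W *m W = W + W.
    rewrite /W -scalemxAl -scalemxAr mulmxA -(mulmxA w^T w) qE.
    rewrite mul_mx_scalar -scalemxAl !scalerA -scalerDl; congr (_ *: _).
    by field; rewrite gt_eqF.
  rewrite mulmxBl mul1mx mulmxBr mulmx1 WW; move: W {WW} => W.
  by apply/matrixP => i j; rewrite !mxE; ring.
- have uvC : (u *m v^T) 0 0 = (v *m u^T) 0 0.
    by rewrite -[u *m v^T]trmxK trmx_mul trmxK mxE.
  have vw : (v *m w^T) 0 0 = - q / 2.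
    rewrite /q /w linearB/= mulmxBl !mulmxBr !mxE in u1 v1 uvC *.
    by rewrite u1 v1 uvC; field.
  rewrite mulmxBr mulmx1 -scalemxAr mulmxA [v *m w^T]mx11_scalar vw.
  rewrite mul_scalar_mx scalerA.
  rewrite (_ : 2 / q * (- q / 2) = -1); last by field; rewrite gt_eqF.
  by rewrite scaleN1r opprK /w addrC subrK.
Qed.

Lemma char_poly_conj n (H A : 'M[R]_n) : H *m H = 1%:M ->
  char_poly (H *m A *m H) = char_poly A.
Proof.
move=> HH; rewrite /char_poly.
have -> : char_poly_mx (H *m A *m H) =
    map_mx polyC H *m char_poly_mx A *m map_mx polyC H.
  rewrite /char_poly_mx mulmxBr mulmxBl !map_mxM; congr (_ - _).
  by rewrite mul_mx_scalar -scalemxAl -map_mxM HH map_mx1 scalemx1.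
rewrite !det_mulmx mulrC mulrA -det_mulmx -map_mxM HH map_mx1 det1 mul1r.
by [].
Qed.

Lemma char_poly_block n x (B : 'M[R]_n) :
  char_poly (block_mx (x%:M : 'M[R]_1) 0 0 B) = ('X - x%:P) * char_poly B.
Proof.
rewrite /char_poly /char_poly_mx map_block_mx !map_mx0 map_scalar_mx.
rewrite (@scalar_mx_block _ 1 n 'X) opp_block_mx add_block_mx.
rewrite !oppr0 !addr0 det_ublock; congr (_ * _).
by rewrite -raddfB det_scalar1.
Qed.

(** Since the characteristic polynomial splits, there is a real eigenvector; a
    reflection moves it to the first basis vector, and by symmetry the first
    row and column then vanish off the diagonal. *)
Theorem symmetric_spectral n (A : 'M[R]_n) (s : seq R) : A^T = A ->
  char_poly A = \prod_(x <- s) ('X - x%:P) ->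
  exists2 O : 'M[R]_n, O *m O^T = 1%:M & O *m A *m O^T = diag_mx (\row_i s`_i).
Proof.
elim: n A s => [|n IH] A s AT cA.
  by exists 1%:M; apply/matrixP => -[].
have : size s = n.+1.
  by have := size_char_poly A; rewrite cA size_prod_XsubC => -[].
case: s cA => [//|x s] cA _.
have /eigenvalueP[v vA v0] : eigenvalue A x.
  by rewrite eigenvalue_root_char cA big_cons rootM root_XsubC eqxx.
pose q := (v *m v^T) 0 0; have q0 : 0 < q by exact: row_sqr_gt0.
pose r := Num.sqrt q; have r0 : 0 < r by rewrite sqrtr_gt0.
pose u := r^-1 *: v.
have u1 : (u *m u^T) 0 0 = 1.
  rewrite /u linearZ/= -scalemxAl -scalemxAr scalerA mxE -/q.
  by rewrite -invfM -expr2 sqr_sqrtr ?ltW// mulVf// gt_eqF.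
have uA : u *m A = x *: u by rewrite /u -scalemxAl vA !scalerA mulrC.
pose e : 'rV[R]_(1 + n) := delta_mx 0 0.
have e1 : (e *m e^T) 0 0 = 1 by rewrite trmx_delta mul_delta_mx mxE !eqxx.
have [H [HT HH eH]] := householder u1 e1.
pose B : 'M[R]_(1 + n) := H *m A *m H.
have BT : B^T = B by rewrite !trmx_mul HT AT mulmxA.
have eB : e *m B = x *: e.
  by rewrite /B !mulmxA eH uA -scalemxAl -eH -mulmxA HH mulmx1.
have B0 j : B 0 j = x * (j == 0)%:R.
  have := congr1 (fun M : 'rV_(1 + n) => M 0 j) eB.
  by rewrite -rowE !mxE eqxx/=.
have cB : char_poly B = char_poly A by exact: char_poly_conj.
have BE : H *m A *m H = B by [].
clearbody B; pose D := drsubmx B.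
have Bblock : B = block_mx (x%:M : 'M[R]_1) 0 0 D.
  rewrite -[LHS]submxK; congr block_mx; apply/matrixP => i j.
  - by rewrite !mxE !ord1 lshift0 B0 eqxx mulr1.
  - by rewrite !mxE ord1 lshift0 B0 mulr0.
  - by rewrite !mxE ord1 lshift0 -BT mxE B0 mulr0.
have DT : D^T = D by rewrite /D trmx_drsub BT.
have cD : char_poly D = \prod_(y <- s) ('X - y%:P).
  move: cB; rewrite cA Bblock char_poly_block big_cons.
  by apply: mulfI; rewrite polyXsubC_eq0.
have [U U1 UD] := IH D s DT cD.
pose K : 'M[R]_(1 + n) := block_mx 1%:M 0 0 U.
have KK : K *m K^T = 1%:M.
  rewrite /K tr_block_mx !trmx0 trmx1 mulmx_block !(mulmx0, mul0mx, addr0, add0r).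
  by rewrite mulmx1 U1 -scalar_mx_block.
have KBK : K *m B *m K^T = block_mx (x%:M : 'M[R]_1) 0 0 (diag_mx (\row_i s`_i)).
  rewrite Bblock /K tr_block_mx !trmx0 trmx1.
  rewrite !mulmx_block !(mulmx0, mul0mx, addr0, add0r).
  by rewrite mul1mx mulmx1 UD.
exists (K *m H); first by rewrite trmx_mul HT mulmxA -(mulmxA K) HH mulmx1.
rewrite trmx_mul HT !mulmxA -(mulmxA K) -(mulmxA K) BE KBK.
apply/matrixP => i j; rewrite !mxE.
case: splitP => i' ii'; rewrite !mxE; case: splitP => j' jj'; rewrite !mxE.
- have -> : (i == j) = (i' == j' :> nat) by rewrite -val_eqE/= ii' jj'.
  by rewrite val_eqE ii' (ord1 i') (ord1 j').
- by rewrite (_ : (i == j) = false)// -val_eqE/= ii' jj' (ord1 i').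
- by rewrite (_ : (i == j) = false)// -val_eqE/= ii' jj' (ord1 j').
- have -> : (i == j) = (i' == j' :> nat) by rewrite -val_eqE/= ii' jj' eqn_add2l.
  by rewrite val_eqE ii'.
Qed.

End spectral_theorem.

(** * Laplace transforms of Gaussian quadratic forms *)

Section gaussian_quadratic_form.
Context d {T : measurableType d} {R : realType} (P : probability T R).

Lemma Rintegral_Fubini d' (T' : measurableType d') (Q : probability T' R)
    (f : T * T' -> R) (B : R) : measurable_fun setT f -> (forall z, `|f z| <= B) ->
  \int[P]_x \int[Q]_y f (x, y) = \int[Q]_y \int[P]_x f (x, y).
Proof.
move=> mf fB.
have ifx x : Q.-integrable setT (EFin \o (fun y => f (x, y))).
  apply: (@bounded_integrable _ _ _ _ _ B) => [|y]; last exact: fB.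
  exact: measurableT_comp.
have ify y : P.-integrable setT (EFin \o (fun x => f (x, y))).
  apply: (@bounded_integrable _ _ _ _ _ B) => [|x]; last exact: fB.
  exact: measurableT_comp.
have B0 : 0 <= B by exact: le_trans (normr_ge0 _) (fB (point, point)).
have iPQ : (P \x Q)%E.-integrable setT (EFin \o f).
  apply/integrable12ltyP; first exact/measurable_EFinP.
  apply: (@le_lt_trans _ _ (\int[P]_x B%:E)%E); last first.
    rewrite integral_cst//=.
    have -> : P setT = 1%E by exact: probability_setT.
    by rewrite mule1 ltry.
  apply: ge0_le_integral => //.
  - by move=> x _; exact: integral_ge0.
  - apply: (measurable_fun_fubini_tonelli_F (fun z => `|(f z)%:E|%E)) => //.
    by apply: measurableT_comp => //; exact/measurable_EFinP.
  - move=> x _; apply: (@le_trans _ _ (\int[Q]_y B%:E)%E).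
      apply: ge0_le_integral => //.
        by apply: measurableT_comp => //; apply/measurable_EFinP; exact: measurableT_comp.
      by move=> y _; rewrite /= lee_fin.
    rewrite integral_cst//=.
    have -> : Q setT = 1%E by exact: probability_setT.
    by rewrite mule1.
have := Fubini iPQ; rewrite /Rintegral => E; congr fine; move: E.
congr (_ = _).
  apply: eq_integral => x _; rewrite fineK//; apply: integrable_fin_num => //.
  exact: ifx.
by apply: eq_integral => y _; rewrite fineK//; apply: integrable_fin_num => //; exact: ify.
Qed.

Variables (n : nat) (Y : nat -> T -> R) (lam : nat -> R).
Hypothesis mY : forall s, measurable_fun setT (Y s).
Hypothesis lam0 : forall s, 0 <= lam s.
Hypothesis cosY : forall (u : nat -> R) (a : R),
  \int[P]_w cos (a + \sum_(0 <= s < n) u s * Y s w)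
  = expR (- (\sum_(0 <= s < n) lam s * u s ^+ 2) / 2) * cos a.

(** Each Gaussian factor [expR (- th * y ^+ 2 / 2)] is the characteristic
    function at [sqrt th * y] of a normal variable; integrating these variables
    last, only the laws of the linear combinations of the [Y s] matter. *)
Lemma Rintegral_gauss_cos th j u a : 0 <= th -> (j <= n)%N ->
  \int[P]_w (expR (- (th * \sum_(0 <= s < j) Y s w ^+ 2) / 2)
             * cos (a + \sum_(j <= s < n) u s * Y s w))
  = (\prod_(0 <= s < j) (Num.sqrt (1 + th * lam s))^-1)
    * expR (- (\sum_(j <= s < n) lam s * u s ^+ 2) / 2) * cos a.
Proof.
move=> th0; elim: j u a => [|j IH] u a jn.
  under eq_Rintegral do rewrite big_geq// mulr0 oppr0 mul0r expR0 mul1r.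
  by rewrite cosY (big_geq (leqnn 0)) mul1r.
pose q := Num.sqrt th; have q2 : q ^+ 2 = th by rewrite sqr_sqrtr.
pose E w := expR (- (th * \sum_(0 <= s < j) Y s w ^+ 2) / 2).
pose L w := a + \sum_(j.+1 <= s < n) u s * Y s w.
pose f (z : T * measurableTypeR R) : R := E z.1 * cos (L z.1) * cos (0 + q * Y j z.1 * z.2).
have mE : measurable_fun setT E.
  apply: measurableT_comp => //; apply: measurable_funM => //.
  apply: measurable_funN; apply: measurable_funM => //.
  by apply: measurable_sum => s; exact: measurable_funX.
have mL : measurable_fun setT L.
  apply: measurable_funD => //; apply: measurable_sum => s; exact: measurable_funM.
have mc := @measurable_cos R.
have mf : measurable_fun setT f.
  apply: measurable_funM.
    apply: (measurableT_comp (f := fun w => E w * cos (L w))) => //.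
    by apply: measurable_funM => //; exact: measurableT_comp.
  apply: measurableT_comp => //; apply: measurable_funD => //.
  apply: measurable_funM; last exact: measurable_snd.
  apply: measurable_funM => //; exact: measurableT_comp.
have E01 w : 0 <= E w <= 1.
  rewrite expR_ge0/= -expR0 ler_expR pmulr_lle0 ?invr_gt0// oppr_le0.
  by rewrite mulr_ge0// sumr_ge0// => s _; exact: sqr_ge0.
have f1 z : `|f z| <= 1.
  rewrite /f !normrM mulr_ile1 ?mulr_ge0 ?mulr_ile1 ?cos_max//.
  by rewrite ger0_norm; case/andP: (E01 z.1).
transitivity (\int[P]_w \int[std_normal]_x f (w, x)).
  apply: eq_Rintegral => w _; rewrite /f/=.
  rewrite RintegralZl//; last first.
    apply: (@bounded_integrable _ _ _ _ _ 1) => [|x]; last exact: cos_max.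
    by apply: measurableT_comp => //; exact: measurable_funD.
  rewrite Rintegral_normal_cos cos0 mulr1 exprMn q2 /E mulrAC -expRD; congr (_ * _).
  congr expR; rewrite big_nat_recr//=; ring.
rewrite (@Rintegral_Fubini _ _ std_normal f 1 mf f1).
pose u' x k : R := if k == j then x else u k.
have jn' : (j <= n)%N by exact: ltnW.
have Lx x w : a + \sum_(j <= s < n) u' x s * Y s w = L w + x * Y j w.
  rewrite big_ltn// /u' eqxx /L addrA addrAC; congr (_ + _); congr (_ + _).
  by apply: eq_big_nat => k /andP[jk _]; rewrite gtn_eqF.
have Sx x : \sum_(j <= s < n) lam s * u' x s ^+ 2 =
    lam j * x ^+ 2 + \sum_(j.+1 <= s < n) lam s * u s ^+ 2.
  rewrite big_ltn// /u' eqxx; congr (_ + _).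
  by apply: eq_big_nat => k /andP[jk _]; rewrite gtn_eqF.
have iEc x : P.-integrable setT (EFin \o (fun w => E w * cos (L w + x * Y j w))).
  apply: (@bounded_integrable _ _ _ _ _ 1) => [|w].
    apply: measurable_funM => //; apply: measurableT_comp => //.
    by apply: measurable_funD => //; exact: measurable_funM.
  rewrite normrM mulr_ile1 ?cos_max//.
  by rewrite ger0_norm; case/andP: (E01 w).
pose p := \prod_(0 <= s < j) (Num.sqrt (1 + th * lam s))^-1.
pose S := \sum_(j.+1 <= s < n) lam s * u s ^+ 2.
have IHx x : \int[P]_w (E w * cos (L w + x * Y j w)) =
    p * expR (- (lam j * x ^+ 2 + S) / 2) * cos a.
  rewrite -Sx -(IH (u' x) a jn'); apply: eq_Rintegral => w _.
  by rewrite Lx.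
transitivity (\int[std_normal]_x (p * expR (- S / 2) * cos a
    * expR (- (th * lam j * x ^+ 2) / 2))).
  apply: eq_Rintegral => x _.
  transitivity (\int[P]_w (2^-1 * (E w * cos (L w + (q * x) * Y j w))
                         + 2^-1 * (E w * cos (L w + - (q * x) * Y j w)))).
    apply: eq_Rintegral => w _; rewrite /f/= add0r.
    rewrite (_ : q * Y j w * x = q * x * Y j w); last by ring.
    rewrite mulNr (cosB (L w)) (cosD (L w)).
    by field.
  rewrite RintegralDprob; [|exact: integrable_scale|exact: integrable_scale].
  rewrite !RintegralZl// !IHx sqrrN exprMn q2.
  rewrite (_ : - (lam j * (th * x ^+ 2) + S) / 2 = - S / 2 + - (th * lam j * x ^+ 2) / 2);
    last by ring.
  by rewrite expRD; field.
rewrite RintegralZl//; last first.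
  apply: (@bounded_integrable _ _ _ _ _ 1).
    apply: measurableT_comp => //; apply: measurable_funM => //.
    by apply: measurable_funN; apply: measurable_funM => //; exact: measurable_funX.
  move=> x; rewrite ger0_norm ?expR_ge0// -expR0 ler_expR pmulr_lle0 ?invr_gt0//.
  by rewrite oppr_le0 mulr_ge0 ?sqr_ge0// mulr_ge0.
rewrite Rintegral_normal_gauss ?mulr_ge0// big_nat_recr//= -/p -/S; ring.
Qed.

Lemma Rintegral_gauss_quadratic th : 0 <= th ->
  \int[P]_w expR (- (th * \sum_(0 <= s < n) Y s w ^+ 2) / 2)
  = \prod_(0 <= s < n) (Num.sqrt (1 + th * lam s))^-1.
Proof.
move=> th0; have := Rintegral_gauss_cos (fun=> 0) 0 th0 (leqnn n).
rewrite (big_geq (leqnn n)) oppr0 mul0r expR0 mulr1 cos0 mulr1 => <-.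
by apply: eq_Rintegral => w _; rewrite (big_geq (leqnn n)) addr0 cos0 mulr1.
Qed.

End gaussian_quadratic_form.

(** * The quadratic form under the null hypothesis *)

Section model_law.
Context {R : realType} (m : model R).

Local Notation a := (ngroups m).
Local Notation D := (total_dim m).
Local Notation N := ((total_size m)%:R : R).
Local Notation P := (prob m).
Local Notation T := (hyp m).
Local Notation V := (V_mx m).

Local Notation K := {i : 'I_a & 'I_(ssize i)}.

Local Notation obs_system := (fun ij : K => sigma_rv (fun c w => obs (tagged ij) c w)).

Lemma sigma_rv_setT (ij : K) : obs_system ij setT.
Proof. exact: (@measurableT _ (g_sigma_algebraType _)). Qed.

Lemma sigma_rv_setI (ij : K) : setI_closed (obs_system ij).
Proof. move=> A B; exact: (@measurableI _ (g_sigma_algebraType _)). Qed.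

Lemma sigma_rv_measurable (ij : K) : obs_system ij `<=` measurable.
Proof.
apply: smallest_sub; first exact: sigma_algebra_measurable.
move=> A [c _ [B mB <-]].
exact: measurable_funP.
Qed.

Definition obs_form (v : forall i : 'I_a, 'cV[R]_(Defs.dim i)) (ij : K) (w : Omega m) : R :=
  ((v (tag ij))^T *m rvec (obs (tagged ij)) w) 0 0.

Definition obs_form_mean (v : forall i : 'I_a, 'cV[R]_(Defs.dim i)) (ij : K) : R :=
  ((v (tag ij))^T *m mean (tag ij)) 0 0.

Definition obs_form_var (v : forall i : 'I_a, 'cV[R]_(Defs.dim i)) (ij : K) : R :=
  ((v (tag ij))^T *m cov (tag ij) *m v (tag ij)) 0 0.

Lemma obs_form_depends v ij J : ij \in J -> depends_on obs_system J (obs_form v ij).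
Proof.
move=> ijJ; apply: (depends_on_mem sigma_rv_setT ijJ).
have mX : measurable_fun (setT : set (g_sigma_algebraType
    (\bigcup_c preimage_set_system setT (fun w => obs (tagged ij) c w) measurable)))
    (obs_form v ij).
  have E w : obs_form v ij w = \sum_c v (tag ij) c 0 * obs (tagged ij) c w.
    by rewrite /obs_form mxE; apply: eq_bigr => c _; rewrite !mxE.
  rewrite (funext E); apply: measurable_sum => c; apply: measurable_funM => //.
  move=> _ A mA; apply: sub_sigma_algebra; exists c => //.
  by exists A.
move=> A [B mB <-]; rewrite setTI; have := mX measurableT B mB; rewrite setTI.
by [].
Qed.

Lemma obs_form_measurable v ij : measurable_fun setT (obs_form v ij).
Proof.
exact: (depends_on_measurable sigma_rv_measurable (obs_form_depends v (mem_head ij [::]))).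
Qed.

Lemma cov_ge0 (i : 'I_a) (u : 'cV[R]_(Defs.dim i)) : 0 <= (u^T *m cov i *m u) 0 0.
Proof.
have [->|u0] := eqVneq u 0; first by rewrite mulmx0 mxE.
by have [_ h] := cov_posdef i; rewrite ltW// h.
Qed.

Lemma Rintegral_cos_obs_forms v (J : seq K) (x : R) : uniq J ->
  \int[P]_w cos (x + \sum_(ij <- J) obs_form v ij w) =
  expR (- (\sum_(ij <- J) obs_form_var v ij) / 2)
  * cos (x + \sum_(ij <- J) obs_form_mean v ij).
Proof.
elim: J x => [|ij J IH] x.
  rewrite !big_nil oppr0 mul0r expR0 mul1r addr0 => _.
  under eq_Rintegral do rewrite big_nil addr0.
  exact: Rintegral_prob_cst.
rewrite cons_uniq => /andP[ijJ uJ].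
pose S w := \sum_(kl <- J) obs_form v kl w.
have dS : depends_on obs_system J S.
  by apply: depends_on_sum => kl klJ; exact: obs_form_depends.
have dX := obs_form_depends v (mem_head ij [::]).
have ind : indep_fun P S (obs_form v ij).
  apply: (depends_on_indep sigma_rv_setT sigma_rv_setI sigma_rv_measurable
    (obs_indep (m := m)) _ dS dX).
  by rewrite cats1 rcons_uniq ijJ.
have hX y : \int[P]_w cos (y + obs_form v ij w) =
    expR (- obs_form_var v ij / 2) * cos (y + obs_form_mean v ij).
  apply: Rintegral_normal_law_cos; last exact: cov_ge0.
    exact: obs_form_measurable.
  exact: obs_normal.
transitivity (\int[P]_w cos (x + (S w + obs_form v ij w))).
  by apply: eq_Rintegral => w _; rewrite big_cons [obs_form v ij w + _]addrC.
rewrite (Rintegral_cos_normal x _ _ ind hX); last 2 first.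
- exact: (depends_on_measurable sigma_rv_measurable dS).
- exact: obs_form_measurable.
rewrite IH// !big_cons mulrA -expRD; congr (expR _ * cos _); last by rewrite addrA.
by rewrite opprD mulrDl.
Qed.

Lemma total_size_ge (i : 'I_a) : (ssize i <= total_size m)%N.
Proof. by rewrite /total_size (bigD1 i)//= leq_addr. Qed.

Lemma V_form (v : 'cV[R]_D) : (v^T *m V *m v) 0 0 =
  \sum_i (N / (ssize i)%:R) * ((submxcol v i)^T *m cov i *m submxcol v i) 0 0.
Proof.
rewrite -{1 2}(submxcolK v) tr_mxcol mul_mxrow_mxdiag mul_mxrow_mxcol summxE.
by apply: eq_bigr => i _; rewrite -scalemxAr -scalemxAl mxE.
Qed.

Lemma V_ge0 (v : 'cV[R]_D) : 0 <= (v^T *m V *m v) 0 0.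
Proof.
rewrite V_form sumr_ge0// => i _; rewrite mulr_ge0 ?cov_ge0//.
Qed.

Lemma V_eq0 (v : 'cV[R]_D) : (v^T *m V *m v) 0 0 = 0 -> v = 0.
Proof.
rewrite V_form => /eqP; rewrite psumr_eq0 => [/allP v0|i _]; last first.
  by rewrite mulr_ge0 ?cov_ge0.
rewrite -(submxcolK v) -[RHS](submxcolK (0 : 'cV_D)); apply/eq_mxcol => i.
rewrite submxcol0; apply/eqP; apply: contraT => vi0.
have := v0 i; rewrite mem_index_enum => /(_ isT).
have [_ /(_ _ vi0) cv] := cov_posdef i.
rewrite mulf_eq0 [X in _ || X]gt_eqF// orbF gt_eqF// divr_gt0// ltr0n ?ssize_gt0//.
exact: leq_trans (ssize_gt0 i) (total_size_ge i).
Qed.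

(** A linear form of the mean is a sum of independent normal variables, one
    for each observation. *)
Lemma Rintegral_cos_mean (v : 'cV[R]_D) (x : R) :
  \int[P]_w cos (x + Num.sqrt N * (v^T *m full_group_mean w) 0 0)
  = expR (- (v^T *m V *m v) 0 0 / 2)
    * cos (x + Num.sqrt N * (v^T *m full_mean m) 0 0).
Proof.
pose u i : 'cV[R]_(Defs.dim i) := (Num.sqrt N / (ssize i)%:R) *: submxcol v i.
have uT i : (u i)^T = (Num.sqrt N / (ssize i)%:R) *: (submxcol v i)^T.
  by rewrite /u linearZ.
have sz0 (i : 'I_a) : (ssize i)%:R != 0 :> R by rewrite pnatr_eq0 -lt0n ssize_gt0.
have pairE (F : forall i, 'I_(ssize i) -> R) :
    \sum_i \sum_j F i j = \sum_(ij <- index_enum K) F (tag ij) (tagged ij).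
  exact: (@sig_big_dep _ _ _ _ _ xpredT (fun i (_ : 'I_(ssize i)) => true) F).
have E w : Num.sqrt N * (v^T *m full_group_mean w) 0 0 =
    \sum_(ij <- index_enum K) obs_form u ij w.
  rewrite -(pairE (fun i j => ((u i)^T *m rvec (obs j) w) 0 0)).
  rewrite -{1}(submxcolK v) tr_mxcol /full_group_mean mul_mxrow_mxcol summxE big_distrr/=.
  apply: eq_bigr => i _; rewrite /group_mean -scalemxAr mxE mulrA.
  rewrite mulmx_sumr summxE big_distrr/=; apply: eq_bigr => j _.
  by rewrite /u linearZ/= -scalemxAl [RHS]mxE.
under eq_Rintegral do rewrite E.
rewrite Rintegral_cos_obs_forms ?index_enum_uniq//; congr (expR (- _ / 2) * cos (_ + _)).
  rewrite -(pairE (fun i _ => ((u i)^T *m cov i *m u i) 0 0)) V_form.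
  apply: eq_bigr => i _; rewrite sumr_const card_ord uT /u.
  rewrite -!scalemxAl -scalemxAr !scalerA [in LHS]mxE -(mulr_natl _ (ssize i)).
  rewrite -[in RHS](@sqr_sqrtr _ N) ?ler0n//; field; exact: sz0.
rewrite -(pairE (fun i _ => ((u i)^T *m mean i) 0 0)).
rewrite -(submxcolK v) tr_mxcol /full_mean mul_mxrow_mxcol summxE big_distrr/=.
apply: eq_bigr => i _; rewrite sumr_const card_ord uT.
by rewrite -scalemxAl [in LHS]mxE -(mulr_natl _ (ssize i)); field; exact: sz0.
Qed.

Lemma full_group_mean_measurable (v : 'cV[R]_D) :
  measurable_fun setT (fun w => (v^T *m full_group_mean w) 0 0).
Proof.
have E w : (v^T *m full_group_mean w) 0 0 =
    \sum_i (ssize i)%:R^-1 * \sum_j \sum_c submxcol v i c 0 * obs j c w.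
  rewrite -{1}(submxcolK v) tr_mxcol /full_group_mean mul_mxrow_mxcol summxE.
  apply: eq_bigr => i _; rewrite /group_mean -scalemxAr mxE; congr (_ * _).
  rewrite mulmx_sumr summxE; apply: eq_bigr => j _.
  by rewrite mxE; apply: eq_bigr => c _; rewrite !mxE.
rewrite (funext E); apply: measurable_sum => i; apply: measurable_funM => //.
apply: measurable_sum => j; apply: measurable_sum => c.
by apply: measurable_funM.
Qed.

Context (lam : seq R).
Hypothesis hlam : ordered_eigenvalues (T *m V *m T) lam.

Let A := T *m V *m T.

Lemma cov_sym_mx : A^T = A.
Proof.
rewrite /A !trmx_mul hyp_sym mulmxA; congr (_ *m _ *m _).
rewrite /V_mx tr_mxdiag; apply/eq_mxdiag => i.
by rewrite linearZ/=; have [-> _] := cov_posdef i.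
Qed.

Lemma size_lam : size lam = D.
Proof.
have [cA _] := hlam; have := size_char_poly A.
by rewrite cA size_prod_XsubC => -[].
Qed.

Lemma lam_diagonalize : exists2 U : 'M[R]_D, U *m U^T = 1%:M &
  U *m A *m U^T = diag_mx (\row_i lam`_i).
Proof. by apply: symmetric_spectral; [exact: cov_sym_mx|have [] := hlam]. Qed.

Lemma A_form (u : 'cV[R]_D) : u^T *m A *m u = (T *m u)^T *m V *m (T *m u).
Proof. by rewrite trmx_mul hyp_sym /A !mulmxA. Qed.

Lemma lam_ge0 s : 0 <= lam`_s.
Proof.
have [ltD|geD] := ltnP s D; last by rewrite nth_default// size_lam.
have [U UU UA] := lam_diagonalize; pose i := Ordinal ltD.
have -> : lam`_s = (U *m A *m U^T) i i by rewrite UA !mxE eqxx.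
have -> : (U *m A *m U^T) i i = ((row i U) *m A *m (row i U)^T) 0 0.
  rewrite -row_mul [LHS]mxE [RHS]mxE; apply: eq_bigr => j _.
  by congr (_ * _); rewrite !mxE.
rewrite -{1}[row i U]trmxK A_form; exact: V_ge0.
Qed.

Lemma sum_lam : \sum_(0 <= s < D) lam`_s = \tr (T *m V).
Proof.
have [U UU UA] := lam_diagonalize; have UTU := mulmx1C UU.
have <- : \tr A = \tr (T *m V) by rewrite /A mxtrace_mulC mulmxA hyp_idem.
have -> : \tr A = \tr (U *m A *m U^T).
  by rewrite [RHS]mxtrace_mulC (mulmxA U^T U) UTU mul1mx.
rewrite UA mxtrace_diag big_mkord; apply: eq_bigr => i _; by rewrite mxE.
Qed.

Lemma sum_lam_sqr : \sum_(0 <= s < D) lam`_s ^+ 2 = \tr ((T *m V) *m (T *m V)).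
Proof.
have [U UU UA] := lam_diagonalize; have UTU := mulmx1C UU.
have <- : \tr (A *m A) = \tr ((T *m V) *m (T *m V)).
  have -> : A *m A = (T *m V *m (T *m V)) *m T.
    by rewrite /A !mulmxA -(mulmxA _ T T) hyp_idem.
  by rewrite mxtrace_mulC !mulmxA hyp_idem.
have -> : \tr (A *m A) = \tr ((U *m A *m U^T) *m (U *m A *m U^T)).
  have -> : U *m A *m U^T *m (U *m A *m U^T) = U *m (A *m A) *m U^T.
    by rewrite !mulmxA -(mulmxA _ U^T U) UTU mulmx1.
  by rewrite [RHS]mxtrace_mulC (mulmxA U^T U) UTU mul1mx.
rewrite UA mulmx_diag mxtrace_diag big_mkord; apply: eq_bigr => i _.
by rewrite !mxE expr2.
Qed.

(** As [V] is positive definite, [T V T] vanishes only if [T] does. *)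
Lemma sum_lam_sqr_gt0 : 0 < \sum_(0 <= s < D) lam`_s ^+ 2.
Proof.
rewrite lt_neqAle sumr_ge0 ?andbT => [|s _]; last exact: sqr_ge0.
apply/eqP => /esym/eqP; rewrite big_mkord psumr_eq0 => [/allP lam0|s _]; last exact: sqr_ge0.
have [U UU UA] := lam_diagonalize; have UTU := mulmx1C UU.
have diag0 : diag_mx (\row_(i < D) lam`_i) = 0.
  apply/matrixP => i j; rewrite !mxE; have := lam0 i; rewrite mem_index_enum => /(_ isT).
  by rewrite sqrf_eq0 => /eqP ->; rewrite mul0rn.
have A0 : A = 0.
  have -> : A = U^T *m (U *m A *m U^T) *m U.
    by rewrite !mulmxA UTU mul1mx -(mulmxA A) UTU mulmx1.
  by rewrite UA diag0 mulmx0 mul0mx.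
have := hyp_neq0 m; rewrite (_ : T = 0) ?eqxx//.
apply/matrixP => i j; rewrite [RHS]mxE.
have : T *m delta_mx j (0 : 'I_1) = 0.
  by apply: V_eq0; rewrite -A_form A0 mulmx0 mul0mx mxE.
by move=> /matrixP/(_ i 0); rewrite -colE !mxE.
Qed.

Hypothesis h0 : H0 m.

Lemma hyp_gram (x : 'cV[R]_D) (U : 'M[R]_D) : U *m U^T = 1%:M ->
  (x^T *m T *m x) 0 0 = \sum_i ((row i (U *m T)) *m x) 0 0 ^+ 2.
Proof.
move=> UU; have UTU := mulmx1C UU.
have -> : x^T *m T *m x = (U *m T *m x)^T *m (U *m T *m x).
  rewrite !trmx_mul hyp_sym -!mulmxA (mulmxA U^T U) UTU mul1mx (mulmxA T T).
  by rewrite hyp_idem.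
rewrite mxE; apply: eq_bigr => i _; rewrite expr2 -row_mul !mxE.
by [].
Qed.

(** Under the null hypothesis the quadratic form is the squared length of a
    centred Gaussian vector with diagonal covariance. *)
Lemma Q_laplace th : 0 <= th ->
  \int[P]_w expR (- (th * Q_stat w) / 2)
  = \prod_(0 <= s < D) (Num.sqrt (1 + th * lam`_s))^-1.
Proof.
move=> th0; have [U UU UA] := lam_diagonalize.
pose Y s w : R := if insub s is Some i then
  Num.sqrt N * ((row (i : 'I_D) (U *m T)) *m full_group_mean w) 0 0 else 0.
have YE (i : 'I_D) w : Y i w = Num.sqrt N * ((row i (U *m T)) *m full_group_mean w) 0 0.
  by rewrite /Y valK.
have mY s : measurable_fun setT (Y s).
  rewrite /Y; case: insubP => [i _ _|_]; last exact: measurable_cst.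
  apply: measurable_funM => //; rewrite -[row i _]trmxK.
  exact: full_group_mean_measurable.
have cosY (u : nat -> R) x : \int[P]_w cos (x + \sum_(0 <= s < D) u s * Y s w)
    = expR (- (\sum_(0 <= s < D) lam`_s * u s ^+ 2) / 2) * cos x.
  pose r : 'rV[R]_D := \row_i u i.
  have E w : \sum_(0 <= s < D) u s * Y s w =
      Num.sqrt N * (((r *m U *m T)^T)^T *m full_group_mean w) 0 0.
    rewrite trmxK big_mkord -mulmxA -mulmxA [in RHS]mxE big_distrr/=.
    apply: eq_bigr => i _; rewrite YE mulrCA; congr (_ * _).
    have -> : r 0 i = u i by rewrite mxE.
    by congr (_ * _); rewrite mulmxA -row_mul [LHS]mxE.
  under eq_Rintegral do rewrite E.
  rewrite Rintegral_cos_mean trmxK.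
  have -> : r *m U *m T *m full_mean m = 0 by rewrite -!mulmxA h0 !mulmx0.
  rewrite [X in cos (_ + _ * X)]mxE mulr0 addr0; congr (expR (- _ / 2) * _).
  have -> : r *m U *m T *m V *m (r *m U *m T)^T = r *m diag_mx (\row_i lam`_i) *m r^T.
    by rewrite -UA /A !trmx_mul hyp_sym !mulmxA.
  rewrite mul_mx_diag mxE big_mkord; apply: eq_bigr => i _.
  by rewrite !mxE expr2; ring.
rewrite -(Rintegral_gauss_quadratic mY lam_ge0 cosY th0).
apply: eq_Rintegral => w _; congr (expR (- (_ * _) / 2)).
rewrite /Q_stat (hyp_gram _ UU) big_mkord big_distrr/=; apply: eq_bigr => i _.
by rewrite YE exprMn sqr_sqrtr.
Qed.

Lemma Q_measurable : measurable_fun setT (fun w : Omega m => Q_stat w).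
Proof.
have E (w : Omega m) : Q_stat w = N * \sum_i ((row i T) *m full_group_mean w) 0 0 ^+ 2.
  by rewrite /Q_stat (hyp_gram _ (U := 1%:M)) ?trmx1 ?mul1mx.
rewrite (funext E); apply: measurable_funM => //; apply: measurable_sum => i.
apply: measurable_funX; rewrite -[row i _]trmxK.
exact: full_group_mean_measurable.
Qed.

Lemma Q_ge0 (w : Omega m) : 0 <= Q_stat w.
Proof.
rewrite /Q_stat (hyp_gram _ (U := 1%:M)) ?trmx1 ?mul1mx// mulr_ge0//.
by rewrite sumr_ge0// => i _; exact: sqr_ge0.
Qed.

End model_law.

(** * Independent chi-square variables and the Lindeberg method *)

Section preimage_systems.
Context d {T : measurableType d} {R : realType} (I : Type) (C : I -> T -> R).

Local Notation F := (fun s => preimage_set_system setT (C s) measurable).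

Lemma preimage_system_setT s : F s setT.
Proof. by exists setT => //; rewrite preimage_setT setTI. Qed.

Lemma preimage_system_setI s : setI_closed (F s).
Proof.
move=> _ _ [A mA <-] [B mB <-]; exists (A `&` B); first exact: measurableI.
by rewrite !setTI preimage_setI.
Qed.

Lemma preimage_system_measurable : (forall s, measurable_fun setT (C s)) ->
  forall s, F s `<=` measurable.
Proof. by move=> mC s _ [A mA <-]; exact: mC. Qed.

End preimage_systems.

Section chi2_sequence.
Context d {T : measurableType d} {R : realType} (P : probability T R).
Variable C : nat -> T -> R.
Hypothesis mC : forall s, measurable_fun setT (C s).
Hypothesis lawC : forall s, has_law P (C s) chi2_1.
Hypothesis indC : mutually_independent P
  (fun s => preimage_set_system setT (C s) measurable).
Implicit Types (c : nat -> R) (a t y : R) (m n s : nat) (w : T).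

Local Notation F := (fun s => preimage_set_system setT (C s) measurable).

Definition std_chi2 s w : R := (C s w - 1) / Num.sqrt 2.

Local Notation xi := std_chi2.

Lemma std_chi2_preimage s : preimage_set_system setT (xi s) measurable `<=` F s.
Proof.
move=> _ [A mA <-]; exists ((fun x : R => (x - 1) / Num.sqrt 2) @^-1` A) => //.
rewrite -[X in measurable X]setTI.
have : measurable_fun setT (fun x : R => (x - 1) / Num.sqrt 2).
  by apply: measurable_funM => //; exact: measurable_funB.
by apply.
Qed.

Let g x : R := (x - 1) / Num.sqrt 2.

Let mg : measurable_fun setT g.
Proof. by apply: measurable_funM => //; exact: measurable_funB. Qed.

Let sqrt2 : Num.sqrt 2 ^+ 2 = 2 :> R. Proof. by rewrite sqr_sqrtr. Qed.

Let sqrt2_gt0 : 0 < Num.sqrt 2 :> R. Proof. by rewrite sqrtr_gt0. Qed.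

Lemma std_chi2_pow_integrable s n : P.-integrable setT (EFin \o (fun w => xi s w ^+ n)).
Proof.
apply: (integrable_chi2_law (mC s) (lawC s) (f := fun x => g x ^+ n)).
  exact: measurable_funX.
have [K K0 hK] := pow_le_expR (R := R) 2.
have [L L0 hL] := pow_le_expR (R := R) 0.
apply: (@integrable_expR_norm _ _ ((K + 1) ^+ n) n%:R) => //.
  apply: measurable_funX; apply: measurableT_comp => //; exact: measurable_funX.
move=> x; rewrite normrX expRM_natl -exprMn lerXn2r ?nnegrE//.
  by rewrite mulr_ge0 ?expR_ge0// addr_ge0.
have s1 : 1 <= Num.sqrt 2 :> R by rewrite -[leLHS]sqrtr1 ler_sqrt// ler1n.
rewrite /g normrM normfV (gtr0_norm sqrt2_gt0) ler_pdivrMr//.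
apply: (@le_trans _ _ ((K + 1) * expR `|x|)); last first.
  by rewrite ler_peMr// mulr_ge0 ?expR_ge0// addr_ge0.
rewrite (le_trans (ler_normB _ _))// normr1 mulrDl mul1r lerD//.
  by rewrite normrX; exact: hK.
by rewrite -[leLHS]expR0 ler_expR.
Qed.

Lemma std_chi2_mean s : \int[P]_w xi s w = 0.
Proof.
rewrite /Rintegral (integral_chi2_law (mC s) (lawC s) mg).
rewrite -[fine _]/(\int[@std_normal R]_x g (x ^+ 2)) /g.
under eq_Rintegral do rewrite mulrC.
have i1 := prob_integrable_cst (@std_normal R) 1.
rewrite RintegralZl//; last exact: integrable_sub (integrable_normal_pow 2) i1.
rewrite RintegralB//; last exact: integrable_normal_pow.
by rewrite Rintegral_normal_sqr Rintegral_prob_cst subrr mulr0.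
Qed.

Lemma std_chi2_var s : \int[P]_w (xi s w ^+ 2) = 1.
Proof.
rewrite /Rintegral (integral_chi2_law (mC s) (lawC s) (f := fun x => g x ^+ 2)); last first.
  exact: measurable_funX.
rewrite -[fine _]/(\int[@std_normal R]_x (g (x ^+ 2) ^+ 2)).
have i1 := prob_integrable_cst (@std_normal R) 1.
have i4 := integrable_normal_pow (R := R) 4.
have i2 := integrable_scale 2 (integrable_normal_pow (R := R) 2).
transitivity (\int[@std_normal R]_x (2^-1 * (x ^+ 4 - 2 * x ^+ 2 + 1))).
  by apply: eq_Rintegral => x _; rewrite /g exprMn exprVn sqrt2; ring.
rewrite RintegralZl//; last exact: integrable_add (integrable_sub i4 i2) i1.
rewrite RintegralDprob//; last exact: integrable_sub.
rewrite RintegralB// RintegralZl//; last exact: integrable_normal_pow.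
by rewrite Rintegral_normal_pow4 Rintegral_normal_sqr Rintegral_prob_cst; field.
Qed.

Definition chi2_kurtosis : R := \int[@std_normal R]_x (g (x ^+ 2) ^+ 4).

Lemma std_chi2_pow4 s : \int[P]_w (xi s w ^+ 4) = chi2_kurtosis.
Proof.
rewrite /Rintegral (integral_chi2_law (mC s) (lawC s) (f := fun x => g x ^+ 4))//.
exact: measurable_funX.
Qed.

Lemma chi2_kurtosis_ge0 : 0 <= chi2_kurtosis.
Proof. by rewrite /chi2_kurtosis; apply: Rintegral_ge0 => x _; rewrite exprn_even_ge0. Qed.

Lemma std_chi2_measurable s : measurable_fun setT (xi s).
Proof. exact: (measurableT_comp mg (mC s)). Qed.

Let cosxi_int s (f : R -> R) y : measurable_fun setT f -> (forall x, `|f x| <= 1) ->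
  P.-integrable setT (EFin \o (fun w => f (y * xi s w))).
Proof.
move=> mf f1; apply: (@bounded_integrable _ _ _ _ _ 1) => [|w]; last exact: f1.
by apply: measurableT_comp => //; apply: measurable_funM => //; exact: std_chi2_measurable.
Qed.

Lemma std_chi2_cos s y :
  `|\int[P]_w cos (y * xi s w) - (1 - y ^+ 2 / 2)| <= y ^+ 4 / 24 * chi2_kurtosis.
Proof.
have i1 := prob_integrable_cst P 1.
have i2 := integrable_scale (y ^+ 2 / 2) (std_chi2_pow_integrable s 2).
have i4 := integrable_scale (y ^+ 4 / 24) (std_chi2_pow_integrable s 4).
have -> : 1 - y ^+ 2 / 2 = \int[P]_w (1 - y ^+ 2 / 2 * xi s w ^+ 2).
  rewrite RintegralB// RintegralZl//; last exact: std_chi2_pow_integrable.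
  by rewrite Rintegral_prob_cst std_chi2_var mulr1.
rewrite -(std_chi2_pow4 s) -RintegralZl//; last exact: std_chi2_pow_integrable.
apply: Rintegral_dist => //; [exact: cosxi_int (@measurable_cos R) (@cos_max R)|exact: integrable_sub|].
move=> w; have := cos_taylor4 (y * xi s w); rewrite !exprMn.
by rewrite opprB addrA addrAC mulrAC (mulrAC (y ^+ 4)).
Qed.

Lemma std_chi2_sin s y :
  `|\int[P]_w sin (y * xi s w)| <= `|y| ^+ 3 / 6 * (1 + chi2_kurtosis).
Proof.
have i1 := prob_integrable_cst P 1.
have i2 := std_chi2_pow_integrable s 2.
have i4 := std_chi2_pow_integrable s 4.
have ix : P.-integrable setT (EFin \o xi s).
  by apply: integrable_sqr_id => //; exact: std_chi2_measurable.
rewrite -[X in `|X|]subr0.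
have -> : (0 : R) = \int[P]_w (y * xi s w).
  by rewrite RintegralZl// std_chi2_mean mulr0.
have -> : 1 + chi2_kurtosis = \int[P]_w (xi s w ^+ 2 + xi s w ^+ 4).
  by rewrite RintegralDprob// std_chi2_var std_chi2_pow4.
rewrite -RintegralZl//; last exact: integrable_add.
apply: Rintegral_dist => //; [exact: cosxi_int (@measurable_sin R) (@sin_max R)|exact: integrable_scale|
  by apply: integrable_scale; exact: integrable_add|].
move=> w; apply: le_trans (sin_taylor3 _) _.
have -> : `|y * xi s w| ^+ 3 / 6 = `|y| ^+ 3 / 6 * `|xi s w| ^+ 3.
  by rewrite normrM exprMn; ring.
apply: ler_wpM2l; first by rewrite divr_ge0 ?exprn_ge0.
set x := xi s w; have : x ^+ 2 + x ^+ 4 = `|x| ^+ 2 + `|x| ^+ 4.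
  rewrite real_normK ?num_real//; congr (_ + _).
  by rewrite -[4%N]/(2 * 2)%N !exprM real_normK ?num_real.
move=> ->; have x0 : 0 <= `|x| by []; have := sqr_ge0 (`|x| - 1); nra.
Qed.

Definition lindeberg_cst t : R := (1 + chi2_kurtosis) * (t ^+ 4 + `|t| ^+ 3).

Lemma lindeberg_cst_ge0 t : 0 <= lindeberg_cst t.
Proof.
apply: mulr_ge0; first by rewrite addr_ge0// chi2_kurtosis_ge0.
by apply: addr_ge0; [rewrite exprn_even_ge0|rewrite exprn_ge0].
Qed.

Local Notation H c n := (block xi c 0 n).

Lemma H_measurable c n : measurable_fun setT (H c n).
Proof. exact: (block_measurable (preimage_system_setT C) (preimage_system_measurable mC) std_chi2_preimage). Qed.

Lemma std_block_indep c n : indep_fun P (H c n) (xi n).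
Proof.
apply: (indep_next (preimage_system_setT C) (preimage_system_setI (C := C))
  (preimage_system_measurable mC) indC std_chi2_preimage (m := 0)).
exact: (block_depends (preimage_system_setT C) std_chi2_preimage).
Qed.

Lemma std_block_var c n : P.-integrable setT (EFin \o (fun w => H c n w ^+ 2)) /\
  \int[P]_w (H c n w ^+ 2) = \sum_(0 <= s < n) c s ^+ 2.
Proof.
exact: (block_var (preimage_system_setT C) (preimage_system_setI (C := C))
  (preimage_system_measurable mC) indC std_chi2_preimage
  (fun s => std_chi2_pow_integrable s 2) std_chi2_mean std_chi2_var c (leq0n n)).
Qed.

Lemma std_block_cvg c : (forall n, \sum_(0 <= s < n) c s ^+ 2 <= 1) ->
  {ae P, forall w, cvgn (fun n => H c n w)}.
Proof.
exact: (block_cvg (preimage_system_setT C) (preimage_system_setI (C := C))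
  (preimage_system_measurable mC) indC std_chi2_preimage
  (fun s => std_chi2_pow_integrable s 2) std_chi2_mean std_chi2_var).
Qed.

(** The characteristic functions of [xi n] and of a standard normal variable
    agree up to second order, so that exchanging the two costs the third power
    of the coefficient; coefficients at most one absorb the fourth order
    terms. *)
Lemma lindeberg_step c n a t : 0 <= c n <= 1 ->
  `|\int[P]_w cos (a + t * H c n.+1 w)
    - expR (- (t ^+ 2 * c n ^+ 2) / 2) * \int[P]_w cos (a + t * H c n w)|
  <= lindeberg_cst t * c n ^+ 3.
Proof.
move=> /andP[c0 c1]; set y := t * c n.
have mH := H_measurable c n; have mxi := std_chi2_measurable n.
have ind : indep_fun P (fun w => t * H c n w) (fun w => y * xi n w).
  apply: (@indep_fun_comp _ _ _ P _ _ (fun x => t * x) (fun x => y * x)).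
  - exact: measurable_funM.
  - exact: measurable_funM.
  exact: std_block_indep.
have -> : \int[P]_w cos (a + t * H c n.+1 w) =
    \int[P]_w cos (a + (t * H c n w + y * xi n w)).
  apply: eq_Rintegral => w _; rewrite /block big_nat_recr//= /y.
  by rewrite mulrDr mulrA.
rewrite Rintegral_cos_indep//; [|exact: measurable_funM|exact: measurable_funM].
set A := \int[P]_w cos _; set B := \int[P]_w cos _.
set A' := \int[P]_w sin _; set B' := \int[P]_w sin _.
have bound (f : R -> R) : measurable_fun setT f -> (forall x, `|f x| <= 1) ->
    `|\int[P]_w f (a + t * H c n w)| <= 1.
  move=> mf f1; have mm : measurable_fun setT (fun w => f (a + t * H c n w)).
    by apply: measurableT_comp => //; apply: measurable_funD => //; exact: measurable_funM.
  have ii : P.-integrable setT (EFin \o (fun w => f (a + t * H c n w))).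
    by apply: (@bounded_integrable _ _ _ _ _ 1).
  apply: le_trans (le_normr_Rintegral measurableT ii) _.
  rewrite -[leRHS](Rintegral_prob_cst P); apply: le_Rintegral => //.
    exact: integrable_norm.
  exact: prob_integrable_cst.
have A1 : `|A| <= 1 by exact: bound (@measurable_cos R) (@cos_max R).
have A'1 : `|A'| <= 1 by exact: bound (@measurable_sin R) (@sin_max R).
have B1 := std_chi2_cos n y; have B'1 := std_chi2_sin n y.
rewrite -/B in B1; rewrite -/B' in B'1.
have y2 : t ^+ 2 * c n ^+ 2 = y ^+ 2 by rewrite exprMn.
have E1 : `|expR (- (t ^+ 2 * c n ^+ 2) / 2) - (1 - y ^+ 2 / 2)| <= y ^+ 4 / 8.
  have := @expRN_bound2 R (y ^+ 2 / 2).
  rewrite divr_ge0 ?sqr_ge0// => /(_ isT); rewrite y2 mulNr opprB addrA.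
  by rewrite (_ : (y ^+ 2 / 2) ^+ 2 / 2 = y ^+ 4 / 8); [rewrite addrAC|field].
have k0 := chi2_kurtosis_ge0.
have yc : `|y| ^+ 3 <= `|t| ^+ 3 * c n ^+ 3.
  by rewrite /y normrM exprMn (ger0_norm c0).
have yc4 : y ^+ 4 <= t ^+ 4 * c n ^+ 3.
  rewrite /y exprMn ler_wpM2l//; first by rewrite exprn_even_ge0.
  by rewrite exprS ler_piMl// exprn_ge0.
have t4 : 0 <= t ^+ 4 by rewrite exprn_even_ge0.
have y40 : 0 <= y ^+ 4 by rewrite exprn_even_ge0.
have y30 : 0 <= `|y| ^+ 3 by exact: exprn_ge0.
set e := expR _ in E1 *.
have -> : A * B - A' * B' - e * A =
    A * (B - (1 - y ^+ 2 / 2)) - A * (e - (1 - y ^+ 2 / 2)) - A' * B' by ring.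
apply: (@le_trans _ _ (y ^+ 4 / 24 * chi2_kurtosis + y ^+ 4 / 8 +
    `|y| ^+ 3 / 6 * (1 + chi2_kurtosis))).
  rewrite (le_trans (ler_normB _ _))// lerD//; last first.
    by rewrite normrM -[leRHS]mul1r ler_pM.
  rewrite (le_trans (ler_normB _ _))// lerD// normrM -[leRHS]mul1r ler_pM//.
rewrite /lindeberg_cst; set k := chi2_kurtosis in k0 *.
apply: (@le_trans _ _ ((1 + k) * (y ^+ 4 + `|y| ^+ 3))).
  have := mulr_ge0 y40 k0; have := mulr_ge0 y30 k0; nra.
rewrite -mulrA [_ * c n ^+ 3]mulrDl; apply: ler_wpM2l; first exact: addr_ge0.
exact: lerD.
Qed.

Lemma lindeberg c m n a t : (forall s, 0 <= c s <= 1) -> (m <= n)%N ->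
  `|\int[P]_w cos (a + t * H c n w)
    - expR (- (t ^+ 2 * \sum_(m <= s < n) c s ^+ 2) / 2)
      * \int[P]_w cos (a + t * H c m w)|
  <= lindeberg_cst t * \sum_(m <= s < n) c s ^+ 3.
Proof.
move=> c01 /subnKC <-; elim: (n - m)%N => [|k IH].
  by rewrite addn0 !big_geq// !mulr0 oppr0 mul0r expR0 mul1r subrr normr0.
rewrite addnS !big_nat_recr ?leq_addr//=; set j := (m + k)%N in IH *.
set A := \int[P]_w _; set B := \int[P]_w _ in IH *.
set A' := \int[P]_w _ in IH *.
set S2 := \sum_(m <= s < j) c s ^+ 2 in IH *.
set e := expR (- (t ^+ 2 * c j ^+ 2) / 2).
have e01 : `|e| <= 1.
  rewrite ger0_norm ?expR_ge0// -expR0 ler_expR pmulr_lle0 ?invr_gt0// oppr_le0.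
  by rewrite mulr_ge0 ?sqr_ge0.
have -> : expR (- (t ^+ 2 * (S2 + c j ^+ 2)) / 2) = e * expR (- (t ^+ 2 * S2) / 2).
  by rewrite /e -expRD; congr expR; ring.
set E := expR (- (t ^+ 2 * S2) / 2) in IH *.
rewrite -/A'; have -> : A - e * E * A' = e * (B - E * A') + (A - e * B) by ring.
rewrite [leRHS]mulrDr (le_trans (ler_normD _ _))// lerD//; last exact: lindeberg_step.
by rewrite normrM -[leRHS]mul1r ler_pM.
Qed.

Lemma sum_cubes_le c m n : nonincreasing_seq c -> (forall s, 0 <= c s <= 1) ->
  (\sum_(0 <= s < n) c s ^+ 2 <= 1) -> (m <= n)%N ->
  \sum_(m <= s < n) c s ^+ 3 <= c m.
Proof.
move=> dc c01 c1 mn; have cm0 : 0 <= c m by case/andP: (c01 m).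
apply: (@le_trans _ _ (\sum_(m <= s < n) c m * c s ^+ 2)).
  apply: ler_sum_nat => s /andP[ms _]; rewrite exprS ler_wpM2r ?sqr_ge0//.
  exact: dc.
rewrite -big_distrr/= ler_piMr//; apply: le_trans c1.
rewrite (big_cat_nat (leq0n m) mn)/= lerDr sumr_ge0// => s _.
exact: sqr_ge0.
Qed.

Lemma head_le c m : nonincreasing_seq c -> (forall s, 0 <= c s <= 1) ->
  (forall n, \sum_(0 <= s < n) c s ^+ 2 <= 1) -> c m <= Num.sqrt (m.+1%:R^-1).
Proof.
move=> dc c01 c1; have cm0 : 0 <= c m by case/andP: (c01 m).
rewrite -[c m]ger0_norm// -sqrtr_sqr ler_sqrt ?invr_ge0//.
rewrite -[leRHS]mul1r ler_pdivlMr//; apply: le_trans (c1 m.+1).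
rewrite big_mkord mulr_natr -[m.+1 in X in X <= _]card_ord -sumr_const ler_sum// => i _.
have cms : c m <= c i by apply: dc; rewrite -ltnS.
by rewrite lerXn2r ?nnegrE//; case/andP: (c01 i).
Qed.

End chi2_sequence.

(** * Limits of weighted chi-square sums *)

Section real_sequences.
Context {R : realType}.
Implicit Types (u : nat -> R) (h : R -> R) (l x : R).

Lemma cvg_image h u l : {for l, continuous h} -> u k @[k --> \oo] --> l ->
  h (u k) @[k --> \oo] --> h l.
Proof. by move=> hl ul; exact: (@continuous_cvg _ _ _ _ _ u h l hl ul). Qed.

Lemma cvg_le_cst u l x : u k @[k --> \oo] --> l -> (\forall k \near \oo, u k <= x) ->
  l <= x.
Proof.
move=> ul ux; rewrite -(cvg_lim _ ul)//; apply: limr_le => //.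
by apply/cvg_ex; exists l.
Qed.

Lemma continuous_gauss t l : {for l, continuous (fun x : R => expR (- (t ^+ 2 * (1 - x)) / 2))}.
Proof.
apply: (@continuous_comp _ _ _ (fun x : R => - (t ^+ 2 * (1 - x)) / 2) expR);
  last exact: continuous_expR.
apply: cvgMr_tmp; apply: cvgN; apply: cvgMl_tmp.
by apply: cvgB; [exact: cvg_cst|exact: cvg_id].
Qed.

Lemma continuous_cos_affine a t l : {for l, continuous (fun x : R => cos (a + t * x))}.
Proof.
apply: (@continuous_comp _ _ _ (fun x : R => a + t * x) cos); last exact: continuous_cos.
by apply: cvgD; [exact: cvg_cst|apply: cvgMl_tmp; exact: cvg_id].
Qed.

End real_sequences.

Section weighted_sums_limit.
Context d {T : measurableType d} {R : realType} (P : probability T R).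
Variable C : nat -> T -> R.
Hypothesis mC : forall s, measurable_fun setT (C s).
Hypothesis lawC : forall s, has_law P (C s) chi2_1.
Hypothesis indC : mutually_independent P
  (fun s => preimage_set_system setT (C s) measurable).
Implicit Types (c b : nat -> R) (a t y : R) (m n s : nat) (w : T).

Local Notation xi := (std_chi2 C).
Local Notation H c n := (block xi c 0 n).

Definition weights c := [/\ nonincreasing_seq c, (forall s, 0 <= c s <= 1) &
  forall n, \sum_(0 <= s < n) c s ^+ 2 <= 1].

Lemma cos_affine_cvg a t (X : nat -> T -> R) (Y : T -> R) :
  (forall n, measurable_fun setT (X n)) -> measurable_fun setT Y ->
  {ae P, forall w, X n w @[n --> \oo] --> Y w} ->
  \int[P]_w cos (a + t * X n w) @[n --> \oo] --> \int[P]_w cos (a + t * Y w).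
Proof.
move=> mX mY XY; apply: (@Rintegral_bounded_cvg _ _ _ _ _ _ 1).
- by move=> n; exact: cos_affine_measurable.
- exact: cos_affine_measurable.
- by move=> n w; exact: cos_max.
- apply: filterS XY => w Xw.
  exact: (@cvg_image R (fun x => cos (a + t * x)) (X^~ w) (Y w) (@continuous_cos_affine R a t (Y w)) Xw).
Qed.

Lemma Rintegral_cos_le1 a t (X : T -> R) : measurable_fun setT X ->
  `|\int[P]_w cos (a + t * X w)| <= 1.
Proof.
move=> mX; have ii := cos_affine_integrable P a t mX.
apply: le_trans (le_normr_Rintegral measurableT ii) _.
rewrite -[leRHS](Rintegral_prob_cst P); apply: le_Rintegral => //.
- exact: integrable_norm.
- exact: prob_integrable_cst.
- by move=> w _; exact: cos_max.
Qed.

(** The weighted sum with all but the first [m] terms replaced by a normal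
    variable, which brings the variance up to one. *)
Definition normal_tail a t m c : R :=
  expR (- (t ^+ 2 * (1 - \sum_(0 <= s < m) c s ^+ 2)) / 2) * \int[P]_w cos (a + t * H c m w).

Lemma normal_tail_continuous a t m (be : nat -> nat -> R) b :
  (forall s, be k s @[k --> \oo] --> b s) ->
  normal_tail a t m (be k) @[k --> \oo] --> normal_tail a t m b.
Proof.
move=> beb; apply: cvgM.
  apply: (cvg_image (@continuous_gauss R t _)).
  elim: m => [|m IH].
    by under eq_fun do rewrite big_geq//; rewrite big_geq//; exact: cvg_cst.
  under eq_fun do rewrite big_nat_recr//=; rewrite big_nat_recr//=.
  by apply: cvgD => //; rewrite expr2; under eq_fun do rewrite expr2; exact: cvgM.
apply: cos_affine_cvg.
- by move=> k; exact: (H_measurable mC).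
- exact: (H_measurable mC).
- apply: aeW => w; rewrite /block; elim: m => [|m IH].
    by under eq_fun do rewrite big_geq//; rewrite big_geq//; exact: cvg_cst.
  under eq_fun do rewrite big_nat_recr//=; rewrite big_nat_recr//=.
  by apply: cvgD => //; apply: cvgMr_tmp.
Qed.

(** Lindeberg's bound for the terms from [m] on: as the weights decrease and
    their squares have sum at most one, the sum of the cubes is at most [c m],
    which in turn is at most the square root of [m.+1%:R^-1]. *)
Lemma normal_tail_error a t m n c : weights c -> (m <= n)%N ->
  `|expR (- (t ^+ 2 * (1 - \sum_(0 <= s < n) c s ^+ 2)) / 2) *
      \int[P]_w cos (a + t * H c n w) - normal_tail a t m c|
  <= lindeberg_cst t * Num.sqrt m.+1%:R^-1.
Proof.
move=> [dc c01 c1] mn; rewrite /normal_tail.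
set A := \int[P]_w _; set B := \int[P]_w _.
have L := lindeberg mC lawC indC a t c01 mn; rewrite -/A -/B in L.
have tau : \sum_(0 <= s < n) c s ^+ 2 =
  \sum_(0 <= s < m) c s ^+ 2 + \sum_(m <= s < n) c s ^+ 2 by rewrite (big_cat_nat (leq0n m) mn).
set S := \sum_(0 <= s < m) _ in tau *.
set U := \sum_(m <= s < n) c s ^+ 2 in tau L *.
have c1n := c1 n; rewrite tau in c1n *.
set e1 := expR (- (t ^+ 2 * (1 - (S + U))) / 2).
have -> : expR (- (t ^+ 2 * (1 - S)) / 2) = e1 * expR (- (t ^+ 2 * U) / 2).
  by rewrite /e1 -expRD; congr expR; ring.
have e11 : `|e1| <= 1.
  rewrite ger0_norm ?expR_ge0// -expR0 ler_expR mulr_le0_ge0// oppr_le0.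
  by rewrite mulr_ge0 ?sqr_ge0// subr_ge0.
rewrite -mulrA -mulrBr normrM; apply: (@le_trans _ _ (1 * (lindeberg_cst t * Num.sqrt m.+1%:R^-1))).
  apply: ler_pM => //; apply: le_trans L _; rewrite ler_wpM2l ?lindeberg_cst_ge0//.
  apply: le_trans (sum_cubes_le dc c01 (c1 n) mn) _; exact: head_le.
by rewrite mul1r.
Qed.

Lemma sqrt_inv_cvg0 (K : R) : K * Num.sqrt m.+1%:R^-1 @[m --> \oo] --> (0 : R).
Proof.
rewrite -(mulr0 K); apply: cvgMl_tmp; rewrite -[X in _ --> X]sqrtr0.
apply: (cvg_image (@sqrt_continuous R 0)); exact: cvg_harmonic.
Qed.

(** Only finitely many weights are far from zero, so that up to an error that
    is uniform in the array both sides are continuous functions of finitely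
    many of them. *)
Lemma weighted_sums_cvg (be : nat -> nat -> R) (D : nat -> nat) b (G Y : T -> R) (v : R) :
  (forall k, weights (be k)) -> weights b ->
  (forall k, \sum_(0 <= s < D k) be k s ^+ 2 = 1) ->
  (forall k s, (D k <= s)%N -> be k s = 0) ->
  (forall s, be k s @[k --> \oo] --> b s) ->
  measurable_fun setT G -> measurable_fun setT Y ->
  \sum_(0 <= s < n) b s ^+ 2 @[n --> \oo] --> 1 - v ->
  (forall n a t, \int[P]_w cos (a + t * (H b n w + G w)) =
     expR (- (t ^+ 2 * v) / 2) * \int[P]_w cos (a + t * H b n w)) ->
  {ae P, forall w, H b n w + G w @[n --> \oo] --> Y w} ->
  forall a t, \int[P]_w cos (a + t * H (be k) (D k) w) @[k --> \oo] -->
    \int[P]_w cos (a + t * Y w).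
Proof.
move=> wbe wb be1 be0 beb mG mY bv cosG HY a t.
set K := lindeberg_cst t.
have err k m : `|\int[P]_w cos (a + t * H (be k) (D k) w) - normal_tail a t m (be k)|
    <= K * Num.sqrt m.+1%:R^-1.
  have HD n : (D k <= n)%N -> \sum_(0 <= s < n) be k s ^+ 2 = 1 /\
      forall w, H (be k) n w = H (be k) (D k) w.
    move=> Dn; split.
      rewrite (big_cat_nat (leq0n (D k)) Dn)/= be1 big_nat_cond big1 ?addr0// => s.
      by rewrite andbT => /andP[/be0 ->]; rewrite expr0n.
    move=> w; rewrite /block (big_cat_nat (leq0n (D k)) Dn)/=.
    rewrite [X in _ + X]big_nat_cond [X in _ + X]big1 ?addr0// => s.
    by rewrite andbT => /andP[/be0 ->]; rewrite mul0r.
  have [E1 E2] := HD _ (leq_maxl (D k) m).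
  have := normal_tail_error a t (wbe k) (leq_maxr (D k) m).
  by rewrite E1 (funext E2) subrr mulr0 oppr0 mul0r expR0 mul1r.
have errb m : `|\int[P]_w cos (a + t * Y w) - normal_tail a t m b|
    <= K * Num.sqrt m.+1%:R^-1.
  pose E n := expR (- (t ^+ 2 * (1 - \sum_(0 <= s < n) b s ^+ 2)) / 2).
  have Ev : E n @[n --> \oo] --> expR (- (t ^+ 2 * v) / 2).
    have -> : v = 1 - (1 - v) by ring.
    exact: (cvg_image (@continuous_gauss R t _) bv).
  have mHG n : measurable_fun setT (fun w => H b n w + G w).
    by apply: measurable_funD => //; exact: (H_measurable mC).
  have cY := @cos_affine_cvg a t _ _ mHG mY HY.
  have cE : (E n - expR (- (t ^+ 2 * v) / 2)) * \int[P]_w cos (a + t * H b n w)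
      @[n --> \oo] --> (0 : R).
    apply: (@squeeze_cvgr _ _ _ _ (fun n => - `|E n - expR (- (t ^+ 2 * v) / 2)|)
      (fun n => `|E n - expR (- (t ^+ 2 * v) / 2)|)).
    - apply: nearW => n; rewrite -ler_norml normrM ler_piMr//.
      exact: Rintegral_cos_le1 (H_measurable mC _ _).
    - rewrite -oppr0; apply: cvgN; apply/norm_cvg0P/cvgrPdist_lt => e e0.
      by move/cvgrPdist_lt : Ev => /(_ e e0); apply: filterS => n /=; rewrite sub0r normrN distrC.
    - apply/norm_cvg0P/cvgrPdist_lt => e e0.
      by move/cvgrPdist_lt : Ev => /(_ e e0); apply: filterS => n /=; rewrite sub0r normrN distrC.
  have cS : E n * \int[P]_w cos (a + t * H b n w) @[n --> \oo] --> \int[P]_w cos (a + t * Y w).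
    rewrite -[X in _ --> X]add0r.
    under eq_fun => n do rewrite -[E n](subrK (expR (- (t ^+ 2 * v) / 2))) mulrDl -cosG.
    exact: cvgD.
  apply: (@cvg_le_cst _ (fun n =>
    `|E n * \int[P]_w cos (a + t * H b n w) - normal_tail a t m b|)).
    by apply: cvg_norm; apply: cvgB => //; exact: cvg_cst.
  by near=> n; apply: normal_tail_error => //; near: n; exists m.
apply/cvgrPdist_le => e e0.
have e3 : 0 < e / 3 by rewrite divr_gt0.
have [m _ /(_ m (leqnn m)) hm] : \forall m \near \oo, K * Num.sqrt m.+1%:R^-1 <= e / 3.
  have := @sqrt_inv_cvg0 K; move/cvgrPdist_le => /(_ _ e3); apply: filterS => m.
  by rewrite sub0r normrN; apply: le_trans; exact: ler_norm.
have := @normal_tail_continuous a t m _ _ beb; move/cvgrPdist_le => /(_ _ e3).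
apply: filterS => k hk.
have h1 := le_trans (err k m) hm; have h2 := le_trans (errb m) hm.
move: h1 h2 hk; rewrite !ler_norml => /andP[? ?] /andP[? ?] /andP[? ?].
apply/andP; split; lra.
Unshelve. all: by end_near. Qed.
End weighted_sums_limit.

(** * The law of the standardized statistic *)

Section standardized_statistic_law.
Context d {T : measurableType d} {R : realType} (P : probability T R).
Variable C : nat -> T -> R.
Hypothesis mC : forall s, measurable_fun setT (C s).
Hypothesis lawC : forall s, has_law P (C s) chi2_1.
Hypothesis indC : mutually_independent P
  (fun s => preimage_set_system setT (C s) measurable).
Implicit Types (c : nat -> R) (th : R) (n s : nat) (w : T).

Local Notation xi := (std_chi2 C).
Local Notation H c n := (block xi c 0 n).
Local Notation F := (fun s => preimage_set_system setT (C s) measurable).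

(** The absolute values, equal almost surely to the variables themselves, make
    the weighted sum nonnegative everywhere. *)
Definition chi2_sum c n w : R := \sum_(0 <= s < n) c s * `|C s w|.

Lemma chi2_depends s J : s \in J -> depends_on F J (C s).
Proof. by move=> sJ; exact: (depends_on_mem (preimage_system_setT C) sJ). Qed.

Lemma chi2_sum_depends c n : depends_on F (index_iota 0 n) (chi2_sum c n).
Proof.
apply: depends_on_sum => s sJ; apply: depends_onM; first exact: depends_on_cst.
by apply: (depends_on_comp (g := Num.norm)) => //; exact: chi2_depends.
Qed.

Lemma chi2_sum_measurable c n : measurable_fun setT (chi2_sum c n).
Proof. exact: (depends_on_measurable (preimage_system_measurable mC) (@chi2_sum_depends c n)). Qed.

Lemma chi2_sum_ge0 c n w : (forall s, 0 <= c s) -> 0 <= chi2_sum c n w.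
Proof. by move=> c0; apply: sumr_ge0 => s _; exact: mulr_ge0. Qed.

Lemma chi2_laplace1 th s : 0 <= th ->
  \int[P]_w expR (- (th * `|C s w|)) = (Num.sqrt (1 + 2 * th))^-1.
Proof.
move=> th0; rewrite -Rintegral_normal_gauss ?mulr_ge0//.
have mf : measurable_fun setT (fun x : R => expR (- (th * `|x|))).
  by apply: measurableT_comp => //; apply: measurableT_comp => //; apply: measurable_funM.
rewrite /Rintegral (integral_chi2_law (mC s) (lawC s) mf); congr fine.
apply: eq_integral => x _; congr (expR _)%:E.
by rewrite ger0_norm ?sqr_ge0//; field.
Qed.

Lemma chi2_sum_laplace c n th : (forall s, 0 <= c s) -> 0 <= th ->
  \int[P]_w expR (- (th * chi2_sum c n w)) =
  \prod_(0 <= s < n) (Num.sqrt (1 + 2 * th * c s))^-1.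
Proof.
move=> c0 th0; elim: n => [|n IH].
  rewrite big_geq// -[RHS](Rintegral_prob_cst P); apply: eq_Rintegral => w _.
  by rewrite /chi2_sum big_geq// mulr0 oppr0 expR0.
rewrite big_nat_recr//= -IH.
have -> : 2 * th * c n = 2 * (th * c n) by ring.
rewrite -(chi2_laplace1 n (mulr_ge0 th0 (c0 n))).
have mf (x : R) : measurable_fun setT (fun y : R => expR (- (x * y))).
  by apply: measurableT_comp => //; apply: measurableT_comp => //; apply: measurable_funM.
have ind : indep_fun P (chi2_sum c n) (fun w => `|C n w|).
  apply: (@indep_fun_comp _ _ _ P _ (C n) id Num.norm) => //.
  apply: (depends_on_indep (preimage_system_setT C) (preimage_system_setI (C := C))
    (preimage_system_measurable mC) indC _ (@chi2_sum_depends c n) (chi2_depends (mem_head n [::]))).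
  by rewrite cats1 rcons_uniq iota_uniq andbT mem_index_iota ltnn andbF.
have mS := chi2_sum_measurable c n.
have mCn : measurable_fun setT (fun w => `|C n w|) by exact: measurableT_comp.
have bnd (x : R) (X : T -> R) : measurable_fun setT X -> 0 <= x -> (forall w, 0 <= X w) ->
    P.-integrable setT (EFin \o (fun w => expR (- (x * X w)))).
  move=> mX x0 X0; apply: (@bounded_integrable _ _ _ _ _ 1).
    exact: (measurableT_comp (mf x) mX).
  by move=> w; rewrite ger0_norm ?expR_ge0// -expR0 ler_expR oppr_le0 mulr_ge0.
have [_ <-] := indep_Rintegral_mul (measurableT_comp (mf th) mS)
  (measurableT_comp (mf (th * c n)) mCn) (indep_fun_comp (mf th) (mf (th * c n)) ind)
  (bnd _ _ mS th0 (fun w => chi2_sum_ge0 n w c0)) (bnd _ _ mCn (mulr_ge0 th0 (c0 n)) (fun w => normr_ge0 _)).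
apply: eq_Rintegral => w _; rewrite /= -expRD; congr expR.
by rewrite /chi2_sum big_nat_recr//=; ring.
Qed.

Section model.
Variables (m : model R) (lam : seq R).
Hypothesis hlam : ordered_eigenvalues (hyp m *m V_mx m *m hyp m) lam.
Hypothesis h0 : H0 m.

Let n := total_dim m.

Lemma sum_sqr_lam : \sum_(x <- lam) x ^+ 2 = \sum_(0 <= s < n) lam`_s ^+ 2.
Proof. by rewrite (big_nth 0) (size_lam hlam). Qed.

Lemma beta_ge0 s : 0 <= beta lam s.
Proof. by rewrite divr_ge0 ?sqrtr_ge0// (lam_ge0 hlam). Qed.

Lemma sum_beta : \sum_(0 <= s < n) beta lam s ^+ 2 = 1.
Proof.
rewrite /beta; under eq_bigr do rewrite exprMn exprVn.
rewrite -big_distrl/= sqr_sqrtr ?sum_sqr_lam; last first.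
  by apply: sumr_ge0 => s _; exact: sqr_ge0.
by rewrite divff// gt_eqF// (sum_lam_sqr_gt0 hlam).
Qed.

Lemma beta_default s : (n <= s)%N -> beta lam s = 0.
Proof. by move=> ns; rewrite /beta nth_default ?mul0r// (size_lam hlam). Qed.

Lemma beta_weights : weights (beta lam).
Proof.
have s1 k : \sum_(0 <= s < k) beta lam s ^+ 2 <= 1.
  rewrite -sum_beta; have [kn|/ltnW nk] := leqP k n.
    rewrite [leRHS](big_cat_nat (leq0n k) kn)/= lerDl; apply: sumr_ge0 => s _.
    exact: sqr_ge0.
  rewrite (big_cat_nat (leq0n n) nk)/= [X in _ + X]big_nat_cond.
  rewrite [X in _ + X]big1 ?addr0// => s.
  by rewrite andbT => /andP[/beta_default ->]; rewrite expr0n.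
split=> // [s s' ss'|s].
  rewrite /beta ler_wpM2r ?invr_ge0 ?sqrtr_ge0//.
  have [sn|ns] := ltnP s' (size lam); last first.
    by rewrite nth_default ?(lam_ge0 hlam).
  have tr : transitive (>=%R : rel R) by move=> y x z xy yz; exact: le_trans yz xy.
  have rf : reflexive (>=%R : rel R) by move=> x; exact: lexx.
  have [_ /(sorted_leq_nth tr rf 0)] := hlam.
  by apply => //; rewrite inE//; exact: leq_ltn_trans sn.
rewrite beta_ge0/= -[beta lam s]ger0_norm ?beta_ge0// -sqrtr_sqr -[leRHS]sqrtr1 ler_sqrt//.
apply: le_trans (s1 s.+1); rewrite big_nat_recr//= lerDr; apply: sumr_ge0 => i _.
exact: sqr_ge0.
Qed.

Lemma W_measurable : measurable_fun setT (@W_stat R m).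
Proof. by apply: measurable_funM => //; apply: measurable_funB => //; exact: Q_measurable. Qed.

(** The quadratic form and the weighted chi-square sum have the same Laplace
    transform. *)
Lemma W_law (f : R -> R) (B : R) : continuous f -> (forall x, `|f x| <= B) ->
  \int[prob m]_w f (W_stat w) = \int[P]_w f (H (beta lam) n w).
Proof.
move=> fc fB; pose tr := \tr (hyp m *m V_mx m).
pose q := Num.sqrt (2 * \tr ((hyp m *m V_mx m) *m (hyp m *m V_mx m))).
pose g (x : R) := f ((x - tr) / q).
have gc : continuous g.
  move=> x; apply: (@continuous_comp _ _ _ (fun x : R => (x - tr) / q) f); last exact: fc.
  by apply: cvgMr_tmp; apply: cvgB; [exact: cvg_id|exact: cvg_cst].
have lap (k : nat) : \int[prob m]_w expR (- (k%:R * Q_stat w)) =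
    \int[P]_w expR (- (k%:R * chi2_sum (nth 0 lam) n w)).
  rewrite chi2_sum_laplace//; last exact: (lam_ge0 hlam).
  rewrite -Q_laplace ?mulr_ge0//.
  by apply: eq_Rintegral => w _; congr expR; field.
rewrite [LHS](laplace_inversion (@Q_measurable R m) (chi2_sum_measurable (nth 0 lam) n) (@Q_ge0 R m)
  (fun w => chi2_sum_ge0 n w (lam_ge0 hlam)) lap gc (B := B) (fun x => fB _)).
have ae_sum : {ae P, forall w, forall s, 0 <= C s w}.
  by apply/ae_foralln => s; exact: chi2_law_ge0 (mC s) (lawC s).
have mf := continuous_measurable_fun fc.
rewrite /Rintegral; congr fine; apply: ae_eq_integral => //.
- by apply/measurable_EFinP; exact: (measurableT_comp (continuous_measurable_fun gc) (chi2_sum_measurable _ _)).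
- by apply/measurable_EFinP; exact: (measurableT_comp mf (H_measurable mC _ _)).
apply: filterS ae_sum => w Cw _; congr (f _)%:E.
have -> : q = Num.sqrt 2 * Num.sqrt (\sum_(x <- lam) x ^+ 2).
  by rewrite -sqrtrM// sum_sqr_lam (sum_lam_sqr hlam).
rewrite /tr -(sum_lam hlam) -sumrB mulr_suml; apply: eq_bigr => s _.
by rewrite (ger0_norm (Cw s)) /std_chi2 /beta invfM; ring.
Qed.
End model.
End standardized_statistic_law.

(** * Almost sure limits and the limit variable *)

Section almost_sure_limits.
Context d {T : measurableType d} {R : realType} (P : probability T R).
Implicit Types (X : nat -> T -> R) (Y : T -> R) (u : nat -> R) (w : T).

(** The set of convergence is that of the Cauchy property, a countable
    combination of inequalities; off it the limit is a constant default value. *)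
Lemma lim_measurable X : (forall n, measurable_fun setT (X n)) ->
  measurable_fun setT (fun w => limn (fun n => X n w)).
Proof.
move=> mX; pose D := [set w | cvgn (fun n => X n w)].
have DE : D = \bigcap_j \bigcup_N \bigcap_k
    [set w | `|X (N + k)%N w - X N w| <= j.+1%:R^-1].
  apply/seteqP; split => w /=.
    move=> /cvg_ex[l Xl] j _.
    set e : R := j.+1%:R^-1; have e0 : 0 < e / 2 by rewrite divr_gt0 ?invr_gt0.
    move/cvgrPdist_le : Xl => /(_ _ e0)[N _ hN]; exists N => // k _ /=.
    have := hN N (leqnn N); have := hN (N + k)%N (leq_addr _ _).
    rewrite /= !ler_norml => /andP[h1 h2] /andP[h3 h4]; apply/andP.
    by split; lra.
  move=> Xw; apply/cauchy_cvgP/cauchy_exP => e e0.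
  have [j je] : exists j, j.+1%:R^-1 < e.
    by exists (Num.truncn e^-1); rewrite invf_plt ?posrE//; exact: truncnS_gt.
  have [N _ hN] := Xw j I; exists (X N w); exists N => // n /= Nn.
  rewrite /ball/= distrC (le_lt_trans _ je)//.
  by have := hN (n - N)%N I; rewrite /= subnKC.
have mD : measurable D.
  rewrite DE; apply: bigcapT_measurable => j; apply: bigcup_measurable => N _.
  apply: bigcapT_measurable => k.
  rewrite (_ : [set w | _] = (fun w => `|X (N + k)%N w - X N w|) @^-1` `]-oo, j.+1%:R^-1]%classic).
    rewrite -[X in measurable X]setTI.
    have : measurable_fun setT (fun w => `|X (N + k)%N w - X N w|).
      by apply: measurableT_comp => //; exact: measurable_funB.
    by apply.
  by apply/seteqP; split => w /=; rewrite in_itv.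
rewrite -(setUv D); apply/measurable_funU => //; first exact: measurableC.
split.
  apply: (@measurable_fun_cvg _ _ _ D X) => // n.
  exact: measurable_funTS.
apply: (@eq_measurable_fun _ _ _ _ _ (fun=> point)) => //.
by move=> w; rewrite inE => /= nD; rewrite dvgP.
Qed.

Lemma fatou_sqr X Y (K : R) : (forall n, measurable_fun setT (X n)) ->
  measurable_fun setT Y -> (forall n, P.-integrable setT (EFin \o (fun w => X n w ^+ 2))) ->
  (forall n, \int[P]_w (X n w ^+ 2) <= K) ->
  {ae P, forall w, X n w @[n --> \oo] --> Y w} ->
  P.-integrable setT (EFin \o (fun w => Y w ^+ 2)) /\ \int[P]_w (Y w ^+ 2) <= K.
Proof.
move=> mX mY iX XK XY.
pose f n w := (X n w ^+ 2)%:E.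
have mf n : measurable_fun setT (f n) by apply/measurable_EFinP; exact: measurable_funX.
have mYE : measurable_fun setT (fun w => (Y w ^+ 2)%:E).
  by apply/measurable_EFinP; exact: measurable_funX.
have fE n : (\int[P]_w f n w = (\int[P]_w (X n w ^+ 2))%:E)%E.
  by rewrite /Rintegral fineK//; exact: (integrable_fin_num measurableT (iX n)).
have le : (\int[P]_w (Y w ^+ 2)%:E <= K%:E)%E.
  apply: (@le_trans _ _ (\int[P]_w limn_einf (f^~ w))%E).
    apply: ae_ge0_le_integral => //.
    - by move=> w _; rewrite lee_fin sqr_ge0.
    - move=> w _; rewrite limn_einf_lim; apply: lime_ge; first exact: is_cvg_einfs.
      apply: nearW => n; apply: le_ereal_inf_tmp => _ [k _ <-].
      by rewrite /f lee_fin sqr_ge0.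
    - apply: measurableT_comp => //; apply: measurable_fun_limn_esup => n.
      by apply: measurableT_comp.
    - apply: filterS XY => w Xw _.
      have cf : f n w @[n --> \oo] --> (Y w ^+ 2)%:E.
        have cX : X n w ^+ 2 @[n --> \oo] --> Y w ^+ 2 by exact: cvgM.
        by apply: (cvg_comp _ _ cX).
      rewrite is_cvg_limn_einfE; last by apply/cvg_ex; eexists; exact: cf.
      by rewrite (cvg_lim _ cf).
  apply: le_trans (fatou P measurableT mf _) _.
    by move=> n w _; rewrite lee_fin sqr_ge0.
  rewrite limn_einf_lim; apply: lime_le; first exact: is_cvg_einfs.
  apply: nearW => n; apply: le_trans (ereal_inf_lbound _) _; first by exists n => /=.
  by rewrite lee_fin.
have iY : P.-integrable setT (EFin \o (fun w => Y w ^+ 2)).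
  apply/integrableP; split => //; apply: le_lt_trans (ltry K); apply: le_trans le.
  rewrite le_eqVlt; apply/orP; left; apply/eqP; apply: eq_integral => w _.
  by rewrite /= ger0_norm ?sqr_ge0.
split => //; rewrite -lee_fin; apply: le_trans le.
by rewrite /Rintegral fineK//; exact: (integrable_fin_num measurableT iY).
Qed.

End almost_sure_limits.

Section limit_variable.
Context {R : realType}.
Implicit Types (b u : nat -> R).

(** The nonzero terms of a nonincreasing nonnegative sequence form an initial
    segment, so that summing up to their number loses nothing. *)
Lemma sum_upto_nonzero b u : nonincreasing_seq b -> (forall s, 0 <= b s) ->
  (forall s, b s = 0 -> u s = 0) ->
  sum_upto (num_nonzero b) u = limn (fun n => \sum_(0 <= s < n) u s).
Proof.
move=> db b0 bu; rewrite /sum_upto; congr (limn _); apply/funext => n.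
rewrite big_mkcond; apply: eq_bigr => s _; case: ifPn => // hs; apply/esym/bu.
apply/eqP; apply: contraNT hs => bs0; rewrite /num_nonzero /counting.
case: asboolP => [fin|_]; last by rewrite leey.
rewrite lee_fin ler_nat; apply: leq_card_fset_set => //.
apply: subset_card_le => i /= si; apply: contra_neq bs0 => bi0.
apply/eqP; rewrite eq_le b0 andbT -bi0; exact: db.
Qed.

Lemma sum_upto_infinite u : sum_upto +oo%E u = limn (fun n => \sum_(0 <= s < n) u s).
Proof.
rewrite /sum_upto; congr (limn _); apply/funext => n.
by apply: eq_bigl => s; rewrite leey.
Qed.

Lemma partial_sums_le1 b : (\sum_(0 <= s <oo) ((b s) ^+ 2)%:E <= 1)%E ->
  forall n, \sum_(0 <= s < n) b s ^+ 2 <= 1.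
Proof.
move=> b1 n; rewrite -lee_fin; apply: le_trans b1; rewrite -sumEFin.
by apply: nneseries_lim_ge => s _ _; rewrite lee_fin sqr_ge0.
Qed.

Lemma sum_sqr_cvg b : (forall n, \sum_(0 <= s < n) b s ^+ 2 <= 1) ->
  cvgn (fun n => \sum_(0 <= s < n) b s ^+ 2).
Proof.
move=> b1; apply: nondecreasing_is_cvgn.
  by apply/nondecreasing_seqP => n; rewrite big_nat_recr//= lerDl sqr_ge0.
by exists 1 => _ [n _ <-].
Qed.

Lemma sum_sqr_lim b : (forall n, \sum_(0 <= s < n) b s ^+ 2 <= 1) ->
  (\sum_(0 <= s <oo) ((b s) ^+ 2)%:E = (limn (fun n => \sum_(0 <= s < n) b s ^+ 2))%:E)%E.
Proof.
move=> b1; rewrite -(EFin_lim (sum_sqr_cvg b1)); congr (limn _).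
by apply/funext => n; rewrite /= sumEFin.
Qed.

End limit_variable.

(** * Chi-square series with a normal part *)

Section series_plus_normal.
Context d {T : measurableType d} {R : realType} (P : probability T R).
Variable C : nat -> T -> R.
Hypothesis mC : forall s, measurable_fun setT (C s).
Hypothesis lawC : forall s, has_law P (C s) chi2_1.
Hypothesis indC : mutually_independent P
  (fun s => preimage_set_system setT (C s) measurable).
Variables (b : nat -> R) (G : T -> R) (v : R).
Implicit Types (c : nat -> R) (a t : R) (n s : nat) (w : T).

Local Notation xi := (std_chi2 C).
Local Notation H c n := (block xi c 0 n).

Hypothesis wb : weights b.
Hypothesis bv : \sum_(0 <= s < n) b s ^+ 2 @[n --> \oo] --> 1 - v.
Hypothesis mG : measurable_fun setT G.
Hypothesis indG : forall n, indep_fun P (H b n) G.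
Hypothesis cosG : forall a t,
  \int[P]_w cos (a + t * G w) = expR (- (t ^+ 2 * v) / 2) * cos a.
Hypothesis iG2 : P.-integrable setT (EFin \o (fun w => G w ^+ 2)).
Hypothesis EG : \int[P]_w G w = 0.
Hypothesis EG2 : \int[P]_w (G w ^+ 2) = v.

Definition series w : R := limn (fun n => H b n w) + G w.

Lemma series_measurable : measurable_fun setT series.
Proof.
apply: measurable_funD => //; apply: lim_measurable => n; exact: (H_measurable mC).
Qed.

Lemma partial_measurable n : measurable_fun setT (fun w => H b n w + G w).
Proof. by apply: measurable_funD => //; exact: (H_measurable mC). Qed.

Lemma series_cvg : {ae P, forall w, H b n w + G w @[n --> \oo] --> series w}.
Proof.
have [_ _ b1] := wb.
have := std_block_cvg mC lawC indC b1.
by apply: filterS => w cw; apply: cvgD => //; exact: cvg_cst.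
Qed.

Lemma series_cos n a t : \int[P]_w cos (a + t * (H b n w + G w)) =
  expR (- (t ^+ 2 * v) / 2) * \int[P]_w cos (a + t * H b n w).
Proof.
have mH := H_measurable mC b n.
have mt : measurable_fun setT (fun x : R => t * x) by exact: measurable_funM.
under eq_Rintegral do rewrite mulrDr.
have cosG0 x : \int[P]_w cos (x + t * G w) = expR (- (t ^+ 2 * v) / 2) * cos (x + 0).
  by rewrite addr0; exact: cosG.
rewrite [LHS](Rintegral_cos_normal a (measurableT_comp mt mH) (measurableT_comp mt mG)
  (indep_fun_comp mt mt (indG n)) cosG0).
by rewrite addr0.
Qed.

Lemma partial_var_le n : \sum_(0 <= s < n) b s ^+ 2 + v <= 1.
Proof.
rewrite -lerBrDr -(cvg_lim _ bv)//.
apply: (@nondecreasing_cvgn_le _ (fun n => \sum_(0 <= s < n) b s ^+ 2)).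
  by apply/nondecreasing_seqP => i; rewrite big_nat_recr//= lerDl sqr_ge0.
by apply/cvg_ex; eexists; exact: bv.
Qed.

Lemma partial_sqr n : P.-integrable setT (EFin \o (fun w => (H b n w + G w) ^+ 2)) /\
  \int[P]_w ((H b n w + G w) ^+ 2) <= 1.
Proof.
have [iH EH] := std_block_var mC lawC indC b n.
have [i E] := indep_Rintegral_sqr (H_measurable mC b n) mG (indG n) iH iG2 EG.
split => //; rewrite E [X in _ + X]EG2 [X in X + _]EH; exact: partial_var_le.
Qed.

Lemma series_sqr : P.-integrable setT (EFin \o (fun w => series w ^+ 2)) /\
  \int[P]_w (series w ^+ 2) <= 1.
Proof.
apply: (fatou_sqr partial_measurable series_measurable _ _ series_cvg) => n;
  by case: (partial_sqr n).
Qed.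

Lemma weighted_sums_cvg_law (be : nat -> nat -> R) (D : nat -> nat) :
  (forall k, weights (be k)) ->
  (forall k, \sum_(0 <= s < D k) be k s ^+ 2 = 1) ->
  (forall k s, (D k <= s)%N -> be k s = 0) ->
  (forall s, be k s @[k --> \oo] --> b s) ->
  forall (f : R -> R) (B : R), continuous f -> (forall x, `|f x| <= B) ->
  \int[P]_w f (H (be k) (D k) w) @[k --> \oo] --> \int[P]_w f (series w).
Proof.
move=> wbe be1 be0 beb f B fc fB.
have var k := std_block_var mC lawC indC (be k) (D k).
have [iS ES] := series_sqr.
apply: (@cosine_cvg_distribution R (fun=> d) (fun=> T) (fun=> P)
  (fun k => H (be k) (D k)) d T P series _ series_measurable _ _ iS _ ES f B fc fB).
- by move=> k; exact: (H_measurable mC).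
- move=> a t; exact: (@weighted_sums_cvg _ _ _ P C mC lawC indC be D b G series v
    wbe wb be1 be0 beb mG series_measurable bv series_cos series_cvg a t).
- by move=> k; case: (var k).
- by move=> k; case: (var k) => _ ->; rewrite be1.
Qed.

End series_plus_normal.

(** * Power sums and Taylor remainders of the logarithm *)

Section logarithm_taylor.
Context {R : realType}.
Implicit Types (y : R) (n : nat).

Definition log_rem n y : R :=
  ln (1 + y) - \sum_(1 <= m < n) (- 1) ^+ m.+1 * y ^+ m / m%:R.

Lemma log_remS n y : log_rem n.+2 y =
  log_rem n.+1 y - (- 1) ^+ n * y ^+ n.+1 / n.+1%:R.
Proof.
rewrite /log_rem big_nat_recr//= opprD addrA; congr (_ - _ * _ / _).
by rewrite 2!exprS mulrA mulrNN !mul1r.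
Qed.

Lemma log_rem0 n : log_rem n 0 = 0.
Proof.
rewrite /log_rem addr0 ln1 sub0r big_nat_cond big1 ?oppr0// => m.
by rewrite andbT => /andP[m0 _]; rewrite expr0n gtn_eqF// mulr0 mul0r.
Qed.

Lemma is_derive_monomial n (c y : R) :
  is_derive y 1 (fun z => c * z ^+ n.+1) (c * (n.+1%:R * y ^+ n)).
Proof.
have dX : is_derive y 1 ((id : R -> R) ^+ n.+1) ((n.+1%:R * y ^+ n) *: (1 : R)).
  exact: is_deriveX.
have := is_deriveZ c dX; rewrite /GRing.scale/= mulr1.
rewrite (_ : (fun z => c * z ^+ n.+1) = c \*: ((id : R -> R) ^+ n.+1))//.
by apply/funext => z; rewrite /= fctE.
Qed.

(** The partial sums of the geometric series of [(1 + y)^-1] appear. *)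
Lemma log_rem_derive n y : 0 <= y ->
  is_derive y 1 (log_rem n.+1) ((- y) ^+ n / (1 + y)).
Proof.
move=> y0; have y1 : 0 < 1 + y by rewrite ltr_pwDl.
elim: n => [|n IH].
  have -> : log_rem 1 = (fun z => ln (1 + z)).
    by apply/funext => z; rewrite /log_rem big_geq// subr0.
  rewrite expr0 mul1r.
  have dl : is_derive (1 + y) 1 (@ln R) (1 + y)^-1 by exact: is_derive1_ln.
  have da : is_derive y 1 (fun z : R => 1 + z) 1.
    by rewrite (_ : (fun z : R => 1 + z) = cst 1 + id)//; apply: is_derive_eq; rewrite ?add0r.
  have := @is_derive1_comp R (@ln R) (fun z : R => 1 + z) y _ _ dl da.
  by rewrite mulr1.
have -> : log_rem n.+2 = log_rem n.+1 - (fun z => ((- 1) ^+ n / n.+1%:R) * z ^+ n.+1).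
  by apply/funext => z; rewrite log_remS !fctE; congr (_ - _); ring.
have := is_deriveB IH (is_derive_monomial n ((- 1) ^+ n / n.+1%:R) y).
rewrite (_ : _ - _ = (- y) ^+ n.+1 / (1 + y))// exprS [(- y) ^+ n]exprNn.
by field; rewrite gt_eqF//= pnatr_eq0.
Qed.

Lemma log_rem_le n y : 0 <= y -> `|log_rem n.+1 y| <= y ^+ n.+1 / n.+1%:R.
Proof.
move=> y0; apply: (@derive_dominated _ (log_rem n.+1) (fun y => (- y) ^+ n / (1 + y))
  (fun y => y ^+ n.+1 / n.+1%:R) (fun y => y ^+ n)) => //.
- exact: log_rem0.
- by rewrite expr0n mul0r.
- by move=> x x0; exact: log_rem_derive.
- move=> x _; have := is_derive_monomial n n.+1%:R^-1 x.
  rewrite mulKf ?pnatr_eq0//; under [X in is_derive _ _ X _]eq_fun do rewrite mulrC.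
  by [].
- move=> x x0; rewrite normrM normrX normrN (ger0_norm x0) ler_piMr ?exprn_ge0//.
  by rewrite normfV ger0_norm ?addr_ge0// invf_le1 ?lerDl// ltr_pwDl.
Qed.

End logarithm_taylor.

Section power_sums.
Context {R : realType}.
Implicit Types (c b u : nat -> R) (x y e : R) (m n s : nat).

Lemma weights_sum_cvg c u (K : R) : weights c -> (forall s, `|u s| <= K * c s ^+ 2) ->
  cvgn (fun n => \sum_(0 <= s < n) u s).
Proof.
move=> [_ _ c1] uc; apply: (@normed_cvg R R u).
apply: (@series_le_cvg _ _ (fun s => K * c s ^+ 2)) => //.
- by move=> s; exact: normr_ge0.
- by move=> s; apply: le_trans (normr_ge0 _) (uc s).
rewrite (_ : sequences.series _ = fun n => K * \sum_(0 <= s < n) c s ^+ 2); last first.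
  by apply/funext => n; rewrite /sequences.series/= big_distrr.
by apply: is_cvgMl_tmp; exact: sum_sqr_cvg.
Qed.

Definition psum c m : R := limn (fun n => \sum_(0 <= s < n) c s ^+ m).

Definition rsum n c x : R := limn (fun N => \sum_(0 <= s < N) log_rem n (x * c s)).

Lemma psum_term_le c m s : weights c -> c s ^+ m.+2 <= c s ^+ 2.
Proof.
move=> [_ c01 _]; have /andP[c0 c1] := c01 s.
by rewrite -addn2 exprD ler_piMl ?sqr_ge0// exprn_ile1.
Qed.

Lemma psum_cvg c m : weights c ->
  \sum_(0 <= s < n) c s ^+ m.+2 @[n --> \oo] --> psum c m.+2.
Proof.
move=> wc; apply: (@weights_sum_cvg c _ 1) => // s.
have [_ c01 _] := wc; rewrite mul1r ger0_norm ?psum_term_le// exprn_ge0//.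
by case/andP: (c01 s).
Qed.

Lemma rsum_term_le n c x s : weights c -> 0 <= x ->
  `|log_rem n.+2 (x * c s)| <= x ^+ n.+2 * c s ^+ 2.
Proof.
move=> wc x0; have [_ c01 _] := wc; have /andP[c0 _] := c01 s.
apply: le_trans (log_rem_le _ (mulr_ge0 x0 c0)) _.
rewrite ler_pdivrMr// exprMn -[leRHS]mulrA ler_wpM2l ?exprn_ge0//.
apply: le_trans (psum_term_le _ _ wc) _.
by rewrite ler_peMr ?sqr_ge0// ler1n.
Qed.

Lemma rsum_cvg n c x : weights c -> 0 <= x ->
  \sum_(0 <= s < N) log_rem n.+2 (x * c s) @[N --> \oo] --> rsum n.+2 c x.
Proof.
move=> wc x0; apply: (@weights_sum_cvg c _ (x ^+ n.+2)) => // s.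
exact: rsum_term_le.
Qed.

Lemma rsum_le n c x : weights c -> 0 <= x -> `|rsum n.+2 c x| <= x ^+ n.+2.
Proof.
move=> wc x0; apply: (cvg_le_cst (cvg_norm (@rsum_cvg n c x wc x0))).
apply: nearW => N; apply: le_trans (ler_norm_sum _ _ _) _.
apply: (@le_trans _ _ (x ^+ n.+2 * \sum_(0 <= s < N) c s ^+ 2)).
  by rewrite big_distrr/=; apply: ler_sum => s _; exact: rsum_term_le.
have [_ _ c1] := wc; by rewrite ler_piMr ?exprn_ge0.
Qed.

Lemma rsumS n c x : weights c -> 0 <= x ->
  rsum n.+3 c x = rsum n.+2 c x - (- 1) ^+ n.+1 * (x ^+ n.+2 / n.+2%:R) * psum c n.+2.
Proof.
move=> wc x0; apply: cvg_lim => //.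
have -> : (fun N => \sum_(0 <= s < N) log_rem n.+3 (x * c s)) = (fun N =>
    \sum_(0 <= s < N) log_rem n.+2 (x * c s)
    - (- 1) ^+ n.+1 * (x ^+ n.+2 / n.+2%:R) * \sum_(0 <= s < N) c s ^+ n.+2).
  apply/funext => N; rewrite big_distrr -sumrB; apply: eq_bigr => s _ /=.
  by rewrite log_remS exprMn; congr (_ - _); ring.
by apply: cvgB; [exact: rsum_cvg|apply: cvgMl_tmp; exact: psum_cvg].
Qed.

(** Near the origin the first nonzero term of the expansion dominates, so that
    convergence of the remainders passes to its coefficient. *)
Lemma psum_cvg_rsum (be : nat -> nat -> R) b n :
  (forall k, weights (be k)) -> weights b ->
  (forall x, 0 < x -> rsum n.+2 (be k) x @[k --> \oo] --> rsum n.+2 b x) ->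
  psum (be k) n.+2 @[k --> \oo] --> psum b n.+2.
Proof.
move=> wbe wb rbe; apply/cvgrPdist_le => e e0.
have n0 : 0 < n.+2%:R :> R by [].
pose x := e / (4 * n.+2%:R); have x0 : 0 < x by rewrite divr_gt0// mulr_gt0.
pose K := x ^+ n.+2 / n.+2%:R; have K0 : 0 < K by rewrite divr_gt0// exprn_gt0.
have e2 : 0 < K * (e / 2) by rewrite mulr_gt0// divr_gt0.
have := rbe x x0 => /cvgrPdist_le/(_ _ e2); apply: filterS => k rk.
have E c : weights c -> (- 1) ^+ n.+1 * K * psum c n.+2 = rsum n.+2 c x - rsum n.+3 c x.
  by move=> wc; rewrite (rsumS _ wc (ltW x0)) -/K; ring.
have norm_sgn : `|(- 1) ^+ n.+1 * K| = K by rewrite normrM normrX normrN1 expr1n mul1r gtr0_norm.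
rewrite -(ler_pM2l K0) -[X in X * _]norm_sgn -normrM mulrBr (E _ wb) (E _ (wbe k)).
have -> : rsum n.+2 b x - rsum n.+3 b x - (rsum n.+2 (be k) x - rsum n.+3 (be k) x) =
  (rsum n.+2 b x - rsum n.+2 (be k) x) - (rsum n.+3 b x - rsum n.+3 (be k) x) by ring.
apply: le_trans (ler_normB _ _) _.
have h1 := rsum_le n.+1 wb (ltW x0); have h2 := rsum_le n.+1 (wbe k) (ltW x0).
have h3 : x ^+ n.+3 + x ^+ n.+3 = K * (e / 2).
  rewrite exprS /K; move: (x ^+ n.+2) => X; rewrite /x.
  by move: n.+2%:R n0 => N n0; field; rewrite gt_eqF.
have h4 := ler_normB (rsum n.+3 b x) (rsum n.+3 (be k) x).
lra.
Qed.

Lemma psums_cvg_rsum (be : nat -> nat -> R) b :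
  (forall k, weights (be k)) -> weights b ->
  (forall x, 0 < x -> rsum 3 (be k) x @[k --> \oo] --> rsum 3 b x) ->
  forall n, psum (be k) n.+3 @[k --> \oo] --> psum b n.+3.
Proof.
move=> wbe wb r3 n; apply: psum_cvg_rsum => //.
elim: n => [//|n IH] x x0; rewrite (rsumS _ wb (ltW x0)).
under eq_fun => k do rewrite (rsumS _ (wbe k) (ltW x0)).
apply: cvgB; first exact: IH.
by apply: cvgMl_tmp; exact: psum_cvg_rsum.
Qed.

Lemma psum_tail_ge c m s : weights c ->
  c s ^+ m.+2 <= psum c m.+2 - \sum_(0 <= i < s) c i ^+ m.+2.
Proof.
move=> wc; have [_ c01 _] := wc; rewrite lerBrDl -(@big_nat_recr _ _ _ _ _ (fun i => c i ^+ m.+2))//=.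
apply: (@nondecreasing_cvgn_le _ (fun n => \sum_(0 <= s < n) c s ^+ m.+2)).
  apply/nondecreasing_seqP => i; rewrite big_nat_recr//= lerDl exprn_ge0//.
  by case/andP: (c01 i).
by apply/cvg_ex; eexists; exact: psum_cvg.
Qed.

Lemma psum_tail_le c m s : weights c ->
  psum c m.+2 - \sum_(0 <= i < s) c i ^+ m.+2 <= c s ^+ m.
Proof.
move=> wc; have [dc c01 c1] := wc; rewrite lerBlDl.
apply: (cvg_le_cst (@psum_cvg c m wc)).
exists s => // n /= sn; rewrite (big_cat_nat (leq0n s) sn)/= lerD2l.
have cs0 : 0 <= c s by case/andP: (c01 s).
apply: (@le_trans _ _ (\sum_(s <= i < n) c s ^+ m * c i ^+ 2)).
  apply: ler_sum_nat => i /andP[si _]; rewrite -addn2 exprD ler_wpM2r ?sqr_ge0//.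
  rewrite lerXn2r ?nnegrE//; first by case/andP: (c01 i).
  exact: dc.
rewrite -big_distrr/= ler_piMr ?exprn_ge0//; apply: le_trans (c1 n).
by rewrite [leRHS](big_cat_nat (leq0n s) sn)/= lerDr sumr_ge0// => i _; exact: sqr_ge0.
Qed.

Lemma pow_gap x y : 0 <= x < y -> exists m, x ^+ m.+1 < y ^+ m.+3.
Proof.
move=> /andP[x0 xy]; have y0 : 0 < y by exact: le_lt_trans xy.
have q1 : `|x / y| < 1 by rewrite ger0_norm ?divr_ge0 ?(ltW y0)// ltr_pdivrMr// mul1r.
have y20 : 0 < y ^+ 2 by rewrite exprn_gt0.
have := cvg_expr q1 => /cvgrPdist_lt/(_ _ y20)[m _ /(_ m.+1 (leqnSn m))].
rewrite /= sub0r normrN ger0_norm ?exprn_ge0 ?divr_ge0 ?(ltW y0)//.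
rewrite exprMn exprVn ltr_pdivrMr ?exprn_gt0// -exprD => h.
by exists m.
Qed.

(** The largest of the remaining weights is the limit of the [m]-th roots of
    the remaining power sums. *)
Lemma weights_cvg_psum (be : nat -> nat -> R) b :
  (forall k, weights (be k)) -> weights b ->
  (forall n, psum (be k) n.+3 @[k --> \oo] --> psum b n.+3) ->
  forall s, be k s @[k --> \oo] --> b s.
Proof.
move=> wbe wb pbe; elim/ltn_ind => s IH.
have tail m : psum (be k) m.+3 - \sum_(0 <= i < s) be k i ^+ m.+3 @[k --> \oo]
    --> psum b m.+3 - \sum_(0 <= i < s) b i ^+ m.+3.
  apply: cvgB => //; elim: s IH => [|j IHj] IH.
    by under eq_fun do rewrite big_geq//; rewrite big_geq//; exact: cvg_cst.
  under eq_fun do rewrite big_nat_recr//=; rewrite big_nat_recr//=; apply: cvgD.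
    by apply: IHj => i ij; apply: IH; exact: ltnW.
  apply: (@cvg_image _ (fun x : R => x ^+ m.+3)); last exact: IH.
  exact: exprn_continuous.
have [_ b01 _] := wb; have /andP[b0 _] := b01 s.
have be0 k : 0 <= be k s by have [_ c01 _] := wbe k; case/andP: (c01 s).
apply/cvgrPdist_le => e e0.
have up : \forall k \near \oo, be k s <= b s + e.
  have [|m gap] := @pow_gap (b s) (b s + e); first by rewrite b0 ltrDl.
  have lt : psum b m.+3 - \sum_(0 <= i < s) b i ^+ m.+3 < (b s + e) ^+ m.+3.
    exact: le_lt_trans (psum_tail_le _ _ wb) gap.
  apply: filterS (cvgr_lt _ (tail m) _ lt) => k hk.
  have := le_lt_trans (psum_tail_ge m.+1 s (wbe k)) hk.
  by rewrite ltr_pXn2r ?nnegrE ?addr_ge0 ?(ltW e0)// => /ltW.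
have low : \forall k \near \oo, b s - e <= be k s.
  have [be_le|be_gt] := leP (b s - e) 0.
    by apply: nearW => k; exact: le_trans (be0 k).
  have [|m gap] := @pow_gap (b s - e) (b s); first by rewrite (ltW be_gt) gtrBl.
  have lt : (b s - e) ^+ m.+1 < psum b m.+3 - \sum_(0 <= i < s) b i ^+ m.+3.
    exact: lt_le_trans gap (psum_tail_ge _ _ wb).
  apply: filterS (cvgr_gt _ (tail m) _ lt) => k hk.
  have := lt_le_trans hk (psum_tail_le m.+1 s (wbe k)).
  by rewrite ltr_pXn2r ?nnegrE ?(ltW be_gt)// => /ltW.
by near=> k; rewrite ler_distlC; apply/andP; split; near: k.
Unshelve. all: by end_near. Qed.

End power_sums.

(** * Exponential moments *)

Section exponential_moments.
Context d {T : measurableType d} {R : realType} (P : probability T R).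
Implicit Types (U : T -> R) (K x th : R) (w : T).

(** Bounded second moments make the truncation error uniformly small. *)
Lemma Rintegral_truncate U K x : measurable_fun setT U -> (forall w, 0 <= U w) ->
  P.-integrable setT (EFin \o (fun w => U w ^+ 2)) -> \int[P]_w (U w ^+ 2) <= K ->
  0 < x -> `|\int[P]_w U w - \int[P]_w Num.min (U w) x| <= K / x.
Proof.
move=> mU U0 iU UK x0.
apply: (@le_trans _ _ (\int[P]_w (x^-1 * U w ^+ 2))).
  apply: Rintegral_dist.
  - exact: integrable_sqr_id.
  - apply: (@bounded_integrable _ _ _ _ _ x); first exact: measurable_minr.
    by move=> w; rewrite ger0_norm ?le_min ?U0 ?(ltW x0)// ge_min lexx orbT.
  - exact: integrable_scale.
  - move=> w; have [Ux|xU] := leP (U w) x.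
      by rewrite subrr normr0 mulr_ge0 ?sqr_ge0// invr_ge0 ltW.
    rewrite ger0_norm ?subr_ge0 ?(ltW xU)// [leRHS]mulrC ler_pdivlMr// expr2.
    have := U0 w; nra.
by rewrite RintegralZl// mulrC ler_wpM2r// invr_ge0 ltW.
Qed.

Lemma Rintegral_cvg_truncate (Uk : nat -> T -> R) U K :
  (forall k, measurable_fun setT (Uk k)) -> measurable_fun setT U ->
  (forall k w, 0 <= Uk k w) -> (forall w, 0 <= U w) ->
  (forall k, P.-integrable setT (EFin \o (fun w => Uk k w ^+ 2))) ->
  P.-integrable setT (EFin \o (fun w => U w ^+ 2)) ->
  (forall k, \int[P]_w (Uk k w ^+ 2) <= K) -> \int[P]_w (U w ^+ 2) <= K ->
  (forall x, 0 < x -> \int[P]_w Num.min (Uk k w) x @[k --> \oo] --> \int[P]_w Num.min (U w) x) ->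
  \int[P]_w Uk k w @[k --> \oo] --> \int[P]_w U w.
Proof.
move=> mUk mU Uk0 U0 iUk iU UkK UK tr; apply/cvgrPdist_le => e e0.
have K0 : 0 <= K by apply: le_trans UK; apply: Rintegral_ge0 => w _; exact: sqr_ge0.
pose x := 3 * (K + 1) / e.
have x0 : 0 < x by rewrite divr_gt0// mulr_gt0// ltr_wpDl.
have e3 : 0 < e / 3 by rewrite divr_gt0.
have Kx : K / x <= e / 3.
  have ex : e / 3 * x = K + 1 by rewrite /x; field; rewrite gt_eqF.
  by rewrite ler_pdivrMr// ex lerDl.
have := tr x x0 => /cvgrPdist_le/(_ _ e3); apply: filterS => k hk.
have h1 := le_trans (Rintegral_truncate (mUk k) (Uk0 k) (iUk k) (UkK k) x0) Kx.
have h2 := le_trans (Rintegral_truncate mU U0 iU UK x0) Kx.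
move: h1 h2 hk; rewrite !ler_norml => /andP[? ?] /andP[? ?] /andP[? ?].
apply/andP; split; lra.
Qed.

Variable C : nat -> T -> R.
Hypothesis mC : forall s, measurable_fun setT (C s).
Hypothesis lawC : forall s, has_law P (C s) chi2_1.
Hypothesis indC : mutually_independent P
  (fun s => preimage_set_system setT (C s) measurable).

Local Notation xi := (std_chi2 C).
Local Notation H c n := (block xi c 0 n).

Lemma log_rem3_ge0 (y : R) : 0 <= y -> 0 <= log_rem 3 y.
Proof.
move=> y0; rewrite log_remS; have := log_rem_le 1 y0.
by rewrite ler_norml expr1 mulN1r mulNr opprK => /andP[]; lra.
Qed.

Lemma measurable_expRN th : measurable_fun setT (fun x : R => expR (- (th * x))).
Proof. by apply: measurableT_comp => //; apply: measurableT_comp => //; exact: measurable_funM. Qed.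

(** Centring and standardizing fix the first two terms of the expansion of the
    logarithm, so that its third order remainder is left. *)
Lemma std_chi2_laplace s x : 0 <= x ->
  P.-integrable setT (EFin \o (fun w => expR (- (x * xi s w)))) /\
  \int[P]_w expR (- (x * xi s w)) = expR (x ^+ 2 / 2 - log_rem 3 (Num.sqrt 2 * x) / 2).
Proof.
move=> x0; set y := Num.sqrt 2 * x; have y0 : 0 <= y by rewrite mulr_ge0 ?sqrtr_ge0.
have s2 : Num.sqrt 2 ^+ 2 = 2 :> R by rewrite sqr_sqrtr.
have s0 : Num.sqrt 2 != 0 :> R by rewrite gt_eqF// sqrtr_gt0.
have sV : (Num.sqrt 2)^-1 = Num.sqrt 2 / 2 :> R.
  by apply: (mulfI s0); rewrite mulfV// mulrA -expr2 s2 divff.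
pose f (z : R) := expR (- (x * ((z - 1) / Num.sqrt 2))).
have mf : measurable_fun setT f.
  apply: (measurableT_comp (measurable_expRN x)); apply: measurable_funM => //.
  exact: measurable_funB.
have fE z : f (z ^+ 2) = expR (y / 2) * expR (- (y * z ^+ 2) / 2).
  by rewrite /f -expRD sV /y; congr expR; field.
have mg : measurable_fun setT (fun z : R => expR (- (y * z ^+ 2) / 2)).
  apply: measurableT_comp => //; apply: measurable_funM => //; apply: measurableT_comp => //.
  by apply: measurable_funM => //; exact: measurable_funX.
have ig : (@std_normal R).-integrable setT (EFin \o (fun z : R => expR (- (y * z ^+ 2) / 2))).
  apply: (@bounded_integrable _ _ _ _ _ 1) => // z.
  by rewrite ger0_norm ?expR_ge0// -expR0 ler_expR mulr_le0_ge0// oppr_le0 mulr_ge0 ?sqr_ge0.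
have ifz : (@std_normal R).-integrable setT (EFin \o (fun z : R => f (z ^+ 2))).
  by under eq_fun do rewrite fE; exact: integrable_scale.
split; first exact: (integrable_chi2_law (mC s) (lawC s) mf ifz).
rewrite /Rintegral (integral_chi2_law (mC s) (lawC s) mf).
rewrite -[LHS]/(\int[@std_normal R]_z f (z ^+ 2)).
under eq_Rintegral do rewrite fE.
rewrite RintegralZl// Rintegral_normal_gauss//.
have y1 : 0 < 1 + y by rewrite ltr_pwDl.
have -> : (Num.sqrt (1 + y))^-1 = expR (- (ln (1 + y) / 2)).
  rewrite expRN; congr (_^-1); apply/eqP; rewrite -(eqrXn2 (n := 2)) ?sqrtr_ge0 ?expR_ge0//.
  rewrite sqr_sqrtr ?(ltW y1)// -expRM_natl mulrC divfK// lnK ?posrE//.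
rewrite -expRD; congr expR; rewrite log_remS /log_rem big_nat1 expr1 /=.
rewrite (_ : x ^+ 2 = y ^+ 2 / 2); last by rewrite /y exprMn s2; field.
by field.
Qed.

Lemma block_laplace c n th : (forall s, 0 <= c s) -> 0 <= th ->
  P.-integrable setT (EFin \o (fun w => expR (- (th * H c n w)))) /\
  \int[P]_w expR (- (th * H c n w)) = expR (th ^+ 2 / 2 * \sum_(0 <= s < n) c s ^+ 2
    - (\sum_(0 <= s < n) log_rem 3 (Num.sqrt 2 * th * c s)) / 2).
Proof.
move=> c0 th0; elim: n => [|n [i E]].
  have E0 w : expR (- (th * H c 0 w)) = 1 by rewrite /block big_geq// mulr0 oppr0 expR0.
  under eq_Rintegral do rewrite E0; under eq_fun do rewrite E0.
  rewrite Rintegral_prob_cst !big_geq// mulr0 mul0r subr0 expR0; split => //.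
  exact: prob_integrable_cst.
have [ix] := std_chi2_laplace n (mulr_ge0 th0 (c0 n)); rewrite [Num.sqrt 2 * _]mulrA => Ex.
have ind := std_block_indep mC indC c n.
have [iM EM] := indep_Rintegral_mul (measurableT_comp (measurable_expRN th) (H_measurable mC c n))
  (measurableT_comp (measurable_expRN (th * c n)) (std_chi2_measurable mC n))
  (indep_fun_comp (measurable_expRN th) (measurable_expRN (th * c n)) ind) i ix.
have ME w : expR (- (th * H c n.+1 w)) = expR (- (th * H c n w)) * expR (- (th * c n * xi n w)).
  by rewrite -expRD /block big_nat_recr//=; congr expR; ring.
under eq_Rintegral do rewrite ME; under eq_fun do rewrite ME.
split => //; rewrite [LHS]EM [X in X * _]E [X in _ * X]Ex -expRD !big_nat_recr//=.
by congr expR; field.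
Qed.

End exponential_moments.

(** * Recovering the weights from the law of the limit *)

Section exponential_moments_of_the_limit.
Context d {T : measurableType d} {R : realType} (P : probability T R).
Variable C : nat -> T -> R.
Hypothesis mC : forall s, measurable_fun setT (C s).
Hypothesis lawC : forall s, has_law P (C s) chi2_1.
Hypothesis indC : mutually_independent P
  (fun s => preimage_set_system setT (C s) measurable).
Variables (b : nat -> R) (G : T -> R) (v : R).
Implicit Types (c : nat -> R) (th x : R) (n s : nat) (w : T).

Local Notation xi := (std_chi2 C).
Local Notation H c n := (block xi c 0 n).
Local Notation Y := (series C b G).

Hypothesis wb : weights b.
Hypothesis bv : \sum_(0 <= s < n) b s ^+ 2 @[n --> \oo] --> 1 - v.
Hypothesis v0 : 0 <= v.
Hypothesis mG : measurable_fun setT G.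
Hypothesis indG : forall n, indep_fun P (H b n) G.
Hypothesis iexpG : forall th, P.-integrable setT (EFin \o (fun w => expR (- (th * G w)))).
Hypothesis expG : forall th, \int[P]_w expR (- (th * G w)) = expR (th ^+ 2 * v / 2).

Let weights_ge0 c : weights c -> forall s, 0 <= c s.
Proof. by move=> [_ c01 _] s; case/andP: (c01 s). Qed.

Lemma exp_sqr th (X : T -> R) w : expR (- (th * X w)) ^+ 2 = expR (- (2 * th * X w)).
Proof. by rewrite expr2 -expRD; congr expR; ring. Qed.

Lemma partial_laplace n th : 0 <= th ->
  P.-integrable setT (EFin \o (fun w => expR (- (th * (H b n w + G w))))) /\
  \int[P]_w expR (- (th * (H b n w + G w))) =
  expR (th ^+ 2 / 2 * (\sum_(0 <= s < n) b s ^+ 2 + v)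
    - (\sum_(0 <= s < n) log_rem 3 (Num.sqrt 2 * th * b s)) / 2).
Proof.
move=> th0; have [iH EH] := block_laplace mC lawC indC n (weights_ge0 wb) th0.
have mexp := measurable_expRN th.
have [iM EM] := indep_Rintegral_mul (measurableT_comp mexp (H_measurable mC b n))
  (measurableT_comp mexp mG) (indep_fun_comp mexp mexp (indG n)) iH (iexpG th).
have ME w : expR (- (th * (H b n w + G w))) = expR (- (th * H b n w)) * expR (- (th * G w)).
  by rewrite -expRD; congr expR; ring.
under eq_Rintegral do rewrite ME; under eq_fun do rewrite ME.
split => //; rewrite [LHS]EM [X in X * _]EH [X in _ * X]expG -expRD.
by congr expR; field.
Qed.

Lemma sum_log_rem3_ge0 c n th : (forall s, 0 <= c s) -> 0 <= th ->
  0 <= \sum_(0 <= s < n) log_rem 3 (Num.sqrt 2 * th * c s).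
Proof.
move=> c0 th0; apply: sumr_ge0 => s _; apply: log_rem3_ge0.
by rewrite !mulr_ge0 ?sqrtr_ge0.
Qed.

Lemma partial_exp_sqr n th : 0 <= th ->
  P.-integrable setT (EFin \o (fun w => expR (- (th * (H b n w + G w))) ^+ 2)) /\
  \int[P]_w (expR (- (th * (H b n w + G w))) ^+ 2) <= expR (2 * th ^+ 2).
Proof.
move=> th0; have th2 : 0 <= 2 * th by rewrite mulr_ge0.
have E w := exp_sqr th (fun w => H b n w + G w) w.
under eq_fun do rewrite E.
have [i ->] := partial_laplace n th2; split => //; rewrite ler_expR.
have := sum_log_rem3_ge0 n (weights_ge0 wb) th2.
have := partial_var_le bv n; have := sqr_ge0 th.
set S := \sum_(0 <= s < n) b s ^+ 2; set L := \sum_(0 <= s < n) log_rem _ _.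
move=> h1 h2 h3; have := ler_wpM2l h1 h2; rewrite exprMn mulr1.
rewrite (_ : 2 ^+ 2 * th ^+ 2 / 2 * (S + v) = 2 * (th ^+ 2 * (S + v))); last by field.
by move=> h4; lra.
Qed.

Lemma exp_measurable (X : T -> R) th : measurable_fun setT X ->
  measurable_fun setT (fun w => expR (- (th * X w))).
Proof. by move=> mX; exact: (measurableT_comp (measurable_expRN th) mX). Qed.

Let mY : measurable_fun setT Y := series_measurable mC b mG.
Let cvgY := series_cvg mC lawC indC G wb.

Lemma exp_series_cvg th w : H b n w + G w @[n --> \oo] --> Y w ->
  expR (- (th * (H b n w + G w))) @[n --> \oo] --> expR (- (th * Y w)).
Proof.
move=> cw; apply: (@cvg_image _ (fun x : R => expR (- (th * x))) _ (Y w)) cw.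
apply: (@continuous_comp _ _ _ (fun x : R => - (th * x)) expR); last exact: continuous_expR.
by apply: cvgN; apply: cvgMl_tmp; exact: cvg_id.
Qed.

Lemma series_exp_sqr th : 0 <= th ->
  P.-integrable setT (EFin \o (fun w => expR (- (th * Y w)) ^+ 2)) /\
  \int[P]_w (expR (- (th * Y w)) ^+ 2) <= expR (2 * th ^+ 2).
Proof.
move=> th0.
apply: (@fatou_sqr _ _ _ P (fun n w => expR (- (th * (H b n w + G w)))) (fun w => expR (- (th * Y w)))).
- by move=> n; apply: exp_measurable; exact: partial_measurable.
- exact: exp_measurable.
- by move=> n; case: (partial_exp_sqr n th0).
- by move=> n; case: (partial_exp_sqr n th0).
- by apply: filterS cvgY => w; exact: exp_series_cvg.
Qed.

(** Uniform integrability carries the formula over from the partial sums. *)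
Lemma series_laplace th : 0 <= th ->
  \int[P]_w expR (- (th * Y w)) = expR (th ^+ 2 / 2 - rsum 3 b (Num.sqrt 2 * th) / 2).
Proof.
move=> th0; have [iY EY] := series_exp_sqr th0.
have c1 : \int[P]_w expR (- (th * (H b n w + G w))) @[n --> \oo] --> \int[P]_w expR (- (th * Y w)).
  apply: (@Rintegral_cvg_truncate _ _ _ P _ _ (expR (2 * th ^+ 2)) _ _ _ _ _ iY _ EY).
  - by move=> n; apply: exp_measurable; exact: partial_measurable.
  - exact: exp_measurable.
  - by move=> n w; exact: expR_ge0.
  - by move=> w; exact: expR_ge0.
  - by move=> n; case: (partial_exp_sqr n th0).
  - by move=> n; case: (partial_exp_sqr n th0).
  move=> x x0; apply: (@Rintegral_bounded_cvg _ _ _ _ _ _ x).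
  - by move=> n; apply: measurable_minr => //; apply: exp_measurable; exact: partial_measurable.
  - by apply: measurable_minr => //; exact: exp_measurable.
  - move=> n w; rewrite ger0_norm ?le_min ?expR_ge0 ?(ltW x0)// ge_min lexx orbT.
    by [].
  - apply: filterS cvgY => w Xw; have cw := @exp_series_cvg th w Xw.
    apply: (@cvg_image _ (fun y : R => Num.min y x) _ _ _ cw).
    by apply: (@continuous_min R R id (fun=> x)) => //; exact: cst_continuous.
have c2 : \int[P]_w expR (- (th * (H b n w + G w))) @[n --> \oo] -->
    expR (th ^+ 2 / 2 - rsum 3 b (Num.sqrt 2 * th) / 2).
  under eq_fun => n do rewrite (partial_laplace n th0).2.
  apply: (@cvg_image _ expR); first exact: continuous_expR.
  apply: cvgB.
    rewrite -[X in _ --> X]mulr1; apply: cvgMl_tmp.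
    by rewrite -[X in _ --> X](subrK v); apply: cvgD => //; exact: cvg_cst.
  by apply: cvgMr_tmp; apply: rsum_cvg => //; rewrite mulr_ge0 ?sqrtr_ge0.
exact: (cvg_unique _ c1 c2).
Qed.

Lemma weighted_sum_laplace c n th : weights c -> \sum_(0 <= s < n) c s ^+ 2 = 1 ->
  (forall s, (n <= s)%N -> c s = 0) -> 0 <= th ->
  \int[P]_w expR (- (th * H c n w)) = expR (th ^+ 2 / 2 - rsum 3 c (Num.sqrt 2 * th) / 2).
Proof.
move=> wc c1 c0 th0; have [_ ->] := block_laplace mC lawC indC n (weights_ge0 wc) th0.
have E : rsum 3 c (Num.sqrt 2 * th) = \sum_(0 <= s < n) log_rem 3 (Num.sqrt 2 * th * c s).
  apply: cvg_lim; first exact: Rhausdorff.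
  apply: cvg_near_cst; exists n => // N /= nN.
  rewrite (big_cat_nat (leq0n n) nN)/= [X in _ + X]big_nat_cond [X in _ + X]big1 ?addr0// => s.
  by rewrite andbT => /andP[/c0 -> _]; rewrite mulr0 log_rem0.
by rewrite E c1 mulr1.
Qed.

(** The weights can be read off from the law of the limit: exponential moments
    converge by uniform integrability, and their logarithms determine all power
    sums of the weights from the third on. *)
Lemma weights_cvg_of_law (be : nat -> nat -> R) (D : nat -> nat) :
  (forall k, weights (be k)) ->
  (forall k, \sum_(0 <= s < D k) be k s ^+ 2 = 1) ->
  (forall k s, (D k <= s)%N -> be k s = 0) ->
  (forall f : R -> R, continuous f -> (exists B, forall x, `|f x| <= B) ->
    \int[P]_w f (H (be k) (D k) w) @[k --> \oo] --> \int[P]_w f (Y w)) ->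
  forall s, be k s @[k --> \oo] --> b s.
Proof.
move=> wbe be1 be0 law; apply: weights_cvg_psum => //; apply: psums_cvg_rsum => // x x0.
have s2 : 0 < Num.sqrt 2 :> R by rewrite sqrtr_gt0.
pose th := x / Num.sqrt 2; have th0 : 0 <= th by rewrite divr_ge0 ?ltW.
have thx : Num.sqrt 2 * th = x by rewrite /th mulrC divfK// gt_eqF.
have [iY EY] := series_exp_sqr th0.
have E k := weighted_sum_laplace (wbe k) (be1 k) (be0 k).
have sqr k : P.-integrable setT (EFin \o (fun w => expR (- (th * H (be k) (D k) w)) ^+ 2)) /\
    \int[P]_w (expR (- (th * H (be k) (D k) w)) ^+ 2) <= expR (2 * th ^+ 2).
  have th2 : 0 <= 2 * th by rewrite mulr_ge0.
  have EE w := exp_sqr th (H (be k) (D k)) w.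
  under eq_fun do rewrite EE.
  have [i ->] := block_laplace mC lawC indC (D k) (weights_ge0 (wbe k)) th2.
  split => //; rewrite ler_expR be1 mulr1.
  have := sum_log_rem3_ge0 (D k) (weights_ge0 (wbe k)) th2.
  set L := \sum_(0 <= s < _) _ => L0; rewrite exprMn.
  by rewrite (_ : 2 ^+ 2 * th ^+ 2 / 2 = 2 * th ^+ 2); [lra|field].
have c1 : \int[P]_w expR (- (th * H (be k) (D k) w)) @[k --> \oo] --> \int[P]_w expR (- (th * Y w)).
  apply: (@Rintegral_cvg_truncate _ _ _ P _ _ (expR (2 * th ^+ 2)) _ _ _ _ _ iY _ EY).
  - by move=> k; apply: exp_measurable; exact: H_measurable.
  - exact: exp_measurable.
  - by move=> k w; exact: expR_ge0.
  - by move=> w; exact: expR_ge0.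
  - by move=> k; case: (sqr k).
  - by move=> k; case: (sqr k).
  move=> y y0; apply: (law (fun x : R => Num.min (expR (- (th * x))) y)).
    move=> z; apply: (@continuous_min R R (fun x : R => expR (- (th * x))) (fun=> y)).
      apply: (@continuous_comp _ _ _ (fun x : R => - (th * x)) expR); last exact: continuous_expR.
      by apply: cvgN; apply: cvgMl_tmp; exact: cvg_id.
    exact: cst_continuous.
  exists y => z; rewrite ger0_norm ?le_min ?expR_ge0 ?(ltW y0)// ge_min lexx orbT.
  by [].
have rE c : rsum 3 c x = th ^+ 2 - 2 * ln (expR (th ^+ 2 / 2 - rsum 3 c x / 2)).
  by rewrite expRK; field.
rewrite rE; under eq_fun do rewrite rE.
apply: cvgB; first exact: cvg_cst.
have cE : expR (th ^+ 2 / 2 - rsum 3 (be k) x / 2) @[k --> \oo] -->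
    expR (th ^+ 2 / 2 - rsum 3 b x / 2).
  have := series_laplace th0; rewrite thx => <-.
  have E' k := E th k th0; under eq_fun => k do rewrite -[X in rsum 3 _ X]thx -E'.
  exact: c1.
apply: cvgMl_tmp.
exact: (@cvg_image R (@ln R) _ _ (continuous_ln (expR_gt0 _)) cE).
Qed.

End exponential_moments_of_the_limit.

(** * Convergence in distribution of the statistic *)

Section convergence_in_distribution.
Context {R : realType} {d : nat -> measure_display} {T : forall k, measurableType (d k)}.
Context (P : forall k, probability (T k) R) (X : forall k, T k -> R).
Context {d' : measure_display} {T' : measurableType d'} (P' : probability T' R) (Y : T' -> R).

Lemma bounded_expectationE d0 (T0 : measurableType d0) (P0 : probability T0 R)
    (X0 : T0 -> R) (f : R -> R) : measurable_fun setT X0 -> continuous f ->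
  (exists B, forall x, `|f x| <= B) -> ('E_P0[f \o X0])%E = (\int[P0]_w f (X0 w))%:E.
Proof.
move=> mX fc [B fB]; apply: expectationE; apply: (@bounded_integrable _ _ _ _ _ B).
  exact: (measurableT_comp (continuous_measurable_fun fc) mX).
by move=> w; exact: fB.
Qed.

Lemma cvg_in_distributionE : (forall k, measurable_fun setT (@X k)) ->
  measurable_fun setT Y ->
  cvg_in_distribution P (@X) P' Y <->
  forall f : R -> R, continuous f -> (exists B, forall x, `|f x| <= B) ->
    \int[P k]_w f (@X k w) @[k --> \oo] --> \int[P']_w f (Y w).
Proof.
move=> mX mY; split=> [[_ _ XY] f fc fB|XY].
  have := XY f fc fB; rewrite bounded_expectationE//.
  under eq_fun do rewrite (bounded_expectationE _ (mX _))//.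
  by move=> /fine_cvg.
split=> // f fc fB; rewrite bounded_expectationE//.
under eq_fun do rewrite (bounded_expectationE _ (mX _))//.
by apply: (cvg_comp _ _ (XY f fc fB)).
Qed.

End convergence_in_distribution.

Section chi2_and_normal.
Context d {T : measurableType d} {R : realType} (P : probability T R).
Variables (C : nat -> T -> R) (Z : T -> R).
Hypothesis mC : forall s, measurable_fun setT (C s).
Hypothesis mZ : measurable_fun setT Z.
Hypothesis lawZ : has_law P Z (normal_prob 0 1).
Hypothesis ind : mutually_independent P (fun o : option nat =>
  preimage_set_system setT (if o is Some s then C s else Z) measurable).

Let X (o : option nat) : T -> R := if o is Some s then C s else Z.

Let mX o : measurable_fun setT (X o). Proof. by case: o. Qed.

Lemma chi2_independent : mutually_independent P
  (fun s => preimage_set_system setT (C s) measurable).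
Proof.
move=> J E uJ JE; pose E' (o : option nat) := if o is Some s then E s else setT.
have := ind (J := map Some J) (E := E').
rewrite map_inj_uniq ?big_map; last by move=> ? ? [].
move=> /(_ uJ) <-.
  congr (P _); apply/seteqP; split => [w Ew o /= /mapP[s sJ ->]|w Ew s /= sJ].
    exact: Ew.
  exact: (Ew (Some s) (map_f _ sJ)).
by move=> _ /mapP[s sJ ->]; exact: JE.
Qed.

Lemma chi2_normal_indep b n (x : R) :
  indep_fun P (block (std_chi2 C) b 0 n) (fun w => x * Z w).
Proof.
have mx : measurable_fun setT (fun y : R => x * y) by exact: measurable_funM.
have mg : measurable_fun setT (fun y : R => (y - 1) / Num.sqrt 2).
  by apply: measurable_funM => //; exact: measurable_funB.
apply: (@indep_fun_comp _ _ _ P _ _ id _ _ mx) => //.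
apply: (@depends_on_indep _ _ _ P _ _ (map Some (index_iota 0 n)) [:: None] _ _
  (preimage_system_setT X) (preimage_system_setI (C := X))
  (preimage_system_measurable mX) ind).
- rewrite cat_uniq map_inj_uniq ?iota_uniq; last by move=> ? ? [].
  by rewrite /= orbF andbT; apply/mapP => -[].
- apply: depends_on_sum => s sJ; apply: depends_onM; first exact: depends_on_cst.
  apply: (depends_on_comp mg).
  exact: (depends_on_mem (preimage_system_setT X) (map_f Some sJ)).
- exact: (depends_on_mem (preimage_system_setT X) (mem_head None [::])).
Qed.

Lemma Rintegral_std_normal (f : R -> R) : measurable_fun setT f ->
  \int[P]_w f (Z w) = \int[@std_normal R]_x f x.
Proof. by move=> mf; rewrite /Rintegral (integral_std_normal_law mZ lawZ mf). Qed.

Lemma scaled_normal_cos (x a t : R) :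
  \int[P]_w cos (a + t * (x * Z w)) = expR (- (t ^+ 2 * x ^+ 2) / 2) * cos a.
Proof.
rewrite -exprMn -Rintegral_normal_cos -Rintegral_std_normal.
  by apply: eq_Rintegral => w _; rewrite mulrA.
exact: (cos_affine_measurable a (t * x) (@measurable_id _ _ setT)).
Qed.

Lemma scaled_normal_sqr (x : R) :
  P.-integrable setT (EFin \o (fun w => (x * Z w) ^+ 2)) /\
  \int[P]_w ((x * Z w) ^+ 2) = x ^+ 2.
Proof.
have m2 : measurable_fun setT (fun y : R => y ^+ 2) by exact: measurable_funX.
have i2 := integrable_std_normal_law mZ lawZ m2 (integrable_normal_pow 2).
under eq_fun do rewrite exprMn; split; first exact: integrable_scale.
by rewrite RintegralZl// (Rintegral_std_normal m2) Rintegral_normal_sqr mulr1.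
Qed.

Lemma scaled_normal_mean (x : R) : \int[P]_w (x * Z w) = 0.
Proof.
have i1 := integrable_std_normal_law mZ lawZ (@measurable_id _ _ setT) (integrable_normal_pow 1).
by rewrite RintegralZl// (Rintegral_std_normal (@measurable_id _ _ setT)) Rintegral_normal_id mulr0.
Qed.

Lemma scaled_normal_expR (x th : R) :
  P.-integrable setT (EFin \o (fun w => expR (- (th * (x * Z w))))) /\
  \int[P]_w expR (- (th * (x * Z w))) = expR (th ^+ 2 * x ^+ 2 / 2).
Proof.
have E w : expR (- (th * (x * Z w))) = expR (- (th * x) * Z w) by congr expR; ring.
have mf : measurable_fun setT (fun y : R => expR (- (th * x) * y)).
  by apply: measurableT_comp => //; exact: measurable_funM.
under eq_fun do rewrite E; split.
  exact: (integrable_std_normal_law mZ lawZ mf (integrable_expR _)).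
by rewrite (Rintegral_std_normal mf) Rintegral_normal_expR sqrrN exprMn.
Qed.

End chi2_and_normal.

Section model_sequence.
Context {R : realType} (M : nat -> model R) (lam : nat -> seq R).
Hypothesis hlam : forall k, ordered_eigenvalues
  (hyp (M k) *m V_mx (M k) *m hyp (M k)) (lam k).
Hypothesis hH0 : forall k, H0 (M k).
Context d {T : measurableType d} (P : probability T R) (C : nat -> T -> R).
Hypothesis mC : forall s, measurable_fun setT (C s).
Hypothesis lawC : forall s, has_law P (C s) chi2_1.
Hypothesis indC : mutually_independent P
  (fun s => preimage_set_system setT (C s) measurable).

(** Only the laws of the statistics matter, so that all of them can be realized
    on the space of the limit as weighted sums of the same variables. *)
Lemma W_cvg_in_distributionE (Y : T -> R) : measurable_fun setT Y ->
  cvg_in_distribution (fun k => prob (M k)) (fun k => W_stat (m := M k)) P Y <->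
  forall f : R -> R, continuous f -> (exists B, forall x, `|f x| <= B) ->
    \int[P]_w f (block (std_chi2 C) (beta (lam k)) 0 (total_dim (M k)) w) @[k --> \oo] -->
    \int[P]_w f (Y w).
Proof.
move=> mY; have mW k := W_measurable (m := M k).
apply: (iff_trans (cvg_in_distributionE (fun k => prob (M k)) P mW mY)).
have E (f : R -> R) : continuous f -> (exists B, forall x, `|f x| <= B) ->
    (fun k => \int[prob (M k)]_w f (W_stat w)) =
    (fun k => \int[P]_w f (block (std_chi2 C) (beta (lam k)) 0 (total_dim (M k)) w)).
  move=> fc [B fB]; apply/funext => k.
  exact: (W_law mC lawC indC (hlam k) (hH0 k) fc fB).
by split=> h f fc fB; have := h f fc fB; rewrite E.
Qed.

End model_sequence.

Section limit_laws.
Context {R : realType} d {T : measurableType d} (P : probability T R).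
Variables (C : nat -> T -> R) (b : nat -> R).
Hypothesis wb : weights b.

Let S := limn (fun n => \sum_(0 <= s < n) b s ^+ 2).

Lemma sum_sqr_lim_le1 : S <= 1.
Proof. by have [_ _ b1] := wb; apply: limr_le; [exact: sum_sqr_cvg|exact: nearW]. Qed.

Lemma limit_variableE (Z : T -> R) :
  limit_variable b C Z = series C b (fun w => Num.sqrt (1 - S) * Z w).
Proof.
have [db b01 _] := wb; have b0 s : 0 <= b s by case/andP: (b01 s).
apply/funext => w; rewrite /limit_variable /chi2_part /series; congr (_ + _ * _).
  by apply: sum_upto_nonzero => // s ->; rewrite mul0r.
by congr (Num.sqrt (1 - _)); apply: sum_upto_nonzero => // s ->; rewrite expr0n.
Qed.

Lemma chi2_part_infinite : chi2_part +oo%E b C = series C b (fun=> 0).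
Proof. by apply/funext => w; rewrite /chi2_part /series sum_upto_infinite addr0. Qed.

End limit_laws.

Unset Implicit Arguments.

Theorem theorem3p1 (R : realType) (M : nat -> model R) (lam : nat -> seq R)
    (hlam : forall k, ordered_eigenvalues
       (hyp (M k) *m V_mx (M k) *m hyp (M k)) (lam k))
    (hH0 : forall k, H0 (M k))
    (hF : F1 M \/ F2 M \/ F3 M) :
  (forall b : nat -> R,
     nonincreasing_seq b ->
     (forall s, 0 <= b s <= 1) ->
     (\sum_(0 <= s <oo) ((b s) ^+ 2)%:E <= 1)%E ->
     forall (d : measure_display) (T : measurableType d) (P : probability T R)
       (C : nat -> {RV P >-> R}) (Z : {RV P >-> R}),
     (forall s, has_law P (C s) chi2_1) ->
     has_law P Z (normal_prob 0 1) ->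
     mutually_independent P (fun o : option nat =>
       preimage_set_system setT (if o is Some s then C s else Z) measurable) ->
     (cvg_in_distribution (fun k => prob (M k)) (fun k => W_stat (m := M k))
        P (limit_variable b C Z)
      <-> forall s, beta (lam k) s @[k --> \oo] --> b s)) /\
  (forall b : nat -> R,
     nonincreasing_seq b ->
     (forall s, 0 < b s < 1) ->
     (\sum_(0 <= s <oo) ((b s) ^+ 2)%:E = 1)%E ->
     (forall s, beta (lam k) s @[k --> \oo] --> b s) ->
     forall (d : measure_display) (T : measurableType d) (P : probability T R)
       (C : nat -> {RV P >-> R}),
     (forall s, has_law P (C s) chi2_1) ->
     mutually_independent P (fun s : nat =>
       preimage_set_system setT (C s) measurable) ->
     cvg_in_distribution (fun k => prob (M k)) (fun k => W_stat (m := M k))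
       P (chi2_part +oo%E b C)).
Proof.
have wbe k := beta_weights (hlam k).
have be1 k := sum_beta (hlam k).
have be0 k s := @beta_default _ _ _ (hlam k) s.
split=> [b db b01 b1 d T P C Z lawC lawZ ind|b db b01 b1 beb d T P C lawC indC].
  have mC s : measurable_fun setT (C s) by exact: measurable_funP.
  have mZ : measurable_fun setT Z by exact: measurable_funP.
  have b1' := partial_sums_le1 b1.
  have wb : weights b by split.
  have indC := chi2_independent ind.
  rewrite (limit_variableE C wb).
  (* The normal part has variance [1 - S]. *)
  set S := limn _; set x := Num.sqrt (1 - S).
  have v0 : 0 <= 1 - S by rewrite subr_ge0 sum_sqr_lim_le1.
  have xv : x ^+ 2 = 1 - S by rewrite sqr_sqrtr.
  have mG : measurable_fun setT (fun w => x * Z w) by exact: measurable_funM.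
  have bv : \sum_(0 <= s < n) b s ^+ 2 @[n --> \oo] --> 1 - x ^+ 2.
    by rewrite xv opprB addrC subrK; exact: sum_sqr_cvg.
  have [iG EG2] := scaled_normal_sqr mZ lawZ x.
  have indG n := chi2_normal_indep mC mZ ind b n x.
  apply: (iff_trans (W_cvg_in_distributionE hlam hH0 mC lawC indC (series_measurable mC b mG))).
  split=> [law|beb].
    apply: (weights_cvg_of_law mC lawC indC wb bv mG indG _ _ wbe be1 be0 law) => th.
      by case: (scaled_normal_expR mZ lawZ x th).
    by case: (scaled_normal_expR mZ lawZ x th).
  move=> f fc [B fB].
  exact: (weighted_sums_cvg_law mC lawC indC wb bv mG indG
    (fun a t => scaled_normal_cos mZ lawZ x a t) iG (scaled_normal_mean mZ lawZ x) EG2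
    wbe be1 be0 beb fc fB).
have mC s : measurable_fun setT (C s) by exact: measurable_funP.
have b1' : forall n, \sum_(0 <= s < n) b s ^+ 2 <= 1 by apply: partial_sums_le1; rewrite b1.
have wb : weights b.
  by split=> // s; case/andP: (b01 s) => b0 bs1; rewrite (ltW b0) (ltW bs1).
(* The weights exhaust the variance, so that the normal part is zero. *)
rewrite chi2_part_infinite.
have bv : \sum_(0 <= s < n) b s ^+ 2 @[n --> \oo] --> 1 - (0 : R).
  rewrite subr0; have := sum_sqr_lim b1'; rewrite b1 => -[->].
  exact: sum_sqr_cvg.
have mG : measurable_fun setT (fun _ : T => 0 : R) by exact: measurable_cst.
have indG n : indep_fun P (block (std_chi2 C) b 0 n) (fun=> 0) by exact: indep_fun_cst.
apply/(W_cvg_in_distributionE hlam hH0 mC lawC indC (series_measurable mC b mG)).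
move=> f fc [B fB].
apply: (weighted_sums_cvg_law mC lawC indC wb bv mG indG _ _ _ _ wbe be1 be0 beb fc fB).
- by move=> a t; under eq_Rintegral do rewrite mulr0 addr0; rewrite Rintegral_prob_cst mulr0 oppr0 mul0r expR0 mul1r.
- by rewrite expr0n; exact: prob_integrable_cst.
- exact: Rintegral_prob_cst.
- by under eq_Rintegral do rewrite expr0n; exact: Rintegral_prob_cst.
Qed.
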